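(* Let $\mathcal M,\mathcal N$ be Hilbert spaces. If $\mathcal H$ is a Hilbert space and $\begin{pmatrix}A&B\\C&D\end{pmatrix}$ is a co-isometry from $\begin{pmatrix}\mathcal H\\ \mathcal M\end{pmatrix}$ to $\begin{pmatrix}\mathcal H\\ \mathcal N\end{pmatrix}$, then for every $\mu>1$ the kernel $$K^{S_\mu}(z,w)=\sum_{n=0}^\infty\frac{z^{(n)}\overline{w^{(n)}}I_{\mathcal N}-(Z_+^nS_\mu)(z)(Z_+^nS_\mu)(w)^*}{\mu^{2n}},\qquad z,w\in\mathbf V(\Lambda),\qquad(\ast)$$ where $S_\mu$ is the associated $\mu$-dilated DA Schur function, is of the form $K^{S_\mu}(z,w)=F(z)F(w)^*$, with $$F(z)=C\left(I-z\frac{A}{\mu}\right)^{-\odot}.$$ In particular, the kernel $(\ast)$ is positive in this case. Conversely, if $\mu>1$ and an $\mathbf L(\mathcal M,\mathcal N)$-valued DA function $S_\mu(z)$ are such that the kernel $(\ast)$ is positive, then there exist a Hilbert space $\mathcal H$ and a co-isometry $\begin{pmatrix}A&B\\C&D\end{pmatrix}$ from $\begin{pmatrix}\mathcal H\\ \mathcal M\end{pmatrix}$ to $\begin{pmatrix}\mathcal H\\ \mathcal N\end{pmatrix}$ such that $S_\mu(z)$ is the associated $\mu$-dilated DA Schur function.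
   Context: Rhombic lattice: $\Lambda$ is a monohedral (edge-to-edge) tessellation of $\mathbb C$ by mutually congruent (nondegenerate) rhombi of side length 1, viewed as a planar graph with vertex set $\mathbf V(\Lambda)$, (undirected) edge set $\mathbf E(\Lambda)$ and face set $\mathbf F(\Lambda)$ (the rhombi). $\hat{\mathbf E}(\Lambda)=\{b-a:(a,b)\in\mathbf E(\Lambda)\}$ is the set of edge directions; it is finite and closed under $e\mapsto -e$. A path from $a$ to $b$ is a finite sequence $(z_0=a,z_1,\dots,z_N=b)$ of vertices with consecutive ones adjacent; it is closed if $a=b$. Standing assumptions: $0\in\mathbf V(\Lambda)$; $1\in\hat{\mathbf E}(\Lambda)$; and both sides of every track $F$ in $\Lambda$ contain tracks that are coherent to $F$. Here a track is a sequence $(F_n)_{n\in\mathbb Z}$ of faces such that for every $n$ the faces $F_n,F_{n+1}$ are adjacent and the edges shared by $F_n$ with $F_{n+1}$ and with $F_{n-1}$ are two opposite sides of $F_n$; these shared edges are the ties of the track. The sides of a track are the two connected components of the graph obtained by deleting all ties of the track from $\mathbf E(\Lambda)$. Two tracks are coherent if their ties are parallel. DA functions: for $f:\mathbf V(\Lambda)\to\mathcal V$ ($\mathcal V$ a complex vector space) and a path $\gamma=(z_0,\dots,z_N)$, $\int_\gamma f\,\delta z=\sum_{n=1}^N\frac{f(z_{n-1})+f(z_n)}{2}(z_n-z_{n-1})$. $f$ is DA if $\int_\gamma f\,\delta z=0$ for every closed path $\gamma$; $\int_a^b f\,\delta z$ denotes the then path-independent integral along any path from $a$ to $b$. The forward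 shift $Z_+$ on DA functions is $(Z_+f)(z)=\frac{f(0)-f(z)}{2}+\int_0^z f\,\delta z$ (again a DA function). Basis: $z^{(0)}=1$ and $z^{(n)}=Z_+z^{(n-1)}$ for $n\ge1$; in particular $z^{(1)}=z$. Notation: $\mathbf L(\mathcal M,\mathcal N)$ is the Banach space of bounded linear operators from $\mathcal M$ to $\mathcal N$. Convolution product with a DA polynomial $p(z)=\sum_{n=0}^N A_nz^{(n)}$ (operator coefficients): $(p\odot f)(z)=\sum_n A_n(Z_+^nf)(z)$ and $(g\odot p)(z)=\sum_n (Z_+^ng)(z)A_n$ for operator-valued DA functions $f,g$ of compatible types. Let $\mathbf S(\Lambda)=\{t\in\mathbb C:2+t(1-e)=0\text{ for some }e\in\hat{\mathbf E}(\Lambda)\}$, a finite subset of the complement of the open unit disk. If $T$ is a bounded operator on a Hilbert space with $\sigma(T)\cap\mathbf S(\Lambda)=\emptyset$, then $(I-zT)^{-\odot}$ denotes the $\odot$-inverse of the DA polynomial $I-zT$, i.e. the operator-valued DA function $G$ with $G\odot(I-zT)=(I-zT)\odot G=I$; it is given by $G(z)=\prod_{k=1}^N\big((2I+(1+z_k-z_{k-1})T)(2I+(1+z_{k-1}-z_k)T)^{-1}\big)$ for any path $(z_0,\dots,z_N)$ from $0$ to $z$. Schur functions: given a Hilbert space $\mathcal H$, a co-isometry $\begin{pmatrix}A&B\\C&D\end{pmatrix}:\mathcal H\oplus\mathcal M\to\mathcal H\oplus\mathcal N$ and $\mu>1$, the associated $\mu$-dilated $\mathbf L(\mathcal M,\mathcal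 N)$-valued DA Schur function is $$S_\mu(z)=D+C\left(I-z\tfrac{A}{\mu}\right)^{-\odot}\odot\left(z\tfrac{B}{\mu}\right).$$ An $\mathbf L(\mathcal N)$-valued kernel $K$ on $\mathbf V(\Lambda)$ is positive if $\sum_{i,j}\langle K(w_i,w_j)\zeta_j,\zeta_i\rangle_{\mathcal N}\ge0$ for all finite families $w_i\in\mathbf V(\Lambda)$, $\zeta_i\in\mathcal N$. *)

(* Defs.v *)
From HB Require Import structures.
From mathcomp Require Import all_boot all_order all_algebra.
From mathcomp Require Import complex.
From mathcomp Require Import all_classical all_reals all_analysis.
From mathcomp Require Import ring.

Set Implicit Arguments.
Unset Strict Implicit.
Unset Printing Implicit Defensive.

Import Order.TTheory GRing.Theory Num.Theory numFieldNormedType.Exports.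

Local Open Scope classical_set_scope.
Local Open Scope ring_scope.

(* Inner products are linear in the first argument. *)
HB.mixin Record isHilbert (R : realType) V & CompleteNormedModule R[i] V := {
  dot : V -> V -> R[i] ;
  dotDl : forall x y z, dot (x + y) z = dot x z + dot y z ;
  dotZl : forall (a : R[i]) x y, dot (a *: x) y = a * dot x y ;
  dotC : forall x y, dot y x = (dot x y)^* ;
  dot_normE : forall x, dot x x = `|x| ^+ 2
}.

#[short(type="hilbertType")]
HB.structure Definition Hilbert (R : realType) :=
  {V of CompleteNormedModule R[i] V & isHilbert R V}.

(* The Hilbert direct sum; the alias hides the sup norm that the library puts
   on pairs. *)
Definition dsum (R : realType) (H M : hilbertType R) : Type := (H * M)%type.

Lemma sqrtC_sqrD_triangle (C : numClosedFieldType) (a b c d : C) :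
  0 <= a -> 0 <= b -> 0 <= c -> 0 <= d ->
  sqrtC ((a + b) ^+ 2 + (c + d) ^+ 2) <=
  sqrtC (a ^+ 2 + c ^+ 2) + sqrtC (b ^+ 2 + d ^+ 2).
Proof.
move=> a0 b0 c0 d0.
have sqD (x y : C) : 0 <= x -> 0 <= y -> 0 <= x ^+ 2 + y ^+ 2.
  by move=> x0 y0; rewrite addr_ge0 ?exprn_ge0.
rewrite -(@ler_pXn2r _ 2) ?nnegrE ?addr_ge0 ?sqrtC_ge0 ?sqD ?addr_ge0//.
rewrite sqrtCK [leRHS]sqrrD !sqrtCK.
have cs : a * b + c * d <= sqrtC (a ^+ 2 + c ^+ 2) * sqrtC (b ^+ 2 + d ^+ 2).
  rewrite -(@ler_pXn2r _ 2) ?nnegrE ?addr_ge0 ?mulr_ge0 ?sqrtC_ge0 ?sqD//.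
  rewrite exprMn !sqrtCK -subr_ge0.
  have -> : (a ^+ 2 + c ^+ 2) * (b ^+ 2 + d ^+ 2) - (a * b + c * d) ^+ 2 =
            (a * d - b * c) ^+ 2.
    by rewrite !expr2; ring.
  by rewrite -real_normK ?exprn_ge0// realB// realM ?ger0_real.
rewrite -subr_ge0 in cs; rewrite -subr_ge0.
rewrite (_ : _ - _ = (sqrtC (a ^+ 2 + c ^+ 2) * sqrtC (b ^+ 2 + d ^+ 2) -
  (a * b + c * d)) *+ 2); first by rewrite mulrn_wge0.
by rewrite -[RHS]mulr_natr !expr2; ring.
Qed.

Section DirectSum.
Context (R : realType) (H M : hilbertType R).
Local Notation V := (dsum H M).
Local Notation C := R[i].

HB.instance Definition _ := GRing.Lmodule.copy V (H * M)%type.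

Definition dsum_norm (x : V) : C := sqrtC (`|x.1| ^+ 2 + `|x.2| ^+ 2).

Lemma dsum_normD x y : dsum_norm (x + y) <= dsum_norm x + dsum_norm y.
Proof.
apply: (le_trans _ (sqrtC_sqrD_triangle _ _ _ _)) => //.
rewrite ler_sqrtC ?qualifE/= ?addr_ge0 ?exprn_ge0 ?addr_ge0//.
by rewrite lerD// ler_pXn2r ?nnegrE ?addr_ge0// ler_normD.
Qed.

Lemma dsum_normZ (l : C) x : dsum_norm (l *: x) = `|l| * dsum_norm x.
Proof.
rewrite /dsum_norm /= !normrZ !exprMn -mulrDr rootCMl ?exprn_ge0//.
by rewrite sqrCK.
Qed.

Lemma dsum_norm_eq0 x : dsum_norm x = 0 -> x = 0.
Proof.
move=> /eqP; rewrite sqrtC_eq0 paddr_eq0 ?exprn_ge0// !expf_eq0 /= !normr_eq0.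
by move=> /andP[/eqP x1 /eqP x2]; apply: injective_projections.
Qed.

HB.instance Definition _ :=
  Lmodule_isNormed.Build C V dsum_normD dsum_normZ dsum_norm_eq0.

Lemma dsum_normE (x : V) : `|x| = sqrtC (`|x.1| ^+ 2 + `|x.2| ^+ 2).
Proof. by []. Qed.

Lemma dsum_norm1 (x : V) : `|x.1| <= `|x|.
Proof.
rewrite dsum_normE -[leLHS]sqrCK// ler_sqrtC ?qualifE/= ?addr_ge0 ?exprn_ge0//.
by rewrite lerDl exprn_ge0.
Qed.

Lemma dsum_norm2 (x : V) : `|x.2| <= `|x|.
Proof.
rewrite dsum_normE -[leLHS]sqrCK// ler_sqrtC ?qualifE/= ?addr_ge0 ?exprn_ge0//.
by rewrite lerDr exprn_ge0.
Qed.

Lemma dsum_norm_le (x : V) : `|x| <= `|x.1| + `|x.2|.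
Proof.
rewrite dsum_normE -[leRHS]sqrCK ?addr_ge0// ler_sqrtC ?qualifE/= ?addr_ge0 ?exprn_ge0 ?addr_ge0//.
by rewrite sqrrD -addrA lerD2l lerDr mulrn_wge0 ?mulr_ge0.
Qed.

Lemma dsum_complete (F : set_system V) : ProperFilter F -> cauchy F -> cvg F.
Proof.
move=> FF /cauchyP Fc.
pose p1 (x : V) : H := x.1; pose p2 (x : V) : M := x.2.
have c1 : cauchy (p1 @ F).
  apply: cauchy_exP => e e0; have [x Fx] := Fc e e0; exists x.1.
  apply: (@filterS _ F _ (ball x e)) => // y; rewrite -!ball_normE /=.
  exact: le_lt_trans (dsum_norm1 (x - y)).
have c2 : cauchy (p2 @ F).
  apply: cauchy_exP => e e0; have [x Fx] := Fc e e0; exists x.2.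
  apply: (@filterS _ F _ (ball x e)) => // y; rewrite -!ball_normE /=.
  exact: le_lt_trans (dsum_norm2 (x - y)).
have l1P := (@cvgrPdist_lt _ H _ F _ p1 _).1 (@cauchy_cvg H (p1 @ F) _ c1).
have l2P := (@cvgrPdist_lt _ M _ F _ p2 _).1 (@cauchy_cvg M (p2 @ F) _ c2).
pose l : V := (lim (p1 @ F), lim (p2 @ F)); apply: (@cvgP V F l).
apply: (@cvgrPdist_lt _ V _ F _ id _).2 => e e0.
have e20 : 0 < e / 2 by rewrite divr_gt0.
apply: filterS2 (l1P _ _ _ e20) (l2P _ _ _ e20) => x xl1 xl2.
apply: le_lt_trans (dsum_norm_le _) _.
by rewrite (splitr e) ltrD.
Qed.

HB.instance Definition _ := Uniform_isComplete.Build V dsum_complete.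

Definition dsum_dot (x y : V) : C := dot x.1 y.1 + dot x.2 y.2.

Lemma dsum_dotDl x y z : dsum_dot (x + y) z = dsum_dot x z + dsum_dot y z.
Proof. by rewrite /dsum_dot !dotDl addrACA. Qed.

Lemma dsum_dotZl (a : C) x y : dsum_dot (a *: x) y = a * dsum_dot x y.
Proof. by rewrite /dsum_dot !dotZl mulrDr. Qed.

Lemma dsum_dotC x y : dsum_dot y x = (dsum_dot x y)^*.
Proof. by rewrite /dsum_dot rmorphD /= -!dotC. Qed.

Lemma dsum_dot_normE (x : V) : dsum_dot x x = `|x| ^+ 2.
Proof. by rewrite /dsum_dot !dot_normE sqrtCK. Qed.

HB.instance Definition _ := isHilbert.Build R V
  dsum_dotDl dsum_dotZl dsum_dotC dsum_dot_normE.

End DirectSum.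

Section BoundedOperators.
Context (R : realType) (M N : hilbertType R).
Local Notation C := R[i].

(* [bop M N] is the normed space L(M, N) of bounded linear operators. *)
Definition is_bop : {pred M -> N} := fun f =>
  `[< linear f /\ exists k : C, forall x, `|f x| <= k * `|x| >].

Record bop := Bop { bop_fun :> M -> N ; _ : bop_fun \in is_bop }.

HB.instance Definition _ := [isSub for bop_fun].
HB.instance Definition _ := [Choice of bop by <:].

Lemma is_bop_closed : submod_closed is_bop.
Proof.
split=> [|a f g].
  apply/asboolP; split=> [b x y|].
    by rewrite -[LHS]/(0 : N) -[0 x]/(0 : N) -[0 y]/(0 : N) scaler0 addr0.
  by exists 0 => x; rewrite -[0 x]/(0 : N) normr0 mul0r.
move=> /asboolP[fl [k fk]] /asboolP[gl [l gl']]; apply/asboolP; split.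
  move=> b x y; have E z : (a *: f + g) z = a *: f z + g z by [].
  by rewrite !E fl gl !scalerDr !scalerA addrACA [a * b]mulrC.
exists (`|a| * k + l) => x; rewrite mulrDl -mulrA.
have -> : (a *: f + g) x = a *: f x + g x by [].
apply: le_trans (ler_normD _ _) _; apply: lerD => //.
by rewrite normrZ ler_wpM2l.
Qed.

HB.instance Definition _ := GRing.isSubmodClosed.Build C (M -> N) is_bop
  is_bop_closed.
HB.instance Definition _ := [SubChoice_isSubLmodule of bop by <:].

Lemma bop_linear (f : bop) : linear f.
Proof. by case: f => f /= /asboolP[]. Qed.

HB.instance Definition _ (f : bop) := GRing.isLinear.Build C M N _ f (bop_linear f).

Lemma bop_bounded (f : bop) : exists k : C, forall x, `|f x| <= k * `|x|.
Proof. by case: f => f /= /asboolP[]. Qed.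

Lemma bopP (f g : bop) : f =1 g -> f = g.
Proof. by move=> fg; apply/val_inj/funext. Qed.

Lemma bopDE (f g : bop) x : (f + g) x = f x + g x.
Proof. by []. Qed.

Lemma bopZE (a : C) (f : bop) x : (a *: f) x = a *: f x.
Proof. by []. Qed.

Lemma bop0E x : (0 : bop) x = 0.
Proof. by []. Qed.

Definition opnorm (f : bop) : R :=
  sup [set complex.Re `|f x| | x in [set x : M | `|x| <= 1]].

Lemma ReK_norm (V : normedModType C) (x : V) : (complex.Re `|x|)%:C%C = `|x|.
Proof. by rewrite RRe_real ?normr_real. Qed.

Lemma Re_ge0 (x : C) : 0 <= x -> 0 <= complex.Re x.
Proof. by rewrite lecE => /andP[]. Qed.

Lemma Re_le (x y : C) : x <= y -> complex.Re x <= complex.Re y.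
Proof. by rewrite lecE => /andP[]. Qed.

Lemma opnorm_has_sup (f : bop) :
  has_sup [set complex.Re `|f x| | x in [set x : M | `|x| <= 1]].
Proof.
split; first by exists (complex.Re `|f 0|), 0 => //=; rewrite normr0.
have [k fk] := bop_bounded f.
exists (complex.Re `|k|) => _ [x x1 <-]; apply: Re_le.
apply: le_trans (fk x) _.
have [->|x0] := eqVneq x 0; first by rewrite normr0 mulr0.
have k0 : 0 <= k.
  by rewrite -(pmulr_lge0 _ (_ : 0 < `|x|)) ?normr_gt0// (le_trans _ (fk x)).
by rewrite ger0_norm// ler_piMr.
Qed.

Lemma opnorm_le (f : bop) (k : C) : 0 <= k ->
  (forall x, `|f x| <= k * `|x|) -> (opnorm f)%:C%C <= k.
Proof.
move=> k0 fk; rewrite -(RRe_real (ger0_real k0)) lecR.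
apply: ge_sup; first by case: (opnorm_has_sup f).
move=> _ [x x1 <-]; apply: Re_le; apply: le_trans (fk x) _.
by rewrite ler_piMr.
Qed.

Lemma opnorm_ge0 (f : bop) : 0 <= opnorm f.
Proof.
apply: (le_trans (Re_ge0 (normr_ge0 (f 0)))).
apply: ub_le_sup; first by case: (opnorm_has_sup f).
by exists 0 => //=; rewrite normr0.
Qed.

Lemma opnormP (f : bop) x : `|f x| <= (opnorm f)%:C%C * `|x|.
Proof.
have [->|x0] := eqVneq x 0; first by rewrite linear0 !normr0 mulr0.
have nx0 : 0 < `|x| by rewrite normr_gt0.
rewrite -ler_pdivrMr// -{1}[`|x|]normr_id -normfV mulrC -normrZ -linearZ /=.
rewrite -ReK_norm lecR; apply: ub_le_sup.
  by case: (opnorm_has_sup f).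
by exists (`|x|^-1 *: x) => //=; rewrite normfZV.
Qed.

Definition bop_norm (f : bop) : C := (opnorm f)%:C%C.

Lemma bop_norm_ge0 f : 0 <= bop_norm f.
Proof. by rewrite /bop_norm ler0c opnorm_ge0. Qed.

Lemma bop_normD f g : bop_norm (f + g) <= bop_norm f + bop_norm g.
Proof.
apply: opnorm_le => [|x]; first by rewrite addr_ge0 ?bop_norm_ge0.
by rewrite mulrDl (le_trans (ler_normD _ _))// lerD ?opnormP.
Qed.

Lemma bop_normZ_le (a : C) f : bop_norm (a *: f) <= `|a| * bop_norm f.
Proof.
apply: opnorm_le => [|x]; first by rewrite mulr_ge0 ?bop_norm_ge0.
by rewrite bopZE normrZ -mulrA ler_wpM2l ?opnormP.
Qed.

Lemma bop_norm_eq0 f : bop_norm f = 0 -> f = 0.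
Proof.
move=> f0; apply: bopP => x; apply/eqP; rewrite -normr_le0.
by rewrite (le_trans (opnormP f x))// -/(bop_norm f) f0 mul0r.
Qed.

Lemma bop_normZ (a : C) f : bop_norm (a *: f) = `|a| * bop_norm f.
Proof.
apply/eqP; rewrite eq_le bop_normZ_le /=.
have [->|a0] := eqVneq a 0; first by rewrite normr0 mul0r bop_norm_ge0.
rewrite -ler_pdivlMl ?normr_gt0// -normfV.
by apply: le_trans (bop_normZ_le _ _); rewrite scalerA mulVf// scale1r.
Qed.

HB.instance Definition _ :=
  Lmodule_isNormed.Build C bop bop_normD bop_normZ bop_norm_eq0.

End BoundedOperators.

Section BoundedOperatorTheory.
Context (R : realType).
Implicit Types H M N : hilbertType R.

Lemma bcomp_subproof H M N (S : bop M N) (T : bop H M) :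
  (S : M -> N) \o T \in @is_bop R H N.
Proof.
apply/asboolP; split=> [a x y|]; first by rewrite /= !linearP.
have [k Sk] := bop_bounded S; have [l Tl] := bop_bounded T.
exists (`|k| * l) => x; apply: le_trans (Sk _) _.
apply: (@le_trans _ _ (`|k| * `|T x|)); last by rewrite -mulrA ler_wpM2l.
have [->|T0] := eqVneq (T x) 0; first by rewrite normr0 !mulr0.
have k0 : 0 <= k.
  by rewrite -(pmulr_lge0 _ (_ : 0 < `|T x|)) ?normr_gt0// (le_trans _ (Sk _)).
by rewrite ger0_norm.
Qed.

Definition bcomp H M N (S : bop M N) (T : bop H M) : bop H N :=
  Bop (bcomp_subproof S T).

Lemma bid_subproof H : idfun \in @is_bop R H H.
Proof. by apply/asboolP; split=> //; exists 1 => x; rewrite mul1r. Qed.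

Definition bid H : bop H H := Bop (bid_subproof H).

Definition is_adjoint M N (T : bop M N) (S : bop N M) :=
  forall x y, dot (T x) y = dot x (S y).

(* The default value 0 is never used: an adjoint exists by the Riesz
   representation theorem, and it is unique. *)
Definition adjoint M N (T : bop M N) : bop N M := xget 0 [set S | is_adjoint T S].

End BoundedOperatorTheory.

Section BlockOperators.
Context (R : realType) (H1 M H2 N : hilbertType R).
Context (A : bop H1 H2) (B : bop M H2) (C : bop H1 N) (D : bop M N).

Definition block_fun (x : dsum H1 M) : dsum H2 N :=
  (A x.1 + B x.2, C x.1 + D x.2).

Lemma block_subproof : block_fun \in @is_bop R (dsum H1 M) (dsum H2 N).
Proof.
apply/asboolP; split=> [a x y|].
  by apply: injective_projections; rewrite /= !linearP /= scalerDr addrACA.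
exists ((opnorm A + opnorm B + (opnorm C + opnorm D))%:C%C) => x.
apply: le_trans (dsum_norm_le _) _.
have bnd (K1 K2 : hilbertType R) (T : bop K1 K2) y : `|y| <= `|x| ->
    `|T y| <= (opnorm T)%:C%C * `|x|.
  by move=> yx; apply: le_trans (opnormP T y) _; rewrite ler_wpM2l ?ler0c ?opnorm_ge0.
rewrite !rmorphD /= !mulrDl lerD // (le_trans (ler_normD _ _))// lerD//;
  by apply: bnd; rewrite ?dsum_norm1 ?dsum_norm2.
Qed.

Definition block : bop (dsum H1 M) (dsum H2 N) := Bop block_subproof.

End BlockOperators.

Definition coisometry (R : realType) (H K : hilbertType R) (T : bop H K) :=
  bcomp T (adjoint T) = bid K.

Section Geometry.
Context (R : realType).
Local Notation C := R[i].
Implicit Types (a b u v z : C) (P Q : set C) (Lam : set (set C)).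

Definition segment a b : set C :=
  [set z | exists2 t : R, 0 <= t <= 1 & z = a + t%:C%C * (b - a)].

Definition rhombus a u v : set C :=
  [set z | exists s t : R,
     [/\ 0 <= s <= 1, 0 <= t <= 1 & z = a + s%:C%C * u + t%:C%C * v]].

Definition open_rhombus a u v : set C :=
  [set z | exists s t : R,
     [/\ 0 < s < 1, 0 < t < 1 & z = a + s%:C%C * u + t%:C%C * v]].

(* P is the nondegenerate rhombus of side length 1 with a vertex at a and the
   two sides [a, a + u] and [a, a + v] issuing from it.  Every corner of P can
   serve as a, so corners and sides of the set P are obtained by quantifying
   over its parametrisations. *)
Definition unit_rhombus P a u v :=
  [/\ `|u| = 1, `|v| = 1, u <> v, u <> - v & P = rhombus a u v].

Definition rhombus_interior P : set C :=
  [set z | exists a u v, unit_rhombus P a u v /\ open_rhombus a u v z].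

Definition corner P a := exists u v, unit_rhombus P a u v.

Definition side P a b := exists v, unit_rhombus P a (b - a) v.

Definition opposite_sides P (s t : set C) := exists a u v,
  [/\ unit_rhombus P a u v, s = segment a (a + u) & t = segment (a + v) (a + v + u)].

Definition congruent P Q := exists f : C -> C,
  (forall x y, `|f x - f y| = `|x - y|) /\ f @` P = Q.

Record rhombic_tessellation Lam : Prop := {
  faces_rhombi : forall P, Lam P -> exists a u v, unit_rhombus P a u v ;
  faces_cover : \bigcup_(P in Lam) P = setT ;
  faces_disjoint : forall P Q, Lam P -> Lam Q -> P <> Q ->
    rhombus_interior P `&` rhombus_interior Q = set0 ;
  faces_edge_to_edge : forall P Q, Lam P -> Lam Q -> P <> Q ->
    [\/ P `&` Q = set0,
        exists a, [/\ corner P a, corner Q a & P `&` Q = [set a]] |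
        exists a b, [/\ side P a b, side Q a b & P `&` Q = segment a b]] ;
  faces_congruent : forall P Q, Lam P -> Lam Q -> congruent P Q
}.

Definition vertices Lam : set C := [set a | exists2 P, Lam P & corner P a].

Definition edge Lam a b := exists2 P, Lam P & side P a b.

Definition directions Lam : set C := [set e | exists a b, edge Lam a b /\ e = b - a].

(* Distinct adjacent faces meet exactly along their common edge, so shared
   edges are written as intersections of consecutive faces. *)
Definition track Lam (T : int -> set C) :=
  (forall n, Lam (T n)) /\
  (forall n, opposite_sides (T n) (T (n - 1) `&` T n) (T n `&` T (n + 1))).

Definition tie (T : int -> set C) a b := exists n, segment a b = T n `&` T (n + 1).

Definition coherent (T T' : int -> set C) := forall a b c d,
  tie T a b -> tie T' c d -> exists r : R, b - a = r%:C%C * (d - c).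

Definition vertex Lam := set_type (vertices Lam).

(* S is a connected component of the graph left after deleting the ties of T. *)
Definition side_of Lam (T : int -> set C) (S : set (vertex Lam)) :=
  exists z : vertex Lam, S = [set w |
    exists2 p : seq (vertex Lam),
      path (fun x y => `[< edge Lam (\val x) (\val y) /\ ~ tie T (\val x) (\val y) >]) z p
      & last z p = w].

Definition contains_track Lam (S : set (vertex Lam)) (T : int -> set C) :=
  forall n (z : vertex Lam), corner (T n) (\val z) -> S z.

(* The last three fields are the standing assumptions on the lattice. *)
Record rhombic_lattice := RhombicLattice {
  faces :> set (set C) ;
  faces_tessellation : rhombic_tessellation faces ;
  origin_vertex : 0 \in vertices faces ;
  direction1 : directions faces 1 ;
  coherent_tracks : forall (T : int -> set C) (S : set (vertex faces)),
    track faces T -> side_of T S ->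
    exists T', [/\ track faces T', coherent T T' & contains_track S T']
}.

End Geometry.

Section DiscreteAnalytic.
Context (R : realType) (L : rhombic_lattice R).
Local Notation C := R[i].
Local Notation vertex := (vertex L).

Definition origin : vertex := Sub 0 (origin_vertex L).

Definition adj : rel vertex := fun x y => `[< edge L (\val x) (\val y) >].

Definition is_path (a b : vertex) (p : seq vertex) := path adj a p /\ last a p = b.

Section VectorValued.
Context (V : lmodType C).
Implicit Types f : vertex -> V.

(* The vertices of the path are those of a :: p. *)
Definition path_integral f (a : vertex) (p : seq vertex) : V :=
  \sum_(e <- zip (a :: p) p) (\val e.2 - \val e.1) *: (2^-1 *: (f e.1 + f e.2)).

Definition DA f := forall a p, is_path a a p -> path_integral f a p = 0.

(* For a DA function the value does not depend on the chosen path; a path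
   exists since the graph of a tessellation is connected. *)
Definition integral f (a b : vertex) : V :=
  path_integral f a (xget [::] [set p | is_path a b p]).

Definition Zplus f : vertex -> V := fun z =>
  2^-1 *: (f origin - f z) + integral f origin z.

End VectorValued.

Definition zbasis (n : nat) : vertex -> C^o := iter n (@Zplus C^o) (fun=> 1).

(* A DA polynomial sum_n A_n z^(n) is represented by its coefficients
   [:: A_0; A_1; and so on]. *)
Section Odot.
Context (H K M : hilbertType R).

Definition odot_polyl (p : seq (bop K M)) (f : vertex -> bop H K) : vertex -> bop H M :=
  fun z => \sum_(n < size p) bcomp p`_n (iter n (@Zplus (bop H K)) f z).

Definition odot_polyr (g : vertex -> bop K M) (p : seq (bop H K)) : vertex -> bop H M :=
  fun z => \sum_(n < size p) bcomp (iter n (@Zplus (bop K M)) g z) p`_n.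

End Odot.

Definition is_odot_inverse (H : hilbertType R) (p : seq (bop H H))
    (G : vertex -> bop H H) :=
  [/\ DA G, odot_polyr G p = (fun=> bid H) & odot_polyl p G = (fun=> bid H)].

(* (I - z T)^(-odot).  It exists, and is then unique, when the spectrum of T
   avoids the points t with 2 + t (1 - e) = 0, e an edge direction, all of
   which satisfy 1 <= |t|; in [schur] below, T = A / mu with A a contraction
   and 1 < mu. *)
Definition resolvent (H : hilbertType R) (T : bop H H) : vertex -> bop H H :=
  xget (fun=> 0) [set G | is_odot_inverse [:: bid H; - T] G].

Definition schur (H M N : hilbertType R) (A : bop H H) (B : bop M H)
    (C0 : bop H N) (D : bop M N) (mu : R) : vertex -> bop M N := fun z =>
  D + odot_polyr (fun z => bcomp C0 (resolvent (mu^-1%:C%C *: A) z))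
                 [:: 0; mu^-1%:C%C *: B] z.

Section Kernel.
Context (M N : hilbertType R) (mu : R) (S : vertex -> bop M N).

Definition schur_term (z w : vertex) (n : nat) : bop N N :=
  ((mu ^+ (2 * n))^-1)%:C%C *:
    ((zbasis n z * (zbasis n w)^*) *: bid N
     - bcomp (iter n (@Zplus (bop M N)) S z) (adjoint (iter n (@Zplus (bop M N)) S w))).

(* Limit in operator norm; the series converges for every DA function S and
   1 < mu, since the iterates of Zplus grow polynomially in n at each vertex. *)
Definition schur_kernel (z w : vertex) : bop N N :=
  limn (series (schur_term z w)).

End Kernel.

Definition positive_kernel (N : hilbertType R) (K : vertex -> vertex -> bop N N) :=
  forall (m : nat) (w : 'I_m -> vertex) (x : 'I_m -> N),
    0 <= \sum_(i < m) \sum_(j < m) dot (K (w i) (w j) (x j)) (x i).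

End DiscreteAnalytic.

Arguments zbasis {R} L n z.
Arguments resolvent {R} L {H} T z.
Arguments schur {R} L {H M N} A B C0 D mu z.

(* Main.v *)
(* A rhombic tessellation is locally finite, so every point of the plane has a
   neighbourhood whose faces share a corner.  A closed 1-cochain therefore
   changes by a locally constant jump from face to face, and summing the jumps
   along fine subdivisions of rays integrates it: the sums of a cochain that is
   closed around every rhombus vanish along all closed paths.  This makes Z_+ f
   discrete analytic when f is, and Z_+ f is then determined by a two-term
   recursion along edges, which also shows that the iterates Z_+^n f (z) grow
   slower than r^n for every r > 1.

   From a co-isometry, the resolvent is the sum of the z^(n) T^n, and the relation
   [F S] = [Z_+ F / mu, 1] [A B; C D] telescopes the kernel to F(z) F(w)^*.

   Conversely, with P(w)^* x = (conj w^(n) mu^-n x)_n and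
   Q(w)^* x = (mu^-n (Z_+^n S)(w)^* x)_n in l^2, positivity of the kernel says
   that P(w)^* x |-> Q(w)^* x extends to a contraction X.  It intertwines the
   backward shifts, so F(w)^* = (I - X^* X)^(1/2) P(w)^* satisfies
   |F(w)^* x|^2 + |S(w)^* x|^2 = |(Z_+ F / mu)(w)^* x|^2 + |x|^2.  The lurking
   partial isometry is completed to an isometry on a larger space by feeding its
   defect into a unilateral shift; its adjoint is the required co-isometry, since
   the edge recursion has at most one solution when |A / mu| < 1. *)
From HB Require Import structures.
Require Import Defs.
From mathcomp Require Import all_boot all_order all_algebra.
From mathcomp Require Import complex.
From mathcomp Require Import all_classical all_reals all_analysis.
From mathcomp Require Import ring lra.

Set Implicit Arguments.
Unset Strict Implicit.
Unset Printing Implicit Defensive.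

Import Order.TTheory GRing.Theory Num.Theory numFieldNormedType.Exports.

Local Open Scope classical_set_scope.
Local Open Scope ring_scope.

(** Splitting off the term n = 0 of the kernel K gives K(z,w) + S(z) S(w)^* = I + mu^-2 K', where K'
    is K with Z_+ applied in both variables. This is the identity that a co-isometry has to factor.
    On sequences weighted by mu^-n, Z_+ / mu acts as the backward shift, so splitting off coordinate
    0 of P(w)^* x and Q(w)^* x realises the identity inside l^2. The square root of I - X^* X stands
    in for the reproducing kernel space of K, without quotient or completion. The resulting isometry
    lives on a subspace only, and the two orthogonal complements may have different sizes, so it
    need not extend to an isometry of the same spaces; the shift supplies the room. On the geometric
    side, faces are bare point sets. Congruence bounds their area from below, which separates their
    centres and gives local finiteness; compactness then gives one star radius per bounded region.
    Operator-valued functions are reduced to scalar ones through their matrix coefficients. *)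

(** * Unit rhombi *)

Section Rhombus.
Context (R : realType).
Local Notation C := R[i].
Local Notation Re := (@complex.Re R).
Local Notation Im := (@complex.Im R).
Implicit Types (a b u v w z : C) (P Q : set C).

Definition det u v : R := Re u * Im v - Im u * Re v.

Lemma cplx_eq z w : Re z = Re w -> Im z = Im w -> z = w.
Proof. by case: z => ? ?; case: w => ? ? /= -> ->. Qed.

Lemma ReD z w : Re (z + w) = Re z + Re w. Proof. by case: z; case: w. Qed.
Lemma ImD z w : Im (z + w) = Im z + Im w. Proof. by case: z; case: w. Qed.
Lemma ReN z : Re (- z) = - Re z. Proof. by case: z. Qed.
Lemma ImN z : Im (- z) = - Im z. Proof. by case: z. Qed.
Lemma ReZ (s : R) z : Re (s%:C%C * z) = s * Re z.
Proof. by case: z => x y /=; rewrite mul0r subr0. Qed.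
Lemma ImZ (s : R) z : Im (s%:C%C * z) = s * Im z.
Proof. by case: z => x y /=; rewrite mul0r addr0. Qed.
Definition ReImE := (ReD, ImD, ReN, ImN, ReZ, ImZ).

Lemma unit_sqr u : `|u| = 1 -> Re u ^+ 2 + Im u ^+ 2 = 1.
Proof.
by move=> u1; apply: complexI; rewrite add_Re2_Im2 u1 expr1n.
Qed.

(** Lagrange's identity gives det^2 + <u,v>^2 = 1, so a zero determinant forces <u,v> = 1 or -1,
    that is, |u - v| = 0 or |u + v| = 0. *)
Lemma det_neq0 u v : `|u| = 1 -> `|v| = 1 -> u <> v -> u <> - v -> det u v != 0.
Proof.
move=> /unit_sqr u1 /unit_sqr v1 uv uNv; apply/eqP => d0.
have c1 : (1 - (Re u * Re v + Im u * Im v)) * (1 + (Re u * Re v + Im u * Im v)) = 0.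
  have -> : 0 = det u v ^+ 2 by rewrite d0 expr0n.
  have E : (Re u ^+ 2 + Im u ^+ 2) * (Re v ^+ 2 + Im v ^+ 2) = 1 by rewrite u1 v1 mulr1.
  by rewrite /det; lra.
have sq0 (x y : R) : x ^+ 2 + y ^+ 2 = 0 -> x = 0 /\ y = 0.
  move=> /eqP; rewrite paddr_eq0 ?sqr_ge0// !sqrf_eq0 => /andP[/eqP-> /eqP->] //.
move: c1 => /eqP; rewrite mulf_eq0 => /orP[] /eqP c1.
- have [] := sq0 (Re u - Re v) (Im u - Im v).
    by lra.
  by move=> /subr0_eq ? /subr0_eq ?; apply: uv; apply: cplx_eq.
- have [] := sq0 (Re u + Re v) (Im u + Im v).
    by lra.
  by move=> /addr0_eq ? /addr0_eq ?; apply: uNv; apply: cplx_eq; rewrite ?ReImE //;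
    lra.
Qed.

Section Coordinates.
Context (u v : C).
Hypothesis D0 : det u v != 0.

Lemma coordE z : z = (det z v / det u v)%:C%C * u + (det u z / det u v)%:C%C * v.
Proof. by apply: cplx_eq; rewrite !ReImE /det; field. Qed.

Lemma coord1 (s t : R) : det (s%:C%C * u + t%:C%C * v) v / det u v = s.
Proof. by move: D0; rewrite /det !ReImE => D1; field. Qed.

Lemma coord2 (s t : R) : det u (s%:C%C * u + t%:C%C * v) / det u v = t.
Proof. by move: D0; rewrite /det !ReImE => D1; field. Qed.

Lemma coord_inj (s t s' t' : R) :
  s%:C%C * u + t%:C%C * v = s'%:C%C * u + t'%:C%C * v -> s = s' /\ t = t'.
Proof.
by move=> E; rewrite -(coord1 s t) -{2}(coord2 s t) E coord1 coord2.
Qed.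

Lemma coord_inj_at a (s t s' t' : R) :
  a + s%:C%C * u + t%:C%C * v = a + s'%:C%C * u + t'%:C%C * v -> s = s' /\ t = t'.
Proof. by rewrite -!addrA => /addrI; exact: coord_inj. Qed.

End Coordinates.

Lemma unit_rhombus_det P a u v : unit_rhombus P a u v -> det u v != 0.
Proof. by case=> *; exact: det_neq0. Qed.

Lemma unit_rhombus_sym P a u v : unit_rhombus P a u v -> unit_rhombus P a v u.
Proof.
case=> u1 v1 uv uNv ->; split=> //; first by move/esym.
  by move=> vu; apply: uNv; rewrite vu opprK.
by apply/seteqP; split=> z [s [t [s01 t01 ->]]]; exists t, s; split=> //; rewrite addrAC.
Qed.

Lemma unit_rhombus_reroot P a u v :
  unit_rhombus P a u v -> unit_rhombus P (a + u) (- u) v.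
Proof.
case=> u1 v1 uv uNv ->; split; rewrite ?normrN//.
- by move=> uv'; apply: uNv; rewrite -uv' opprK.
- by move=> /oppr_inj.
by apply/seteqP; split=> z [s [t [s01 t01 ->]]]; exists (1 - s), t; split=> //;
  rewrite ?subr_ge0 ?gerBl; [lra| |lra|];
  rewrite rmorphB rmorph1; ring.
Qed.

Lemma unit_rhombus_corner P a u v : unit_rhombus P a u v ->
  [/\ corner P a, corner P (a + u), corner P (a + v) & corner P (a + u + v)].
Proof.
move=> h; split; first by exists u, v.
- by exists (- u), v; exact: unit_rhombus_reroot.
- by exists (- v), u; apply: unit_rhombus_reroot; exact: unit_rhombus_sym.
exists (- v), (- u); apply: unit_rhombus_reroot; apply: unit_rhombus_sym.
exact: unit_rhombus_reroot.
Qed.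

Lemma unit_rhombus_mem P a u v (s t : R) : unit_rhombus P a u v ->
  0 <= s <= 1 -> 0 <= t <= 1 -> P (a + s%:C%C * u + t%:C%C * v).
Proof. by case=> _ _ _ _ -> *; exists s, t. Qed.

Lemma unit_rhombus_memP P a u v z : unit_rhombus P a u v -> P z ->
  exists s t, [/\ 0 <= s <= 1, 0 <= t <= 1 & z = a + s%:C%C * u + t%:C%C * v].
Proof. by case=> _ _ _ _ ->. Qed.

Lemma corner_mem P a : corner P a -> P a.
Proof.
move=> [u [v h]]; have := @unit_rhombus_mem P a u v 0 0 h.
by rewrite !rmorph0 !mul0r !addr0; apply; rewrite lexx ler01.
Qed.

(** Corners are extreme points, a property of the set [P] that no longer mentions a parametrisation:
    with [a] as root, nonnegative coordinates that sum to 0 vanish. *)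
Lemma corner_extreme P a y z : corner P a -> P y -> P z -> y + z = a + a -> y = a.
Proof.
move=> [u [v h]] /(unit_rhombus_memP h) [s [t [s01 t01 ->]]].
move=> /(unit_rhombus_memP h) [s' [t' [s01' t01' ->]]] E.
have [ss tt] : s + s' = 0 /\ t + t' = 0.
  apply: (coord_inj (unit_rhombus_det h)); rewrite !rmorphD rmorph0.
  by apply: (addrI (a + a)); rewrite !mul0r !addr0 -[RHS]E; ring.
have -> : s = 0 by lra.
have -> : t = 0 by lra.
by rewrite !mul0r !addr0.
Qed.

(** For 0 < s < 1 the point is the midpoint of two points of [P] obtained by moving [s] by min (s, 1
    - s) both ways, which contradicts extremality. *)
Lemma corner_coord1 P a u v (s t : R) : unit_rhombus P a u v ->
  0 <= s <= 1 -> 0 <= t <= 1 -> corner P (a + s%:C%C * u + t%:C%C * v) ->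
  s = 0 \/ s = 1.
Proof.
move=> h s01 t01 cor.
have [|s0] := eqVneq s 0; first by left.
have [|s1] := eqVneq s 1; first by right.
exfalso.
pose e := Num.min s (1 - s).
have e0 : 0 < e by rewrite lt_min subr_gt0 !lt_neqAle s1 eq_sym s0; lra.
have es : e <= s by rewrite /e ge_min lexx.
have es' : e <= 1 - s by rewrite /e ge_min lexx orbT.
have := @corner_extreme P _ (a + (s + e)%:C%C * u + t%:C%C * v)
  (a + (s - e)%:C%C * u + t%:C%C * v) cor.
have s1' : 0 <= s + e <= 1 by lra.
have s2' : 0 <= s - e <= 1 by lra.
move=> /(_ (unit_rhombus_mem h s1' t01) (unit_rhombus_mem h s2' t01)).
have -> : a + (s + e)%:C%C * u + t%:C%C * v + (a + (s - e)%:C%C * u + t%:C%C * v) =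
  a + s%:C%C * u + t%:C%C * v + (a + s%:C%C * u + t%:C%C * v).
  by rewrite rmorphD rmorphB; ring.
move=> /(_ erefl) /(coord_inj_at (unit_rhombus_det h)) [se _].
by lra.
Qed.

Lemma corner_coords P a u v (s t : R) : unit_rhombus P a u v ->
  0 <= s <= 1 -> 0 <= t <= 1 -> corner P (a + s%:C%C * u + t%:C%C * v) ->
  (s = 0 \/ s = 1) /\ (t = 0 \/ t = 1).
Proof.
move=> h s01 t01 cor; split; first exact: corner_coord1 cor.
by apply: (corner_coord1 (unit_rhombus_sym h) t01 s01); rewrite addrAC.
Qed.

Lemma cornerP P a u v q : unit_rhombus P a u v -> corner P q ->
  [\/ q = a, q = a + u, q = a + v | q = a + u + v].
Proof.
move=> h cq; have [s [t [s01 t01 qE]]] := unit_rhombus_memP h (corner_mem cq).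
rewrite qE in cq *; have [[->|->] [->|->]] := corner_coords h s01 t01 cq;
  rewrite ?rmorph0 ?rmorph1 ?mul0r ?mul1r ?addr0; by constructor.
Qed.

Lemma unit_neq0 u : `|u| = 1 -> u != 0.
Proof. by move=> u1; rewrite -normr_eq0 u1 oner_neq0. Qed.

(** The point a + u' is a corner other than a. If it were a + u + v, then a + u' + v' would have
    coordinates 1 + s and 1 + t in [0, 1], where s and t are those of a + v', and v' would
    vanish. *)
Lemma same_root P a u v u' v' : unit_rhombus P a u v -> unit_rhombus P a u' v' ->
  u' = u \/ u' = v.
Proof.
move=> h h'; have D0 := unit_rhombus_det h.
have [_ c1 c2 c3] := unit_rhombus_corner h'.
have [u'1 v'1 _ _ _] := h'; have u'0 := unit_neq0 u'1; have v'0 := unit_neq0 v'1.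
have addI (x : C) : a + x = a -> x = 0 by rewrite -[RHS]addr0 => /addrI.
case: (cornerP h c1) => [/addI u0|/addrI ->|/addrI ->|].
- by rewrite u0 eqxx in u'0.
- by left.
- by right.
rewrite -addrA => /addrI u'E.
have [s [t [s01 t01 /eqP]]] := unit_rhombus_memP h (corner_mem c2).
rewrite -addrA (inj_eq (addrI a)) => /eqP vE.
have [s' [t' [s01' t01' /eqP]]] := unit_rhombus_memP h (corner_mem c3).
rewrite -!addrA (inj_eq (addrI a)) => /eqP.
rewrite u'E vE.
have -> : u + v + (s%:C%C * u + t%:C%C * v) = (1 + s)%:C%C * u + (1 + t)%:C%C * v.
  by rewrite !rmorphD rmorph1; ring.
move=> /(coord_inj D0)[ss tt].
have s0 : s = 0 by lra.
have t0 : t = 0 by lra.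
by move: v'0; rewrite vE s0 t0 !mul0r addr0 eqxx.
Qed.

Lemma side_corner P a b : side P a b -> corner P a /\ corner P b.
Proof.
move=> [v h]; have [ca cb _ _] := unit_rhombus_corner h.
by move: cb; rewrite addrC subrK.
Qed.

Lemma side_sym P a b : side P a b -> side P b a.
Proof.
move=> [v h]; exists v; have := unit_rhombus_reroot h.
by rewrite addrC subrK opprB.
Qed.

Lemma side_neq P a b : side P a b -> a != b.
Proof.
by move=> [v [h _ _ _ _]]; move: (unit_neq0 h); rewrite subr_eq0 eq_sym.
Qed.

(** The start of the side is one of four corners; after rerooting there, [same_root] leaves two
    directions, hence eight oriented sides. *)
Lemma sideP P a u v b c : unit_rhombus P a u v -> side P b c ->
  exists b0 u0 v0, [/\ b = b0, c = b0 + u0, unit_rhombus P b0 u0 v0 &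
   [\/ b0 = a /\ ((u0 = u /\ v0 = v) \/ (u0 = v /\ v0 = u)),
      b0 = a + u /\ ((u0 = - u /\ v0 = v) \/ (u0 = v /\ v0 = - u)),
      b0 = a + v /\ ((u0 = u /\ v0 = - v) \/ (u0 = - v /\ v0 = u)) |
      b0 = a + u + v /\ ((u0 = - u /\ v0 = - v) \/ (u0 = - v /\ v0 = - u))]].
Proof.
move=> h sd; have [cb _] := side_corner sd; case: sd => w h'.
have key a0 u0 v0 : unit_rhombus P a0 u0 v0 -> b = a0 ->
    exists u1 v1, [/\ c = a0 + u1, unit_rhombus P a0 u1 v1 &
      (u1 = u0 /\ v1 = v0) \/ (u1 = v0 /\ v1 = u0)].
  move=> h0 bE; rewrite bE in h'.
  have [cu|cu] := same_root h0 h'.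
    by exists u0, v0; split=> //; [rewrite -cu addrC subrK | left].
  exists v0, u0; split=> //; [by rewrite -cu addrC subrK | |by right].
  exact: unit_rhombus_sym.
case: (cornerP h cb) => bE.
- have [u1 [v1 [cE h1 E]]] := key _ _ _ h bE; exists a, u1, v1; split=> //.
  by constructor 1.
- have [u1 [v1 [cE h1 E]]] := key _ _ _ (unit_rhombus_reroot h) bE.
  by exists (a + u), u1, v1; split=> //; constructor 2.
- have [u1 [v1 [cE h1 E]]] := key _ _ _
    (unit_rhombus_sym (unit_rhombus_reroot (unit_rhombus_sym h))) bE.
  by exists (a + v), u1, v1; split=> //; constructor 3.
- have [u1 [v1 [cE h1 E]]] := key _ _ _
    (unit_rhombus_sym (unit_rhombus_reroot (unit_rhombus_sym (unit_rhombus_reroot h)))) bE.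
  by exists (a + u + v), u1, v1; split=> //; constructor 4.
Qed.

Lemma segment_side P a b q : side P a b -> segment a b q ->
  exists u v t, [/\ unit_rhombus P a u v, b = a + u, 0 <= t <= 1 &
    q = a + t%:C%C * u + 0%:C%C * v].
Proof.
move=> [v h] [t t01 ->]; exists (b - a), v, t; split=> //.
  by rewrite addrC subrK.
by rewrite rmorph0 mul0r addr0.
Qed.

Lemma segment_sub P a b : side P a b -> segment a b `<=` P.
Proof.
move=> sd q /(segment_side sd) [u [v [t [h _ t01 ->]]]].
by apply: unit_rhombus_mem => //; rewrite lexx ler01.
Qed.

Lemma segment_corner P a b q : side P a b -> segment a b q -> corner P q ->
  q = a \/ q = b.
Proof.
move=> sd /(segment_side sd) [u [v [t [h -> t01 ->]]]] cq.
have [|[->|->] _] := corner_coords h t01 _ cq; first by rewrite lexx ler01.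
  by left; rewrite rmorph0 !mul0r !addr0.
by right; rewrite rmorph0 rmorph1 mul0r mul1r addr0.
Qed.

(** In coordinates where the first side is t = 0, the point p is a proper convex combination of a'
    and b', whose second coordinates are nonnegative; both therefore vanish. Two distinct corners on
    t = 0 are the two ends of the first side. *)
Lemma side_common P a b a' b' p : side P a b -> side P a' b' ->
  segment a b p -> segment a' b' p -> ~ corner P p -> a = a' \/ a = b'.
Proof.
move=> sd sd' pab [s' s01' pE'] ncp.
have [ca' cb'] := side_corner sd'.
have [u [v [t [h bE t01 pE]]]] := segment_side sd pab.
have D0 := unit_rhombus_det h.
have [s1 [t1 [s101 t101 a'E]]] := unit_rhombus_memP h (corner_mem ca').
have [s2 [t2 [s201 t201 b'E]]] := unit_rhombus_memP h (corner_mem cb').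
have s'0 : s' != 0.
  apply/eqP => s0; apply: ncp; suff -> : p = a' by [].
  by rewrite pE' s0 rmorph0 mul0r addr0.
have s'1 : s' != 1.
  apply/eqP => s0; apply: ncp; suff -> : p = b' by [].
  by rewrite pE' s0 rmorph1 mul1r addrC subrK.
have [_ tt] : t = (1 - s') * s1 + s' * s2 /\ 0 = (1 - s') * t1 + s' * t2.
  apply: (@coord_inj_at _ _ D0 a); rewrite -pE pE' a'E b'E.
  by rewrite !rmorphD !rmorphM !rmorphB /= rmorph1; ring.
have s'p : 0 < s' by rewrite lt_neqAle eq_sym s'0; case/andP: s01'.
have s'p1 : 0 < 1 - s' by rewrite subr_gt0 lt_neqAle s'1; case/andP: s01'.
have h1 : 0 <= (1 - s') * t1 by rewrite mulr_ge0 ?(ltW s'p1)//; case/andP: t101.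
have h2 : 0 <= s' * t2 by rewrite mulr_ge0 ?(ltW s'p)//; case/andP: t201.
have t10 : t1 = 0.
  by apply/eqP; rewrite -(mulrI_eq0 _ (lregP (lt0r_neq0 s'p1))); apply/eqP; lra.
have t20 : t2 = 0.
  by apply/eqP; rewrite -(mulrI_eq0 _ (lregP (lt0r_neq0 s'p))); apply/eqP; lra.
have [s1E _] := corner_coords h s101 t101 (eq_ind _ _ ca' _ a'E).
have [s2E _] := corner_coords h s201 t201 (eq_ind _ _ cb' _ b'E).
have ne := side_neq sd'.
rewrite a'E b'E t10 t20.
case: s1E => s1E; first by left; rewrite s1E rmorph0 !mul0r !addr0.
case: s2E => s2E; first by right; rewrite s2E rmorph0 !mul0r !addr0.
by move: ne; rewrite a'E b'E t10 t20 s1E s2E eqxx.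
Qed.

End Rhombus.

(** * Local finiteness of the tessellation *)

Section Tessellation.
Context (R : realType).
Local Notation C := R[i].
Local Notation Re := (@complex.Re R).
Local Notation Im := (@complex.Im R).
Implicit Types (a b u v w z p q : C) (P Q : set C).

(** The sup norm takes values in [R], whereas the modulus is an element of [R[i]]; it also fits the
    square cells and the compact square used below. *)
Definition supn z : R := Num.max `|Re z| `|Im z|.

Lemma supn_lt z r : (supn z < r) = (`|Re z| < r) && (`|Im z| < r).
Proof. by rewrite /supn gt_max. Qed.

Lemma supn_le z r : (supn z <= r) = (`|Re z| <= r) && (`|Im z| <= r).
Proof. by rewrite /supn ge_max. Qed.

Lemma Re_supn z : `|Re z| <= supn z. Proof. by rewrite /supn le_max lexx. Qed.
Lemma Im_supn z : `|Im z| <= supn z. Proof. by rewrite /supn le_max lexx orbT. Qed.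

Lemma supn_ge0 z : 0 <= supn z. Proof. exact: le_trans (Re_supn z). Qed.

Lemma supnD z w : supn (z + w) <= supn z + supn w.
Proof.
rewrite supn_le !ReImE; apply/andP; split; apply: (le_trans (ler_normD _ _));
  by rewrite lerD ?Re_supn ?Im_supn.
Qed.

Lemma supnN z : supn (- z) = supn z.
Proof. by rewrite /supn !ReImE !normrN. Qed.

Lemma supnZ (s : R) z : supn (s%:C%C * z) = `|s| * supn z.
Proof. by rewrite /supn !ReImE !normrM maxr_pMr. Qed.

Lemma supn0 : supn 0 = 0.
Proof. by rewrite /supn /= normr0 maxxx. Qed.

Lemma supn_unit u : `|u| = 1 -> supn u <= 1.
Proof.
move=> /unit_sqr u1.
have s1 (x y : R) : x ^+ 2 + y ^+ 2 = 1 -> `|x| <= 1.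
  move=> xy; rewrite -(@expr_le1 _ 2)// real_normK ?num_real//.
  by have := sqr_ge0 y; lra.
by rewrite supn_le (s1 _ _ u1) (s1 (Im u) (Re u))// addrC.
Qed.

Lemma det_le w v : `|v| = 1 -> `|det w v| <= 2 * supn w.
Proof.
move=> /supn_unit v1; rewrite /det (le_trans (ler_normB _ _))// !normrM.
rewrite mulr_natl mulr2n lerD//.
  by rewrite -[leRHS]mulr1 ler_pM ?Re_supn// (le_trans (Im_supn v)).
by rewrite -[leRHS]mulr1 ler_pM ?Im_supn// (le_trans (Re_supn v)).
Qed.

Lemma det_le' w v : `|v| = 1 -> `|det v w| <= 2 * supn w.
Proof.
move=> v1; have -> : det v w = - det w v by rewrite /det; ring.
by rewrite normrN det_le.
Qed.

Definition nsq z : R := Re z ^+ 2 + Im z ^+ 2.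

Lemma nsq_norm z w : `|z| = `|w| -> nsq z = nsq w.
Proof. by move=> zw; apply: complexI; rewrite /nsq !add_Re2_Im2 zw. Qed.

(** The bound is the squared length of the longer diagonal, which an isometry transports without any
    knowledge of where corners go. *)
Lemma unit_rhombus_diam P a u v x y : unit_rhombus P a u v -> P x -> P y ->
  nsq (x - y) <= 2 + 2 * `|Re u * Re v + Im u * Im v|.
Proof.
move=> h /(unit_rhombus_memP h) [s [t [s01 t01 ->]]].
move=> /(unit_rhombus_memP h) [s' [t' [s01' t01' ->]]].
have [/unit_sqr u1 /unit_sqr v1 _ _ _] := h.
set c := _ + _ * _.
have -> : nsq (a + s%:C%C * u + t%:C%C * v - (a + s'%:C%C * u + t'%:C%C * v)) =
  (s - s') ^+ 2 + (t - t') ^+ 2 + 2 * (s - s') * (t - t') * c.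
  rewrite /nsq !ReImE.
  transitivity ((s - s') ^+ 2 * (Re u ^+ 2 + Im u ^+ 2) +
    (t - t') ^+ 2 * (Re v ^+ 2 + Im v ^+ 2) + 2 * (s - s') * (t - t') * c).
    by rewrite /c; ring.
  by rewrite u1 v1 !mulr1.
have n1 (x1 y1 : R) : 0 <= x1 <= 1 -> 0 <= y1 <= 1 -> `|x1 - y1| <= 1.
  by move=> *; rewrite ler_norml; lra.
have sq1 (x1 : R) : `|x1| <= 1 -> x1 ^+ 2 <= 1.
  by move=> x11; rewrite -real_normK ?num_real// expr_le1.
have := sq1 _ (n1 _ _ s01 s01'); have := sq1 _ (n1 _ _ t01 t01').
have : (s - s') * (t - t') * c <= `|c|.
  rewrite (le_trans (ler_norm _))// normrM ler_piMl// normrM mulr_ile1 ?n1//.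
by lra.
Qed.

Context (Lam : set (set C)).
Hypothesis tess : rhombic_tessellation Lam.

(** All distances in a face are at most the longer diagonal of one reference face. Applied to both
    diagonals, this bounds |<u,v>| from above, hence the area |det u v| from below. *)
Lemma det_bound : exists2 k : R, 0 < k &
  forall P a u v, Lam P -> unit_rhombus P a u v -> k <= `|det u v|.
Proof.
have [P0 LP0 _] : (\bigcup_(P in Lam) P) 0 by rewrite (faces_cover tess).
have [a0 [u0 [v0 h0]]] := faces_rhombi tess LP0.
exists `|det u0 v0|; first by rewrite normr_gt0 (unit_rhombus_det h0).
move=> P a u v LP h; rewrite -ler_sqr ?nnegrE// !real_normK ?num_real//.
have [f [fiso fP]] := faces_congruent tess LP0 LP.
have dist x y : P x -> P y -> nsq (x - y) <= 2 + 2 * `|Re u0 * Re v0 + Im u0 * Im v0|.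
  rewrite -fP => -[x' Px' <-] [y' Py' <-]; rewrite (nsq_norm (fiso _ _)).
  exact: unit_rhombus_diam h0 Px' Py'.
have [/corner_mem c1 /corner_mem c2 /corner_mem c3 /corner_mem c4] := unit_rhombus_corner h.
have detE (x y : C) : `|x| = 1 -> `|y| = 1 ->
    det x y ^+ 2 = 1 - (Re x * Re y + Im x * Im y) ^+ 2.
  move=> /unit_sqr x1 /unit_sqr y1.
  have E : (Re x ^+ 2 + Im x ^+ 2) * (Re y ^+ 2 + Im y ^+ 2) = 1 by rewrite x1 y1 mulr1.
  by rewrite /det; lra.
case: (h) => nu nv _ _ _; case: (h0) => nu0 nv0 _ _ _.
rewrite !detE// lerD2l lerN2 -[leLHS]real_normK ?num_real// -[leRHS]real_normK ?num_real//.
rewrite ler_sqr ?nnegrE//.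
have := dist _ _ c2 c3; have := dist _ _ c4 c1.
rewrite /nsq !ReImE; have := unit_sqr nu; have := unit_sqr nv.
move: `|Re u0 * Re v0 + Im u0 * Im v0| => B.
by move=> nv1 nu1 d1 d2; rewrite ler_norml; apply/andP; split; lra.
Qed.

Lemma coord_near a u v z p (s t s' t' : R) : `|u| = 1 -> `|v| = 1 -> det u v != 0 ->
  z = a + s%:C%C * u + t%:C%C * v -> p = a + s'%:C%C * u + t'%:C%C * v ->
  `|s - s'| * `|det u v| <= 2 * supn (z - p) /\ `|t - t'| * `|det u v| <= 2 * supn (z - p).
Proof.
move=> u1 v1 D0 zE pE.
have zp : z - p = (s - s')%:C%C * u + (t - t')%:C%C * v.
  by rewrite zE pE !rmorphB; ring.
split; rewrite -normrM.
  by rewrite -{1}(coord1 D0 (s - s') (t - t')) -zp divfK// det_le.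
by rewrite -{1}(coord2 D0 (s - s') (t - t')) -zp divfK// det_le'.
Qed.

Lemma coord_at u v a z : det u v != 0 ->
  exists s t : R, z = a + s%:C%C * u + t%:C%C * v.
Proof.
move=> D0; exists (det (z - a) v / det u v), (det u (z - a) / det u v).
by rewrite -addrA -coordE// addrC subrK.
Qed.

(** A face is closed; the radius form, uniform in whether [p] lies in [P], allows a minimum over
    finitely many faces. If [p] is outside, one of its coordinates misses [0, 1] by some d, and
    coordinates are Lipschitz by Cramer's rule. *)
Lemma face_closed P p : Lam P ->
  exists2 r : R, 0 < r & forall z, P z -> supn (z - p) < r -> P p.
Proof.
move=> LP; have [Pp|nPp] := pselect (P p); first by exists 1.
have [a [u [v h]]] := faces_rhombi tess LP.
have D0 := unit_rhombus_det h; have [s' [t' pE]] := coord_at a p D0.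
have Dp : 0 < `|det u v| by rewrite normr_gt0.
have [u1 v1 _ _ _] := h.
have bad : exists2 d : R, 0 < d & forall s t : R, 0 <= s <= 1 -> 0 <= t <= 1 ->
    d <= `|s - s'| \/ d <= `|t - t'|.
  have [s0|s0] := ltP s' 0.
    exists (- s') => [|s t s01 t01]; first lra.
    by left; rewrite (le_trans _ (ler_norm _))//; lra.
  have [s1|s1] := ltP 1 s'.
    exists (s' - 1) => [|s t s01 t01]; first lra.
    by left; rewrite distrC (le_trans _ (ler_norm _))//; lra.
  have [t0|t0] := ltP t' 0.
    exists (- t') => [|s t s01 t01]; first lra.
    by right; rewrite (le_trans _ (ler_norm _))//; lra.
  have [t1|t1] := ltP 1 t'.
    exists (t' - 1) => [|s t s01 t01]; first lra.
    by right; rewrite distrC (le_trans _ (ler_norm _))//; lra.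
  by exfalso; apply: nPp; rewrite pE; apply: unit_rhombus_mem; rewrite ?s0 ?s1 ?t0 ?t1.
have [d d0 dP] := bad.
exists (d * `|det u v| / 2); first by rewrite divr_gt0// mulr_gt0.
move=> z Pz zp; exfalso.
have [s [t [s01 t01 zE]]] := unit_rhombus_memP h Pz.
have [c1 c2] := coord_near u1 v1 D0 zE pE.
have zp' : 2 * supn (z - p) < d * `|det u v| by lra.
case: (dP _ _ s01 t01) => dle.
  by have := lt_le_trans (le_lt_trans c1 zp') (ler_wpM2r (ltW Dp) dle); rewrite ltxx.
by have := lt_le_trans (le_lt_trans c2 zp') (ler_wpM2r (ltW Dp) dle); rewrite ltxx.
Qed.

Definition center a u v := a + (2^-1)%:C%C * u + (2^-1)%:C%C * v.

Lemma open_rhombus_interior P a u v z : unit_rhombus P a u v ->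
  open_rhombus a u v z -> rhombus_interior P z.
Proof. by move=> h oz; exists a, u, v. Qed.

(** A centre close enough to that of another face has coordinates strictly between 0 and 1 there, so
    the two interiors meet. With distance below k / 4, coordinates deviate from 1/2 by less than
    1/2. *)
Lemma centers_separated : exists2 d : R, 0 < d &
  forall P a u v Q a' u' v', Lam P -> Lam Q -> unit_rhombus P a u v ->
  unit_rhombus Q a' u' v' -> supn (center a u v - center a' u' v') < d -> P = Q.
Proof.
have [k k0 kP] := det_bound.
exists (k / 4); first by rewrite divr_gt0.
move=> P a u v Q a' u' v' LP LQ h h' near; apply: contrapT => PQ.
have := faces_disjoint tess LP LQ PQ; apply/eqP/set0P.
exists (center a u v); split.
  apply: (open_rhombus_interior h); exists 2^-1, 2^-1.
  by split=> //; rewrite invr_gt0 ltr0n invf_lt1 ?ltr1n//.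
apply: (open_rhombus_interior h').
have D0 := unit_rhombus_det h'; have [s [t cE]] := coord_at a' (center a u v) D0.
have [u1 v1 _ _ _] := h'.
have [c1 c2] := coord_near u1 v1 D0 cE (erefl (center a' u' v')).
have kD := kP _ _ _ _ LQ h'.
have half (x : R) : `|x - 2^-1| * `|det u' v'| <=
    2 * supn (center a u v - center a' u' v') -> 0 < x < 1.
  move=> xle; have : `|x - 2^-1| * k < 2^-1 * k.
    by rewrite (le_lt_trans (ler_wpM2l (normr_ge0 _) kD))//; lra.
  by rewrite ltr_pM2r// ltr_norml; lra.
by exists s, t; split; [exact: half|exact: half|].
Qed.

Lemma fin_min (I : finType) (r : I -> R) : (forall i, 0 < r i) ->
  exists2 d : R, 0 < d & forall i, d <= r i.
Proof.
move=> r0; exists (\big[Num.min/1]_i r i); last by move=> i; exact: bigmin_le_cond.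
by apply: lt_bigmin.
Qed.

(** Pigeonhole: a face that comes within 1 of [p] has its centre within 2 of [p]. That square is cut
    into cells of mesh less than the separation of centres, so each cell accounts for at most one
    face, and finitely many radii from [face_closed] remain. *)
Lemma locally_finite p : exists2 r : R, 0 < r &
  forall P z, Lam P -> P z -> supn (z - p) < r -> P p.
Proof.
have [d d0 dP] := centers_separated.
pose k := (Num.truncn d^-1).+1%:R : R.
have kd : d^-1 < k by rewrite /k truncnS_gt.
have k0 : 0 < k by rewrite (lt_trans _ kd)// invr_gt0.
(* Coordinates are shifted from [-2, 2] to [0, 4] and then scaled by [k], which exceeds 1 / d, so
   points with the same index differ by less than d. *)
pose N := (Num.truncn (4 * k)).+1.
pose cell (x : R) : 'I_N := inord (Num.truncn ((x + 2) * k)).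
have cellP (x y : R) : -2 <= x <= 2 -> -2 <= y <= 2 -> cell x = cell y -> `|x - y| < d.
  have tr (w : R) : -2 <= w <= 2 -> (Num.truncn ((w + 2) * k) < N)%N /\
      (Num.truncn ((w + 2) * k))%:R <= (w + 2) * k < (Num.truncn ((w + 2) * k)).+1%:R.
    move=> w2; split; last by apply: truncn_itv; rewrite mulr_ge0 ?(ltW k0)//; lra.
    by rewrite ltnS le_truncn// ler_wpM2r ?(ltW k0)//; lra.
  move=> x2 y2; have [xN xk] := tr _ x2; have [yN yk] := tr _ y2.
  move=> /(congr1 (@nat_of_ord N)); rewrite !inordK// => E.
  rewrite E -!natr1 in xk yk.
  have kd1 : 1 < d * k by rewrite mulrC -ltr_pdivrMr// mul1r.
  rewrite -(ltr_pM2r k0) -[in ltLHS](gtr0_norm k0) -normrM ltr_norml.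
  by lra.
pose good (ij : 'I_N * 'I_N) r := forall P a u v z, Lam P -> unit_rhombus P a u v ->
  cell (Re (center a u v - p)) = ij.1 -> cell (Im (center a u v - p)) = ij.2 ->
  supn (center a u v - p) <= 2 ->
  P z -> supn (z - p) < r -> P p.
(* If some face has its centre in the cell, it is the only one and its own radius serves; otherwise
   any radius does. *)
have ex ij : exists r : R, 0 < r /\ good ij r.
  have [[P0 [a0 [u0 [v0 [LP0 h0 c1 c2 c3]]]]]|none] := pselect (exists P a u v,
      [/\ Lam P, unit_rhombus P a u v, cell (Re (center a u v - p)) = ij.1,
        cell (Im (center a u v - p)) = ij.2 & supn (center a u v - p) <= 2]); last first.
    by exists 1; split=> // P a u v z *; exfalso; apply: none; exists P, a, u, v.
  have [r r0 rP] := face_closed p LP0; exists r; split=> // P a u v z LP h d1 d2 d3.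
  suff -> : P = P0 by exact: rP.
  apply: (dP _ _ _ _ _ _ _ _ LP LP0 h h0).
  move: c3 d3; rewrite !supn_le !ler_norml => /andP[c3 c4] /andP[d3 d4].
  have := cellP _ _ d3 c3; rewrite c1 d1 => /(_ erefl).
  have := cellP _ _ d4 c4; rewrite c2 d2 => /(_ erefl).
  rewrite supn_lt !ReImE => im re; apply/andP; split.
    by rewrite (le_lt_trans _ re)// le_eqVlt; apply/orP; left; apply/eqP; congr `|_|; ring.
  by rewrite (le_lt_trans _ im)// le_eqVlt; apply/orP; left; apply/eqP; congr `|_|; ring.
have [r rP] := choice ex.
have [r1 r10 r1P] := fin_min (fun ij => (rP ij).1).
exists (Num.min r1 1); first by rewrite lt_min r10 ltr01.
move=> P z LP Pz; rewrite lt_min => /andP[zr1 z1].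
have [a [u [v h]]] := faces_rhombi tess LP.
have cz : supn (center a u v - p) <= 2.
  have -> : center a u v - p = (center a u v - z) + (z - p) by ring.
  apply: le_trans (supnD _ _) _.
  suff : supn (center a u v - z) <= 1 by lra.
  have [s [t [s01 t01 ->]]] := unit_rhombus_memP h Pz.
  have -> : center a u v - (a + s%:C%C * u + t%:C%C * v) =
    (2^-1 - s)%:C%C * u + (2^-1 - t)%:C%C * v by rewrite /center !rmorphB; ring.
  apply: le_trans (supnD _ _) _; rewrite !supnZ; have [u1 v1 _ _ _] := h.
  have half (x y : R) : 0 <= x <= 1 -> 0 <= y <= 1 -> `|2^-1 - x| * y <= 2^-1.
    move=> x01 /andP[y0 y1]; rewrite -[leRHS]mulr1 ler_pM// ler_norml; lra.
  have := half _ _ s01 (introT andP (conj (supn_ge0 u) (supn_unit u1))).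
  have := half _ _ t01 (introT andP (conj (supn_ge0 v) (supn_unit v1))).
  by lra.
pose ij := (cell (Re (center a u v - p)), cell (Im (center a u v - p))).
apply: ((rP ij).2 _ _ _ _ z LP h) => //.
exact: lt_le_trans zr1 (r1P ij).
Qed.

(** The edge-to-edge condition leaves no T-junction: the intersection is a common corner or a common
    side, and a side contains no corners besides its ends. *)
Lemma corner_transfer P Q a : Lam P -> Lam Q -> corner P a -> Q a -> corner Q a.
Proof.
move=> LP LQ ca Qa; have [<-//|PQ] := pselect (P = Q).
have Ia : (P `&` Q) a by split=> //; exact: corner_mem.
case: (faces_edge_to_edge tess LP LQ PQ) => [E|[b [cb cb' E]]|[b [c [s1 s2 E]]]].
- by rewrite E in Ia.
- by rewrite E in Ia; rewrite Ia.
rewrite E in Ia; have [cb cc] := side_corner s2.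
by have [->|->] := segment_corner s1 Ia ca.
Qed.

(** Three cases: a vertex serves itself; a point inside a shared edge is served by an end of that
    edge, by [side_common]; a point in a single face is served by any corner. *)
Lemma common_corner p : exists q, forall P, Lam P -> P p -> corner P q.
Proof.
have [[P [LP cp]]|nc] := pselect (exists P, Lam P /\ corner P p).
  by exists p => Q LQ; exact: corner_transfer cp.
have {}nc P : Lam P -> ~ corner P p by move=> LP cp; apply: nc; exists P.
have [P LP Pp] : (\bigcup_(P in Lam) P) p by rewrite (faces_cover tess).
have meet Q : Lam Q -> Q p -> P <> Q ->
    exists a b, [/\ side P a b, side Q a b & segment a b p].
  move=> LQ Qp PQ; have Ip : (P `&` Q) p by [].
  case: (faces_edge_to_edge tess LP LQ PQ) => [E|[b [cb cb' E]]|[b [c [s1 s2 E]]]].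
  - by rewrite E in Ip.
  - by rewrite E in Ip; exfalso; apply: (nc P LP); rewrite Ip.
  by exists b, c; split=> //; rewrite -E.
have [[Q [LQ Qp PQ]]|alone] := pselect (exists Q, [/\ Lam Q, Q p & P <> Q]).
  have [a [b [sP _ pab]]] := meet Q LQ Qp PQ.
  exists a => T LT Tp; have [<-|PT] := pselect (P = T); first by have [] := side_corner sP.
  have [a' [b' [sP' sT' pab']]] := meet T LT Tp PT.
  have [c1 c2] := side_corner sT'.
  by have [->|->] := side_common sP sP' pab pab' (nc P LP).
have [a [u [v h]]] := faces_rhombi tess LP.
exists a => Q LQ Qp; have [<-|PQ] := pselect (P = Q); first by exists u, v.
by exfalso; apply: alone; exists Q.
Qed.

Lemma star p : exists r : R, exists q, 0 < r /\
  forall P z, Lam P -> P z -> supn (z - p) < r -> corner P q.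
Proof.
have [r r0 rP] := locally_finite p; have [q qP] := common_corner p.
by exists r, q; split=> // P z LP Pz zp; apply: qP => //; exact: rP zp.
Qed.

End Tessellation.

(** * Connectedness and simple connectedness *)

Section SimplyConnected.
Context (R : realType).
Local Notation C := R[i].
Local Notation Re := (@complex.Re R).
Local Notation Im := (@complex.Im R).
Implicit Types (a b u v w z p q : C) (P Q : set C).
Context (Lam : set (set C)).
Hypothesis tess : rhombic_tessellation Lam.

(** A Lebesgue number for the cover of the compact square by stars: half the star radius at x works
    at all points within that half of x. *)
Lemma star_uniform (B : R) : exists2 r : R, 0 < r & forall p, supn p <= B ->
  exists q, forall P z, Lam P -> P z -> supn (z - p) < r -> corner P q.
Proof.
pose good (r : R) (x : R * R) := exists q, forall P z, Lam P -> P z ->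
  supn (z - (x.1 +i* x.2)%C) < r -> corner P q.
pose K := (`[- B, B] `*` `[- B, B]) : set (R * R).
have cK : compact K by apply: compact_setX; exact: segment_compact.
have loc : forall x, K x -> \forall x' \near x & r \near (0 : R)^'+, good r x'.
  move=> x _; have [r [q [r0 rq]]] := star tess (x.1 +i* x.2)%C.
  have r20 : 0 < r / 2 by rewrite divr_gt0.
  exists (ball x (r / 2), [set s | s < r / 2]).
    split; first exact: nbhsx_ballx.
    exact: nbhs_right_lt.
  move=> [x' s] /= [[xx1 xx2] sr]; exists q => P z LP Pz zx; apply: (rq P z LP Pz).
  have -> : z - (x.1 +i* x.2)%C = (z - (x'.1 +i* x'.2)%C) + ((x'.1 - x.1) +i* (x'.2 - x.2))%C.
    by apply: cplx_eq; rewrite !ReImE /=; ring.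
  rewrite (le_lt_trans (supnD _ _))// [ltRHS](splitr r) ltrD//; first exact: lt_trans zx _.
  by rewrite supn_lt /= [`|x'.1 - _|]distrC [`|x'.2 - _|]distrC; apply/andP; split.
have := (compact_near_coveringP K).1 cK _ _ good _ loc.
move=> near0.
have : \forall r \near (0 : R)^'+, 0 < r /\ K `<=` good r.
  by near=> r; split; near: r; [exact: nbhs_right_gt|exact: near0].
move=> /filter_ex [r [r0 rK]]; exists r => // p; rewrite supn_le !ler_norml => /andP[p1 p2].
have [|q qP] := rK (Re p, Im p).
  by split; rewrite /= in_itv /=.
exists q => P z LP Pz zp; apply: (qP P z LP Pz) => /=.
by move: zp; case: (p).
Unshelve. all: by end_near. Qed.

Lemma face_at_subproof z : exists P, Lam P /\ P z.
Proof.
have [P LP Pz] : (\bigcup_(P in Lam) P) z by rewrite (faces_cover tess).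
by exists P.
Qed.

Definition face_at z : set C := sval (cid (face_at_subproof z)).

Lemma face_atL z : Lam (face_at z).
Proof. by rewrite /face_at; case: cid => P []. Qed.

Lemma face_at_mem z : face_at z z.
Proof. by rewrite /face_at; case: cid => P []. Qed.

Lemma addrCK (x y : C) : x + y - x = y.
Proof. by rewrite addrAC subrr add0r. Qed.

Lemma mesh_size (B r : R) : 0 < r -> exists m : nat, B / m.+1%:R < r.
Proof.
move=> r0; exists (Num.truncn (B / r)).
rewrite ltr_pdivrMr ?ltr0n// mulrC -ltr_pdivrMr//.
exact: truncnS_gt.
Qed.

Definition ray (m : nat) z (k : nat) : C := (k%:R / m.+1%:R)%:C%C * z.

Lemma ray0 m z : ray m z 0 = 0.
Proof. by rewrite /ray mul0r rmorph0 mul0r. Qed.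

Lemma ray_last m z : ray m z m.+1 = z.
Proof. by rewrite /ray divff ?pnatr_eq0// rmorph1 mul1r. Qed.

Lemma ray_le m z k : (k <= m.+1)%N -> supn (ray m z k) <= supn z.
Proof.
move=> km; rewrite /ray supnZ ger0_norm ?divr_ge0//.
by rewrite ler_piMl ?supn_ge0// ler_pdivrMr ?ltr0n// mul1r ler_nat.
Qed.

Lemma ray_step m z k : supn (ray m z k.+1 - ray m z k) = supn z / m.+1%:R.
Proof.
have -> : ray m z k.+1 - ray m z k = (m.+1%:R^-1)%:C%C * z.
  by rewrite /ray -mulrBl -rmorphB -mulrBl -natr1 addrAC subrr add0r mul1r.
by rewrite supnZ ger0_norm ?invr_ge0// mulrC.
Qed.

Lemma rayB m z w k : ray m w k - ray m z k = ray m (w - z) k.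
Proof. by rewrite /ray mulrBr. Qed.

(** Walk from 0 to z on a straight segment with steps finer than the star radius. Faces at
    consecutive points share a corner, and [W] spreads over the corners of each face along its
    sides. *)
Lemma vertices_ind (W : C -> Prop) :
  vertices Lam 0 -> W 0 ->
  (forall P a b, Lam P -> side P a b -> W a -> W b) ->
  forall z, vertices Lam z -> W z.
Proof.
move=> [P0 LP0 c0] W0 Wside z [Pz LPz cz].
have Wface P a b : Lam P -> corner P a -> corner P b -> W a -> W b.
  move=> LP [u [v h]] cb Wa.
  have Wu : W (a + u).
    by apply: (Wside P a) => //; exists v; rewrite addrCK.
  have Wv : W (a + v).
    by apply: (Wside P a) => //; exists u; rewrite addrCK; exact: unit_rhombus_sym.
  have Wuv : W (a + u + v).
    apply: (Wside P (a + u)) => //; exists (- u).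
    rewrite addrCK; apply: unit_rhombus_sym; exact: unit_rhombus_reroot.
  by case: (cornerP h cb) => ->.
have [r r0 rP] := star_uniform (supn z).
have [m mr] := mesh_size (supn z) r0.
have key k : (k <= m.+1)%N -> forall q, corner (face_at (ray m z k)) q -> W q.
  elim: k => [_ q|k IH km q cq].
    rewrite ray0 => cq; apply: (Wface _ 0 q (face_atL 0)) => //.
    exact: (corner_transfer tess LP0 (face_atL 0) c0 (face_at_mem 0)).
  have [s sP] := rP (ray m z k) (ray_le z (ltnW km)).
  apply: (Wface _ s q (face_atL _) _ cq).
    by apply: (sP _ _ (face_atL _) (face_at_mem _)); rewrite ray_step.
  apply: (IH (ltnW km)); apply: (sP _ _ (face_atL _) (face_at_mem _)).
  by rewrite subrr supn0.
apply: (key m.+1) => //; rewrite ray_last.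
exact: (corner_transfer tess LPz (face_atL z) cz (face_at_mem z)).
Qed.

(** * Discrete Poincare lemma: primitives of closed cochains *)

Section Poincare.
Local Notation V := C.
Context (om : C -> C -> V).
Hypothesis om_sym : forall a b, om b a = - om a b.
Hypothesis om_closed : forall P a u v, Lam P -> unit_rhombus P a u v ->
  om a (a + u) + om (a + u) (a + u + v) = om a (a + v) + om (a + v) (a + u + v).

(** Closedness says precisely that the two routes to the opposite corner agree. The hypothesis
    [Lam P] sits under the existential so that choice yields potentials indexed by all sets. *)
Lemma pot_subproof P : exists f : C -> V, Lam P ->
  forall b c, side P b c -> f c - f b = om b c.
Proof.
have [LP|nLP] := pselect (Lam P); last by exists (fun=> 0).
have [a [u [v h]]] := faces_rhombi tess LP.
pose f q : V := if q == a then 0 else if q == a + u then om a (a + u)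
  else if q == a + v then om a (a + v) else om a (a + u) + om (a + u) (a + u + v).
have [u1 v1 uv uNv _] := h; have u0 := unit_neq0 u1; have v0 := unit_neq0 v1.
have addI (x y : C) : (x + y == x) = (y == 0) by rewrite -[X in _ == X]addr0 (inj_eq (addrI _)).
have f1 : f a = 0 by rewrite /f eqxx.
have f2 : f (a + u) = om a (a + u) by rewrite /f addI (negPf u0) eqxx.
have f3 : f (a + v) = om a (a + v).
  by rewrite /f addI (negPf v0) (inj_eq (addrI a)) [v == u]eq_sym (introF eqP uv) eqxx.
have f4 : f (a + u + v) = om a (a + u) + om (a + u) (a + u + v).
  rewrite /f -[a + u + v == a]/(_ == _) -addrA addI addr_eq0 (introF eqP uNv).
  rewrite (inj_eq (addrI a)) addI (negPf v0) (inj_eq (addrI a)).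
  by rewrite [u + v]addrC addI (negPf u0).
exists f => _ b c sd.
have E1 : a + u - u = a by rewrite addrK.
have E2 : a + v - v = a by rewrite addrK.
have E3 : a + u + v - v = a + u by rewrite addrK.
have E4 : a + u + v - u = a + v by rewrite addrAC addrK.
have E5 : a + v + u = a + u + v by rewrite addrAC.
have cl := om_closed LP h.
have cl2 : om a (a + u) + om (a + u) (a + u + v) - om a (a + v) = om (a + v) (a + u + v).
  by rewrite cl addrCK.
have [b0 [u' [v' [-> -> _]]]] := sideP h sd.
case=> -[-> [[-> _]|[-> _]]]; rewrite ?(E1, E2, E3, E4, E5) ?(f1, f2, f3, f4).
- by rewrite subr0.
- by rewrite subr0.
- by rewrite sub0r -om_sym.
- by rewrite addrCK.
- exact: cl2.
- by rewrite sub0r -om_sym.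
- by rewrite [RHS]om_sym -cl2 opprB.
- by rewrite opprD addrA subrr sub0r -om_sym.
Qed.

Definition pot P : C -> V := sval (cid (pot_subproof P)).

Lemma pot_side P b c : Lam P -> side P b c -> pot P c - pot P b = om b c.
Proof. by move=> LP; rewrite /pot; case: cid => f /= /(_ LP); apply. Qed.

(** Two distinct corners shared by distinct faces are the ends of a shared edge, along which both
    potentials increase by the same amount. *)
Lemma pot_agree P Q q q' : Lam P -> Lam Q -> corner P q -> corner P q' ->
  corner Q q -> corner Q q' -> pot P q - pot Q q = pot P q' - pot Q q'.
Proof.
move=> LP LQ cPq cPq' cQq cQq'.
have [<-|PQ] := pselect (P = Q); first by rewrite !subrr.
have [<-//|qq'] := eqVneq q q'.
have Iq : (P `&` Q) q by split; exact: corner_mem.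
have Iq' : (P `&` Q) q' by split; exact: corner_mem.
have swap b c : side P b c -> side Q b c -> pot P b - pot Q b = pot P c - pot Q c.
  move=> s1 s2.
  have -> : pot P c = pot P b + om b c by rewrite -(pot_side LP s1); ring.
  have -> : pot Q c = pot Q b + om b c by rewrite -(pot_side LQ s2); ring.
  by ring.
case: (faces_edge_to_edge tess LP LQ PQ) => [E|[b [_ _ E]]|[b [c [s1 s2 E]]]].
- by rewrite E in Iq.
- by move: qq'; rewrite E in Iq Iq'; rewrite Iq Iq' eqxx.
rewrite E in Iq Iq'.
case: (segment_corner s1 Iq cPq) => qE; case: (segment_corner s1 Iq' cPq') => qE'.
- by rewrite qE qE'.
- by rewrite qE qE'; exact: swap.
- by rewrite qE qE'; apply/esym/swap.
- by rewrite qE qE'.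
Qed.

(** The constant by which two local potentials differ. Any shared corner gives the same value; the
    default 0 of [xget] concerns faces without a shared corner only. *)
Definition jump P Q : V :=
  let q := xget 0 [set q | corner P q /\ corner Q q] in pot P q - pot Q q.

Lemma jumpE P Q q : Lam P -> Lam Q -> corner P q -> corner Q q ->
  jump P Q = pot P q - pot Q q.
Proof.
move=> LP LQ cP cQ; rewrite /jump.
by case: xgetP => [q' _ [cP' cQ']|/(_ q)[]//]; exact: pot_agree.
Qed.

(** A single corner common to all three faces is required; [star_uniform] is what provides it. *)
Lemma jump_cocycle P Q T q : Lam P -> Lam Q -> Lam T ->
  corner P q -> corner Q q -> corner T q -> jump P Q + jump Q T = jump P T.
Proof.
by move=> *; rewrite !(@jumpE _ _ q)// addrA subrK.
Qed.

(** Total jump collected from the face at 0 to the face at the k-th point of the ray: continuation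
    of the local potential along the ray. *)
Definition dev m z (k : nat) : V :=
  \sum_(j < k) jump (face_at (ray m z j)) (face_at (ray m z j.+1)).

(** The number of subdivisions depends on the region, hence the bound [B]. The primitive is the
    local potential at z corrected by the jumps met on the ray from 0. *)
Lemma primitive (B : R) : exists U : C -> V, forall P a b, Lam P -> side P a b ->
  supn a <= B -> supn b <= B -> U b - U a = om a b.
Proof.
have [r r0 rP] := star_uniform B.
have r20 : 0 < r / 2 by rewrite divr_gt0.
have [m mr] := mesh_size (2 * B) r20.
have c2 x y z : supn (x - y) < r / 2 -> supn (y - z) < r / 2 -> supn (x - z) < r.
  move=> xy yz; have -> : x - z = (x - y) + (y - z) by ring.
  by rewrite (le_lt_trans (supnD _ _))// (splitr r) ltrD.
have fin x y : supn (x - y) < r / 2 -> supn (x - y) < r.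
  by move=> /lt_trans; apply; lra.
have stepr x k : supn x <= B -> supn (ray m x k.+1 - ray m x k) < r / 2.
  move=> xB; rewrite ray_step (le_lt_trans _ mr)// ler_pM2r ?invr_gt0 ?ltr0n//.
  by have := supn_ge0 x; lra.
pose u z := dev m z m.+1.
(* Two neighbouring rays form a ladder. The half radius keeps the four faces around each of its
   cells in one star, so the cocycle rule carries the comparison from one rung to the next. *)
have uE x y : supn x <= B -> supn y <= B -> supn (y - x) < r / 2 ->
    u y = u x + jump (face_at x) (face_at y).
  move=> xB yB xy.
  suff key k : (k <= m.+1)%N ->
      dev m y k = dev m x k + jump (face_at (ray m x k)) (face_at (ray m y k)).
    by have := key m.+1 (leqnn _); rewrite !ray_last.
  elim: k => [_|k IH km].
    by rewrite /dev !big_ord0 !ray0 add0r /jump subrr.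
  rewrite /dev !big_ord_recr /= -/(dev m y k) -/(dev m x k) (IH (ltnW km)).
  have [q qP] := rP (ray m x k) (le_trans (ray_le x (ltnW km)) xB).
  have xyk : supn (ray m y k - ray m x k) < r / 2.
    by rewrite rayB (le_lt_trans _ xy)// ray_le// ltnW.
  have q1 : corner (face_at (ray m x k)) q.
    by apply: qP (face_atL _) (face_at_mem _) _; rewrite subrr supn0.
  have q2 : corner (face_at (ray m x k.+1)) q.
    by apply: qP (face_atL _) (face_at_mem _) _; apply: fin; exact: stepr.
  have q3 : corner (face_at (ray m y k)) q.
    by apply: qP (face_atL _) (face_at_mem _) _; exact: fin.
  have q4 : corner (face_at (ray m y k.+1)) q.
    by apply: qP (face_atL _) (face_at_mem _) _; apply: c2 xyk; exact: stepr.
  by rewrite -[LHS]addrA -[RHS]addrA !(@jump_cocycle _ _ _ q)//; exact: face_atL.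
exists (fun z => u z + pot (face_at z) z) => Q a b LQ sd aB bB.
have [ca cb] := side_corner sd.
have ab2 : supn (b - a) <= 2 * B.
  by rewrite (le_trans (supnD _ _))// supnN; lra.
pose x k := a + ray m (b - a) k.
have xQ k : (k <= m.+1)%N -> Q (x k).
  move=> km; apply: (segment_sub sd); exists (k%:R / m.+1%:R) => //.
  by rewrite divr_ge0//= ler_pdivrMr ?ltr0n// mul1r ler_nat.
have xB k : (k <= m.+1)%N -> supn (x k) <= B.
  move=> km; have km1 : 0 <= (k%:R / m.+1%:R : R) <= 1.
    by rewrite divr_ge0//= ler_pdivrMr ?ltr0n// mul1r ler_nat.
  rewrite /x /ray; move: (k%:R / m.+1%:R : R) km1 => t t01.
  have -> : a + t%:C%C * (b - a) = (1 - t)%:C%C * a + t%:C%C * b.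
    by rewrite rmorphB rmorph1; ring.
  have -> : B = (1 - t) * B + t * B by ring.
  by rewrite (le_trans (supnD _ _))// !supnZ !ger0_norm ?lerD ?ler_wpM2l//; lra.
(* Along the edge every point lies in [Q], so [u (x k)] plus the jump from the face at [x k] to [Q]
   stays constant. *)
have key k : (k <= m.+1)%N ->
    u (x k) = u a + jump (face_at a) Q - jump (face_at (x k)) Q.
  elim: k => [_|k IH km]; first by rewrite /x ray0 addr0 addrK.
  have xx : supn (x k.+1 - x k) < r / 2.
    have -> : x k.+1 - x k = ray m (b - a) k.+1 - ray m (b - a) k by rewrite /x; ring.
    by rewrite ray_step (le_lt_trans _ mr)// ler_pM2r ?invr_gt0 ?ltr0n.
  rewrite (uE (x k) (x k.+1)) ?xB// 1?ltnW// IH 1?ltnW//.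
  have [q qP] := rP (x k) (xB k (ltnW km)).
  have q1 : corner (face_at (x k)) q.
    by apply: qP (face_atL _) (face_at_mem _) _; rewrite subrr supn0.
  have q2 : corner Q q.
    by apply: qP LQ (xQ k (ltnW km)) _; rewrite subrr supn0.
  have q3 : corner (face_at (x k.+1)) q.
    by apply: qP (face_atL _) (face_at_mem _) _; apply: fin.
  rewrite -(@jump_cocycle (face_at (x k)) (face_at (x k.+1)) Q q)//; try exact: face_atL.
  by ring.
have := key m.+1 (leqnn _); rewrite {1 2}/x ray_last [a + (b - a)]addrC subrK => ->.
have ca' := corner_transfer tess LQ (face_atL a) ca (face_at_mem a).
have cb' := corner_transfer tess LQ (face_atL b) cb (face_at_mem b).
rewrite (jumpE (face_atL a) LQ ca' ca) (jumpE (face_atL b) LQ cb' cb) -(pot_side LQ sd).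
move: (u a) (pot _ a) (pot Q a) (pot _ b) (pot Q b) => A A1 A2 B1 B2.
by ring.
Qed.

End Poincare.
End SimplyConnected.

(** * Discrete analytic functions *)

Section Graph.
Context (R : realType) (L : rhombic_lattice R).
Local Notation C := R[i].
Local Notation vertex := (vertex L).
Local Notation origin := (origin L).
Local Notation tess := (faces_tessellation L).

Lemma valO : \val origin = 0 :> C. Proof. exact: SubK. Qed.

Lemma adj_sym (a b : vertex) : adj a b -> adj b a.
Proof.
by move=> /asboolP[P LP sd]; apply/asboolP; exists P => //; exact: side_sym.
Qed.

Lemma adj_unit (a b : vertex) : adj a b -> `|\val b - \val a| = 1.
Proof. by move=> /asboolP[P LP [v []]]. Qed.

Lemma side_vertex P a b : faces L P -> side P a b ->
  exists x y : vertex, [/\ \val x = a, \val y = b & adj x y].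
Proof.
move=> LP sd; have [ca cb] := side_corner sd.
have Va : a \in vertices L by rewrite inE; exists P.
have Vb : b \in vertices L by rewrite inE; exists P.
exists (Sub a Va), (Sub b Vb); split; rewrite ?SubK//.
by apply/asboolP; exists P => //; rewrite !SubK.
Qed.

Lemma vertex_ind (W : vertex -> Prop) :
  W origin -> (forall a b, adj a b -> W a -> W b) -> forall z, W z.
Proof.
move=> W0 Wadj z.
pose W' (x : C) := forall z : vertex, \val z = x -> W z.
have V0 : vertices L 0 by have := origin_vertex L; rewrite inE.
suff H : forall x, vertices L x -> W' x.
  by apply: (H (\val z)) => //; have := valP z; rewrite inE.
apply: (vertices_ind tess) => //.
  by move=> x x0; have -> : x = origin by apply: val_inj; rewrite x0 valO.
move=> P a b LP sd Wa y yb.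
have [x [y' [xa yb' xy]]] := side_vertex LP sd.
have -> : y = y' by apply: val_inj; rewrite yb yb'.
by apply: Wadj xy _; exact: Wa.
Qed.

Lemma path_from_origin (z : vertex) : exists p, is_path origin z p.
Proof.
elim/vertex_ind: z => [|a b ab [p [pp lp]]]; first by exists [::].
by exists (rcons p b); split; rewrite ?rcons_path ?last_rcons// pp lp.
Qed.

Lemma path_to_origin (z : vertex) : exists p, is_path z origin p.
Proof.
elim/vertex_ind: z => [|a b ab [p [pp lp]]]; first by exists [::].
by exists (a :: p); split=> //=; rewrite (adj_sym ab).
Qed.

Section EdgeRelation.
Context (V : lmodType C).
Implicit Types (f g : vertex -> V).

(** It says that g + f / 2 is a primitive of f for the trapezoidal sums, hence that g is Z_+ f up to
    a constant, with no mention of paths. *)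
Definition edge_rel f g := forall a b : vertex, adj a b ->
  g b = g a + (2^-1 * (1 + (\val b - \val a))) *: f a
            - (2^-1 * (1 - (\val b - \val a))) *: f b.

Lemma path_integral_cons f a b p :
  path_integral f a (b :: p) =
  (\val b - \val a) *: (2^-1 *: (f a + f b)) + path_integral f b p.
Proof. by rewrite /path_integral /= big_cons. Qed.

Lemma path_integral_cat f a p q :
  path_integral f a (p ++ q) = path_integral f a p + path_integral f (last a p) q.
Proof.
elim: p a => [|b p IH] a; first by rewrite /path_integral /= big_nil add0r.
by rewrite cat_cons !path_integral_cons IH addrA.
Qed.

Lemma edge_term f (a b : vertex) :
  (\val b - \val a) *: (2^-1 *: (f a + f b)) =
  (2^-1 * (1 + (\val b - \val a))) *: f a - (2^-1 * (1 - (\val b - \val a))) *: f b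
   + (2^-1 *: f b - 2^-1 *: f a).
Proof.
set e := _ - _.
rewrite scalerA scalerDr [2^-1 *: f b - _]addrC addrACA -![- (_ *: f _)]scaleNr -!scalerDl.
by congr (_ *: _ + _ *: _); field.
Qed.


Lemma edge_relE f g : edge_rel f g <-> forall a b : vertex, adj a b ->
  g b + 2^-1 *: f b = (g a + 2^-1 *: f a) + (\val b - \val a) *: (2^-1 *: (f a + f b)).
Proof.
have E a b : (g a + 2^-1 *: f a) + (\val b - \val a) *: (2^-1 *: (f a + f b)) =
    (g a + (2^-1 * (1 + (\val b - \val a))) *: f a
            - (2^-1 * (1 - (\val b - \val a))) *: f b) + 2^-1 *: f b.
  by rewrite edge_term addrACA -!addrA; congr (_ + (_ + (_ + _))); rewrite addrC subrK.
split=> fg a b ab; first by rewrite E -(fg a b ab).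
by apply: (addIr (2^-1 *: f b)); rewrite (fg a b ab) E.
Qed.

Lemma edge_rel_integral f g a b p : edge_rel f g -> is_path a b p ->
  path_integral f a p = (g b + 2^-1 *: f b) - (g a + 2^-1 *: f a).
Proof.
move=> /edge_relE fg; elim: p a => [|c p IH] a [/= pp lp].
  by rewrite /path_integral /= big_nil lp subrr.
move: pp => /andP[ac pp].
rewrite path_integral_cons (IH c)// (fg _ _ ac).
move: (g a + _) (_ *: (_ *: _)) (g b + _) => ha E hb.
by rewrite [LHS]addrC opprD addrA subrK.
Qed.

Lemma edge_rel_DA f g : edge_rel f g -> DA f.
Proof. by move=> fg a p ap; rewrite (edge_rel_integral fg ap) subrr. Qed.

Lemma DA_path_indep f a p q : DA f -> is_path origin a p -> is_path origin a q ->
  path_integral f origin p = path_integral f origin q.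
Proof.
move=> fD [pp lp] [pq lq]; have [r [pr lr]] := path_to_origin a.
apply: (addIr (path_integral f a r)).
rewrite -{1}lp -lq -!path_integral_cat !fD//; split.
- by rewrite cat_path pq lq.
- by rewrite last_cat lq.
- by rewrite cat_path pp lp.
- by rewrite last_cat lp.
Qed.

Lemma DA_integralE f a p : DA f -> is_path origin a p ->
  Defs.integral f origin a = path_integral f origin p.
Proof.
move=> fD op; rewrite /Defs.integral; case: xgetP => [q _ oq|/(_ p)//].
by apply: DA_path_indep fD oq op.
Qed.

Lemma DA_edge_rel f : DA f -> edge_rel f (Zplus f).
Proof.
move=> fD; apply/edge_relE => a b ab.
have ZE x : Zplus f x + 2^-1 *: f x = 2^-1 *: f origin + Defs.integral f origin x.
  by rewrite /Zplus scalerBr [LHS]addrAC subrK.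
rewrite !ZE -addrA; congr (_ + _).
have [p [pp lp]] := path_from_origin a.
rewrite (@DA_integralE _ a p)// (@DA_integralE _ b (rcons p b))//; last first.
  by split; rewrite ?rcons_path ?last_rcons// pp lp.
rewrite -cats1 path_integral_cat path_integral_cons lp.
by rewrite [path_integral f b _]/path_integral big_nil addr0.
Qed.

Lemma Zplus_origin f : DA f -> Zplus f origin = 0.
Proof.
move=> fD; rewrite /Zplus subrr scaler0 add0r (@DA_integralE _ _ [::])//.
by rewrite /path_integral big_nil.
Qed.

Lemma edge_rel_unique f g g' : edge_rel f g -> edge_rel f g' ->
  g origin = g' origin -> g = g'.
Proof.
move=> fg fg' gg'; apply/funext; elim/vertex_ind => // a b ab IH.
by rewrite (fg _ _ ab) (fg' _ _ ab) IH.
Qed.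

Lemma edge_rel_Zplus f g : edge_rel f g -> g origin = 0 -> Zplus f = g.
Proof.
move=> fg g0; have fD := edge_rel_DA fg.
by apply: (edge_rel_unique (DA_edge_rel fD) fg); rewrite g0 Zplus_origin.
Qed.

Lemma path_integralD f g a p :
  path_integral (f \+ g) a p = path_integral f a p + path_integral g a p.
Proof.
rewrite /path_integral -big_split; apply: eq_bigr => e _ /=.
by rewrite -!scalerDr addrACA.
Qed.

(** The path inside [integral] is chosen from its end points alone, so the same path serves f, g and
    their sum. *)
Lemma ZplusD f g : Zplus (f \+ g) = Zplus f \+ Zplus g.
Proof.
apply/funext => z; rewrite /Zplus /= /Defs.integral path_integralD.
by rewrite addrACA opprD -scalerDr addrACA.
Qed.

Lemma iter_ZplusD f g n :
  iter n (@Zplus _ _ V) (f \+ g) = iter n (@Zplus _ _ V) f \+ iter n (@Zplus _ _ V) g.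
Proof. by elim: n => //= n ->; rewrite ZplusD. Qed.

End EdgeRelation.

Section LinearImage.
Context (V W : lmodType C) (phi : {linear V -> W}).

Let phiZ (a : C) x : phi (a *: x) = a *: phi x.
Proof. exact: linearZZ. Qed.
Let phiD x y : phi (x + y) = phi x + phi y.
Proof. exact: raddfD. Qed.
Let phiB x y : phi (x - y) = phi x - phi y.
Proof. exact: raddfB. Qed.

Lemma path_integral_linear (f : vertex -> V) a p :
  path_integral (phi \o f) a p = phi (path_integral f a p).
Proof.
rewrite /path_integral raddf_sum; apply: eq_bigr => e _ /=.
by rewrite !phiZ phiD.
Qed.

Lemma Zplus_linear (f : vertex -> V) : Zplus (phi \o f) = phi \o Zplus f.
Proof.
apply/funext => z.
by rewrite /Zplus /= /Defs.integral path_integral_linear phiD phiZ phiB.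
Qed.

Lemma iter_Zplus_linear (f : vertex -> V) n :
  iter n (@Zplus _ _ W) (phi \o f) = phi \o iter n (@Zplus _ _ V) f.
Proof. by elim: n => //= n ->; rewrite Zplus_linear. Qed.

Lemma DA_linear (f : vertex -> V) : DA f -> DA (phi \o f).
Proof. by move=> fD a p ap; rewrite path_integral_linear fD// raddf0. Qed.

End LinearImage.

(** Separating functionals pass from vector values to complex ones, where [primitive] applies. *)
Lemma DA_of_functionals (V : lmodType C) (I : Type) (phi : I -> {linear V -> C^o})
    (f : vertex -> V) :
  (forall x, (forall i, phi i x = 0) -> x = 0) ->
  (forall i, DA (phi i \o f)) -> DA f.
Proof.
by move=> sep fD a p ap; apply: sep => i; rewrite -path_integral_linear fD.
Qed.

(** The trapezoidal cochain of g = Z_+ f is closed around every rhombus because its circulation is a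
    multiple of that of f; a primitive then kills all closed paths. *)
Lemma DA_Zplus_scalar (f : vertex -> C^o) : DA f -> DA (Zplus f).
Proof.
move=> fD; set g := Zplus f; have fg : edge_rel f g := DA_edge_rel fD.
(* [primitive] expects a cochain on pairs of complex numbers, so functions are extended by 0 off the
   vertices. *)
pose ext (h : vertex -> C) (z : C) : C := oapp h 0 (insub z).
have extE h (x : vertex) : ext h (\val x) = h x by rewrite /ext valK.
pose om (a b : C) : C := (b - a) * (2^-1 * (ext g a + ext g b)).
have om_sym a b : om b a = - om a b by rewrite /om; ring.
have om_closed P a u v : faces L P -> unit_rhombus P a u v ->
    om a (a + u) + om (a + u) (a + u + v) = om a (a + v) + om (a + v) (a + u + v).
  move=> LP h.
  have h2 := unit_rhombus_reroot h; have hs := unit_rhombus_sym h.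
  have h3 := unit_rhombus_reroot hs.
  have [|x [y [xE yE xy]]] := @side_vertex P a (a + u) LP.
    by exists v; rewrite addrCK.
  have [|x1 [t [x1E tE xt]]] := @side_vertex P a (a + v) LP.
    by exists u; rewrite addrCK.
  have [|y1 [z [y1E zE yz]]] := @side_vertex P (a + u) (a + u + v) LP.
    by exists (- u); rewrite addrCK; exact: unit_rhombus_sym.
  have [|t1 [z1 [t1E z1E tz]]] := @side_vertex P (a + v) (a + u + v) LP.
    exists (- v); have -> : a + u + v - (a + v) = u by ring.
    exact: unit_rhombus_sym.
  have ? : x1 = x by apply: val_inj; rewrite x1E xE.
  have ? : y1 = y by apply: val_inj; rewrite y1E yE.
  have ? : t1 = t by apply: val_inj; rewrite t1E tE.
  have ? : z1 = z by apply: val_inj; rewrite z1E zE.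
  subst x1 y1 t1 z1.
  have := fg _ _ xy; have := fg _ _ yz; have := fg _ _ xt; have := fg _ _ tz.
  have at_ c (q : vertex) : \val q = c -> ext g c = g q by move=> <-; exact: extE.
  have ea := at_ _ _ xE; have eb := at_ _ _ yE; have ec := at_ _ _ zE.
  have ed := at_ _ _ tE.
  rewrite /om ea eb ec ed xE yE zE tE.
  have -> : a + u - a = u by ring.
  have -> : a + v - a = v by ring.
  have -> : a + u + v - (a + u) = v by ring.
  have -> : a + u + v - (a + v) = u by ring.
  rewrite /GRing.scale /=.
  move: (f x : C) (f y : C) (f z : C) (f t : C) (g x : C) (g y : C) (g z : C) (g t : C).
  move=> fx fy fz ft gx gy gz gt gz1 gtE gz2 gyE.
  have F0 : u * (fx + fy) + v * (fy + fz) - v * (fx + ft) - u * (ft + fz) = 0.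
    have : 2 * (gz - gz) = 0 by ring.
    rewrite {1}gz2 gyE gz1 gtE => E0; by rewrite -E0; field.
  apply: subr0_eq.
  (* The factor is not symmetric in u and v because the value of g at the far corner z is expressed
     through the route over y; the route over t differs by a multiple of the vanishing bracket. *)
  transitivity ((v - 1) / 4 * (u * (fx + fy) + v * (fy + fz) - v * (fx + ft) - u * (ft + fz))).
    by rewrite gz2 gyE gtE; field.
  by rewrite F0 mulr0.
move=> a p ap.
(* A path visits finitely many vertices, so one bounded region and one primitive suffice. *)
pose B := \big[Num.max/0]_(x <- a :: p) supn (\val x).
have pB x : x \in a :: p -> supn (\val x) <= B by move=> xp; exact: (@le_bigmax_seq _ _ _ _ 0 x xpredT (fun x : vertex => supn (\val x)) xp isT).
have [U UP] := primitive (faces_tessellation L) om_sym om_closed B.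
suff key (q : seq vertex) (b : vertex) : path (@adj R L) b q -> {subset b :: q <= a :: p} ->
    path_integral g b q = U (\val (last b q)) - U (\val b).
  by case: ap => pp lp; rewrite key// lp subrr.
elim: q b => [|c q IH] b; first by rewrite /path_integral /= big_nil subrr.
move=> /andP[bc pq] sub; rewrite path_integral_cons IH//; last first.
  by move=> x xq; apply: sub; rewrite inE xq orbT.
move: (bc) => /asboolP[P LP sd].
have := UP P _ _ LP sd (pB b _) (pB c _).
move=> /(_ (sub b _) (sub c _)); rewrite !inE !eqxx ?orbT => /(_ erefl erefl).
rewrite /om !extE /GRing.scale /= => <-.
by ring.
Qed.

Lemma DA_iter_Zplus_scalar (f : vertex -> C^o) n : DA f -> DA (iter n (@Zplus _ _ C^o) f).
Proof. by move=> fD; elim: n => //= n; exact: DA_Zplus_scalar. Qed.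

Lemma DA_iter_functionals (V : lmodType C) (I : Type) (phi : I -> {linear V -> C^o})
    (f : vertex -> V) n :
  (forall x, (forall i, phi i x = 0) -> x = 0) ->
  DA f -> DA (iter n (@Zplus _ _ V) f).
Proof.
move=> sep fD; apply: (DA_of_functionals sep) => i.
by rewrite -iter_Zplus_linear; apply: DA_iter_Zplus_scalar; exact: DA_linear.
Qed.

Lemma DA_cst (V : lmodType C) (c : V) : DA (fun _ : vertex => c).
Proof.
apply: (@edge_rel_DA _ _ (fun z => \val z *: c)) => a b ab.
by rewrite -addrA -scalerBl -scalerDl; congr (_ *: _); field.
Qed.

(** At the origin only the term n = 0 survives. Along an edge the coefficients (1 + e) / 2 and (1 -
    e) / 2 have modulus at most 1, so an exponential bound of any rate r > 1 is passed on with a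
    larger constant. *)
Lemma growth (V : normedModType C) (f : nat -> vertex -> V) (r : C) :
  (forall n, edge_rel (f n) (f n.+1)) -> (forall n, f n.+1 origin = 0) -> 1 < r ->
  forall z, exists2 K : C, 0 <= K & forall n, `|f n z| <= K * r ^+ n.
Proof.
move=> fE f0 r1; have r0 : 0 <= r by rewrite ltW// (lt_trans ltr01).
elim/vertex_ind => [|a b ab [K K0 KP]].
  exists `|f 0%N origin| => // -[|n]; first by rewrite expr0 mulr1.
  by rewrite f0 normr0 mulr_ge0 ?exprn_ge0.
pose e := \val b - \val a; have e1 : `|e| = 1 := adj_unit ab.
have c1 : `|2^-1 * (1 + e)| <= 1.
  rewrite normrM ger0_norm ?invr_ge0// ler_pdivrMl ?ltr0n// mulr1.
  by rewrite (le_trans (ler_normD _ _))// e1 normr1.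
have c2 : `|2^-1 * (1 - e)| <= 1.
  rewrite normrM ger0_norm ?invr_ge0// ler_pdivrMl ?ltr0n// mulr1.
  by rewrite (le_trans (ler_normB _ _))// e1 normr1.
have r10 : 0 < r - 1 by rewrite subr_gt0.
(* Chosen so that K (r + 1) + K1 = K1 r, which closes the induction on n. *)
pose K1 := K * (r + 1) / (r - 1).
have K10 : 0 <= K1 by rewrite divr_ge0 ?(ltW r10)// mulr_ge0// addr_ge0.
exists (`|f 0%N b| + K1); first by rewrite addr_ge0.
elim=> [|n IH]; first by rewrite expr0 mulr1 lerDl.
rewrite (fE n _ _ ab) -/e (le_trans (ler_normB _ _))//.
have h1 : `|f n.+1 a + (2^-1 * (1 + e)) *: f n a| <= K * (r + 1) * r ^+ n.
  rewrite (le_trans (ler_normD _ _))// [K * (r + 1)]mulrDr mulrDl lerD//.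
    by rewrite (le_trans (KP _))// exprS mulrA.
  by rewrite normrZ mulr1 (le_trans _ (KP n))// ler_piMl.
have h2 : `|(2^-1 * (1 - e)) *: f n b| <= (`|f 0%N b| + K1) * r ^+ n.
  by rewrite normrZ (le_trans _ IH)// ler_piMl.
apply: le_trans (lerD h1 h2) _; rewrite -mulrDl exprS mulrA ler_wpM2r ?exprn_ge0//.
have -> : K * (r + 1) = K1 * (r - 1) by rewrite /K1 divfK// gt_eqF.
have -> : K1 * (r - 1) + (`|f 0%N b| + K1) = K1 * r + `|f 0%N b| by ring.
by rewrite mulrDl addrC lerD2r ler_peMr// ltW.
Qed.

End Graph.

(** * Hilbert spaces and the Riesz representation *)

Section ComplexReal.
Context (R : realType).
Local Notation C := R[i].
Local Notation Re := (@complex.Re R).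
Local Notation Im := (@complex.Im R).

Lemma ge0_RRe (x : C) : 0 <= x -> (Re x)%:C%C = x.
Proof. by move=> x0; apply: RRe_real; exact: ger0_real. Qed.

Lemma gt0_Re (x : C) : 0 < x -> 0 < Re x.
Proof. by rewrite ltcE => /andP[]. Qed.

Lemma normc_ge_Im (z : C) : `|Im z|%:C%C <= `|z|.
Proof.
have := normc_ge_Re (z * 'i%C); rewrite ReiNIm normrN normrM => /le_trans; apply.
suff -> : `|'i%C| = 1 :> C by rewrite mulr1.
by rewrite normc_def /= expr0n expr1n add0r sqrtr1.
Qed.

Lemma norm_le_ReIm (z : C) : `|z| <= (`|Re z| + `|Im z|)%:C%C.
Proof.
rewrite {1}[z]complexE (le_trans (ler_normD _ _))// rmorphD lerD//.
  by rewrite normc_def /= expr0n addr0 sqrtr_sqr.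
by rewrite normrM normc_def /= expr0n expr1n add0r sqrtr1 mul1r normc_def /= expr0n
  addr0 sqrtr_sqr.
Qed.

Lemma Re_norm_le (z : C) : Re z <= Re `|z|.
Proof.
rewrite -lecR (ge0_RRe (normr_ge0 z)); apply: le_trans (normc_ge_Re z).
by rewrite lecR ler_norm.
Qed.

Lemma conjCR (x : R) : (x%:C%C)^* = x%:C%C :> C.
Proof. by rewrite conj_Creal// complex_real eqxx. Qed.

Lemma normCR (x : R) : `|x%:C%C| = `|x|%:C%C :> C.
Proof. by rewrite normc_def /= expr0n addr0 sqrtr_sqr. Qed.

Lemma le_epsC (x y : C) : 0 <= x -> 0 <= y -> (forall e : R, 0 < e -> x <= y + e%:C%C) ->
  x <= y.
Proof.
move=> x0 y0 H; rewrite -(ge0_RRe x0) -(ge0_RRe y0) lecR.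
apply/ler_addgt0Pr => e e0; have := H e e0.
by rewrite -{1}(ge0_RRe x0) -{1}(ge0_RRe y0) -rmorphD lecR.
Qed.

Lemma Re_cvg (T : Type) (F : set_system T) {FF : Filter F} (f : T -> C^o) (l : C^o) :
  f @ F --> l -> Re (f x) @[x --> F] --> Re l.
Proof.
move=> /cvgrPdist_lt fl; apply/cvgrPdist_lt => e e0.
have e0' : (0 : C) < e%:C%C by rewrite ltcR.
apply: filterS (fl _ e0') => x; rewrite -ltcR; apply: le_lt_trans.
have -> : Re l - Re (f x) = Re (l - f x) by rewrite ReD ReN.
exact: normc_ge_Re.
Qed.

Lemma complex_complete (F : set_system C^o) : ProperFilter F -> cauchy F -> cvg F.
Proof.
move=> FF /cauchyP Fc.
have c1 : cauchy ((Re : C^o -> R) @ F).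
  apply: cauchy_exP => e e0; have e0' : (0 : C) < e%:C%C by rewrite ltcR.
  have [x Fx] := Fc _ e0'; exists (Re x).
  apply: (@filterS _ F _ (ball x e%:C%C)) => // y.
  rewrite -!ball_normE /= -ltcR; apply: le_lt_trans.
  have -> : Re x - Re y = Re (x - y) by rewrite ReD ReN.
  exact: normc_ge_Re.
have c2 : cauchy ((Im : C^o -> R) @ F).
  apply: cauchy_exP => e e0; have e0' : (0 : C) < e%:C%C by rewrite ltcR.
  have [x Fx] := Fc _ e0'; exists (Im x).
  apply: (@filterS _ F _ (ball x e%:C%C)) => // y.
  rewrite -!ball_normE /= -ltcR; apply: le_lt_trans.
  have -> : Im x - Im y = Im (x - y) by rewrite ImD ImN.
  exact: normc_ge_Im.
have l1 : (Re : C^o -> R) @ F --> lim ((Re : C^o -> R) @ F) by exact: cauchy_cvg c1.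
have l2 : (Im : C^o -> R) @ F --> lim ((Im : C^o -> R) @ F) by exact: cauchy_cvg c2.
set a := lim _ in l1; set b := lim _ in l2.
have l1P := (@cvgrPdist_lt _ R _ F _ Re a).1 l1.
have l2P := (@cvgrPdist_lt _ R _ F _ Im b).1 l2.
apply: (@cvgP C^o F (a +i* b)%C).
apply: (@cvgrPdist_lt _ C^o _ F _ id _).2 => e e0.
have e20 : 0 < Re e / 2 by rewrite divr_gt0// gt0_Re.
apply: filterS2 (l1P _ _ e20) (l2P _ _ e20) => x xa xb.
apply: le_lt_trans (norm_le_ReIm _) _; rewrite -[ltRHS](ge0_RRe (ltW e0)) ltcR.
by rewrite ReD ReN ImD ImN /= [ltRHS]splitr ltrD.
Qed.

End ComplexReal.

Section BoundedVariation.
Context (R : realType).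
Local Notation C := R[i].

Lemma cvg_norm_le (V : normedModType C) (T : Type) (F : set_system T)
    {FF : ProperFilter F} (f : T -> V) (l : V) (k : C) : 0 <= k ->
  f @ F --> l -> (\forall x \near F, `|f x| <= k) -> `|l| <= k.
Proof.
move=> k0 /cvgrPdist_lt fl fk; apply: le_epsC => // e e0.
have e0' : (0 : C) < e%:C%C by rewrite ltcR.
have [x [xl xk]] := filter_ex (filterI (fl _ e0') fk).
rewrite -[l](subrK (f x)) addrC (le_trans (ler_normD _ _))// lerD//.
exact: ltW.
Qed.

Lemma cvg_uniq (V : normedModType C) (T : Type) (F : set_system T)
    {FF : ProperFilter F} (f : T -> V) (a b : V) :
  f @ F --> a -> f @ F --> b -> a = b.
Proof.
by move=> fa fb; apply: (@cvg_unique V _ (f @ F) _ a b fa fb); exact: norm_hausdorff.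
Qed.

(* Stated for any V in which Cauchy filters converge, since C^o carries no
   canonical completeness structure. *)
Lemma cvg_bounded_variation_of (V : normedModType C) (u : nat -> V)
    (a : nat -> R) (A : R) :
  (forall F : set_system V, ProperFilter F -> cauchy F -> cvg F) ->
  (forall n, `|u n.+1 - u n| <= (a n.+1 - a n)%:C%C) -> (forall n, a n <= A) ->
  cvgn u.
Proof.
move=> Vc ua aA.
have am n : a n <= a n.+1.
  have : (0 : C) <= (a n.+1 - a n)%:C%C by apply: le_trans (ua n).
  by rewrite ler0c subr_ge0.
have anm n m : (n <= m)%N -> a n <= a m.
  by move=> /subnKC <-; elim: (m - n)%N => [|k IH]; rewrite ?addn0// addnS (le_trans IH).
have unm n m : (n <= m)%N -> `|u m - u n| <= (a m - a n)%:C%C.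
  move=> /subnKC <-; elim: (m - n)%N => [|k IH].
    by rewrite addn0 !subrr normr0.
  rewrite addnS; have -> : u (n + k).+1 - u n = (u (n + k).+1 - u (n + k)%N) + (u (n + k)%N - u n).
    by rewrite addrA subrK.
  apply: le_trans (ler_normD _ _) _.
  have -> : a (n + k).+1 - a n = (a (n + k).+1 - a (n + k)%N) + (a (n + k)%N - a n).
    by rewrite addrA subrK.
  by rewrite rmorphD lerD.
have hs : has_sup (range a).
  by split; [exists (a 0%N), 0%N|exists A => _ [n _ <-]].
apply: Vc; apply: cauchy_exP => e e0.
have [_ [N _ <-] aN] := sup_adherent (gt0_Re e0) hs.
exists (u N); exists N => //= n Nn; rewrite -ball_normE /= distrC.
apply: le_lt_trans (unm _ _ Nn) _; rewrite -[ltRHS](ge0_RRe (ltW e0)) ltcR.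
have : a n <= sup (range a) by apply: ub_le_sup; [case: hs|exists n].
by lra.
Qed.

Lemma cvg_bounded_variation (V : completeNormedModType C) (u : nat -> V)
    (a : nat -> R) (A : R) :
  (forall n, `|u n.+1 - u n| <= (a n.+1 - a n)%:C%C) -> (forall n, a n <= A) ->
  cvgn u.
Proof. by apply: cvg_bounded_variation_of => F FF; exact: cauchy_cvg. Qed.

Lemma cvg_series_geometric (V : completeNormedModType C) (u : nat -> V) (K q : R) :
  0 <= q < 1 -> (forall n, `|u n| <= (K * q ^+ n)%:C%C) -> cvgn (series u).
Proof.
move=> /andP[q0 q1] uq; have K0 : 0 <= K.
  by have := le_trans (normr_ge0 _) (uq 0%N); rewrite ler0c expr0 mulr1.
have q10 : 0 < 1 - q by rewrite subr_gt0.
(* The majorant is minus the geometric tail: its increments are K q^n and it stays below 0. *)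
apply: (@cvg_bounded_variation _ _ (fun n => - (K * q ^+ n / (1 - q))) 0) => n.
  rewrite /series /= big_nat_recr//= addrAC subrr add0r (le_trans (uq n))// lecR.
  rewrite le_eqVlt; apply/orP; left; apply/eqP.
  by rewrite exprS; field; rewrite gt_eqF.
by rewrite oppr_le0 divr_ge0 ?mulr_ge0 ?exprn_ge0// ltW.
Qed.

Lemma cvg_lipschitz (V W : normedModType C) (phi : V -> W) (k : C)
    (T : Type) (F : set_system T) {FF : Filter F} (f : T -> V) (l : V) :
  0 <= k -> (forall x y, `|phi x - phi y| <= k * `|x - y|) ->
  f @ F --> l -> phi (f x) @[x --> F] --> phi l.
Proof.
move=> k0 lip /cvgrPdist_lt fl; apply/cvgrPdist_lt => e e0.
have k1 : 0 < k + 1 by rewrite ltr_wpDl.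
have ek : 0 < e / (k + 1) by rewrite divr_gt0.
apply: filterS (fl _ ek) => x; rewrite ltr_pdivlMr// mulrC; apply: le_lt_trans.
by rewrite (le_trans (lip _ _))// ler_wpM2r// lerDl.
Qed.

End BoundedVariation.

Section Form.
Context (R : realType) (V : lmodType R[i]) (f : V -> V -> R[i]).
Hypothesis fDl : forall x y z, f (x + y) z = f x z + f y z.
Hypothesis fZl : forall a x y, f (a *: x) y = a * f x y.
Hypothesis fC : forall x y, f y x = (f x y)^*.
Hypothesis f_ge0 : forall x, 0 <= f x x.
Hypothesis f_eq0 : forall x, f x x = 0 -> x = 0.

(** Stated for a bare form since it is applied twice: in Hilbert spaces, and to square-summable
    sequences before they have a norm, to obtain the triangle inequality. *)
Lemma form_cauchy_schwarz x y : `|f x y| ^+ 2 <= f x x * f y y.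
Proof.
have f0 z : f z 0 = 0 by rewrite fC -(scale0r 0) fZl mul0r rmorph0.
have [->|y0] := eqVneq y 0; first by rewrite !f0 normr0 expr0n mulr0.
have n0 : f y y != 0 by apply: contraNneq y0 => /f_eq0 ->.
have ny : 0 < f y y by rewrite lt_neqAle eq_sym n0 f_ge0.
pose a := f x y / f y y.
have := f_ge0 (x + (- a) *: y).
rewrite fDl fZl [f x (_ + _)]fC [f y (_ + _)]fC !fDl !fZl [f y x]fC.
rewrite !(rmorphD, rmorphM, rmorphN) /= fmorphV /= conjCK.
rewrite (conj_Creal (ger0_real (f_ge0 x))) (conj_Creal (ger0_real (f_ge0 y))).
set d := f x y; set n := f y y in ny n0 *.
set X := (X in 0 <= X).
have -> : X = f x x - d * d^* / n by rewrite /X /a -/d -/n; field.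
by rewrite subr_ge0 -normCK ler_pdivrMr.
Qed.

End Form.

Section Dot.
Context (R : realType) (H : hilbertType R).
Local Notation C := R[i].
Local Notation Re := (@complex.Re R).
Implicit Types (x y z : H) (a : C).

Lemma dotDr x y z : dot x (y + z) = dot x y + dot x z.
Proof. by rewrite dotC dotDl rmorphD /= -!dotC. Qed.

Lemma dotZr a x y : dot x (a *: y) = a^* * dot x y.
Proof. by rewrite dotC dotZl rmorphM /= -dotC. Qed.

Lemma dot0l y : dot 0 y = 0.
Proof. by rewrite -(scale0r 0) dotZl mul0r. Qed.

Lemma dot0r y : dot y 0 = 0.
Proof. by rewrite dotC dot0l rmorph0. Qed.

Lemma dotNl x y : dot (- x) y = - dot x y.
Proof. by rewrite -scaleN1r dotZl mulN1r. Qed.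

Lemma dotNr x y : dot x (- y) = - dot x y.
Proof. by rewrite dotC dotNl rmorphN /= -dotC. Qed.

Lemma dotBl x y z : dot (x - y) z = dot x z - dot y z.
Proof. by rewrite dotDl dotNl. Qed.

Lemma dotBr x y z : dot z (x - y) = dot z x - dot z y.
Proof. by rewrite dotDr dotNr. Qed.

Lemma dot_suml (I : Type) (r : seq I) (P : pred I) (F : I -> H) y :
  dot (\sum_(i <- r | P i) F i) y = \sum_(i <- r | P i) dot (F i) y.
Proof.
apply: (big_morph (fun x => dot x y)) => [x z|]; [exact: dotDl|exact: dot0l].
Qed.

Lemma dot_sumr (I : Type) (r : seq I) (P : pred I) (F : I -> H) y :
  dot y (\sum_(i <- r | P i) F i) = \sum_(i <- r | P i) dot y (F i).
Proof.
apply: (big_morph (fun x => dot y x)) => [x z|]; [exact: dotDr|exact: dot0r].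
Qed.

Definition dotl y (x : H) : C^o := dot x y.

Lemma dotl_linear y : linear (dotl y).
Proof. by move=> a u v; rewrite /dotl dotDl dotZl. Qed.

HB.instance Definition _ y := GRing.isLinear.Build C H C^o _ (dotl y) (dotl_linear y).

Lemma dot_ge0 x : 0 <= dot x x.
Proof. by rewrite dot_normE exprn_ge0. Qed.

Lemma dot_eq0 x : dot x x = 0 -> x = 0.
Proof. by rewrite dot_normE => /eqP; rewrite expf_eq0 /= normr_eq0 => /eqP. Qed.

Lemma dot_inj x y : (forall z, dot x z = dot y z) -> x = y.
Proof. by move=> xy; apply/subr0_eq/dot_eq0; rewrite dotBl xy subrr. Qed.

Lemma dot_injr x y : (forall z, dot z x = dot z y) -> x = y.
Proof. by move=> xy; apply: dot_inj => z; rewrite dotC xy -dotC. Qed.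

Lemma cauchy_schwarz x y : `|dot x y| <= `|x| * `|y|.
Proof.
rewrite -(@ler_pXn2r _ 2) ?nnegrE ?mulr_ge0// exprMn -!dot_normE.
apply: form_cauchy_schwarz; [exact: dotDl|exact: dotZl|exact: dotC|exact: dot_ge0|].
exact: dot_eq0.
Qed.

Lemma dot_cvgl (T : Type) (F : set_system T) {FF : Filter F} (f : T -> H) (l : H) y :
  f @ F --> l -> (dot (f x) y : C^o) @[x --> F] --> (dot l y : C^o).
Proof.
move=> fl; apply: (@cvg_lipschitz _ H C^o (fun x => dot x y : C^o) `|y|) => // u v.
by rewrite -dotBl mulrC cauchy_schwarz.
Qed.

End Dot.

(** * Riesz representation of a functional given on a subspace *)

Section Riesz.
Context (R : realType) (H : hilbertType R).
Local Notation C := R[i].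
Local Notation Re := (@complex.Re R).
Context (E : Type) (e0 : E) (u : E -> H) (l : E -> C) (k : C).
Hypothesis comb : forall (a : C) (e e' : E), exists e'',
  u e'' = a *: u e + u e' /\ l e'' = a * l e + l e'.
Hypothesis k_ge0 : 0 <= k.
Hypothesis l_le : forall e, `|l e| <= k * `|u e|.

Let J (e : E) : R := Re (dot (u e) (u e)) - 2 * Re (l e).

Let JE e : (J e)%:C%C = dot (u e) (u e) - (l e + (l e)^*).
Proof.
rewrite /J rmorphB rmorphM /= ge0_RRe ?dot_ge0//; congr (_ - _).
by rewrite (complexRe (l e)) ReE rmorph_nat mulrC divfK.
Qed.

(** The subspace and the functional on it are given by the pairs (u e, l e). A minimising sequence
    of J e = |u e|^2 - 2 Re (l e) is Cauchy by the parallelogram identity, and its limit represents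
    l; taking the limit inside H avoids forming a closed subspace. *)
Lemma riesz_subspace : exists y, [/\ forall e, l e = dot (u e) y,
  forall h, (forall e, dot (u e) h = 0) -> dot y h = 0 & `|y| <= k].
Proof.
pose k' := Re k.
have J_ge e : - k' ^+ 2 <= J e.
  have h1 : Re (l e) <= k' * Re `|u e|.
    apply: le_trans (Re_norm_le _) _; rewrite -lecR rmorphM /= !ge0_RRe//.
    exact: l_le.
  have h2 : Re (dot (u e) (u e)) = Re `|u e| ^+ 2.
    by apply: complexI; rewrite ge0_RRe ?dot_ge0// dot_normE rmorphXn /= ge0_RRe.
  rewrite /J h2; have := sqr_ge0 (Re `|u e| - k'); nra.
have hi : has_inf (range J).
  by split; [exists (J e0), e0|exists (- k' ^+ 2) => _ [e _ <-]].
pose m := inf (range J).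
have Jm e : m <= J e by apply: ge_inf; [case: hi|exists e].
(* An excess of 4^-n over the infimum makes consecutive distances of order 2^-n, which is
   summable. *)
pose d n : R := (4^-1) ^+ n.
have d0 n : 0 < d n by rewrite exprn_gt0// invr_gt0.
have ex n : exists e, J e < m + d n.
  by have [_ [e _ <-] Je] := inf_adherent (d0 n) hi; exists e.
have [s sP] := choice ex.
have expand e e' (a : C) e'' : u e'' = a *: u e + u e' -> l e'' = a * l e + l e' ->
    (J e'')%:C%C = (J e')%:C%C + a * a^* * dot (u e) (u e)
      - (a * (l e - dot (u e) (u e')) + (a * (l e - dot (u e) (u e')))^*).
  move=> ue le; rewrite !JE ue le dotDl !dotDr !dotZl !dotZr [dot (u e') (u e)]dotC.
  by rewrite !(rmorphD, rmorphM, rmorphB, rmorphN) /=; ring.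
(* Here z indexes the zero vector, h half of [u e], and g the midpoint of [u e] and [u e'], so that
   2 J e + 2 J e' - 4 J g is the squared distance. *)
have par e e' : Re (dot (u e - u e') (u e - u e')) <= 2 * (J e - m) + 2 * (J e' - m).
  have [z [uz lz]] := comb (-1) e e.
  have [h [uh lh]] := comb (2^-1) e z.
  have [g [ug lg]] := comb (2^-1) e' h.
  rewrite scaleN1r addNr in uz; rewrite mulN1r addNr in lz.
  rewrite uz addr0 in uh; rewrite lz addr0 in lh; rewrite uh in ug; rewrite lh in lg.
  have : Re (dot (u e - u e') (u e - u e')) = 2 * J e + 2 * J e' - 4 * J g.
    apply: complexI; rewrite ge0_RRe ?dot_ge0//.
    rewrite rmorphB rmorphD !rmorphM /= !rmorph_nat !JE ug lg.
    rewrite !(dotDl, dotDr, dotNl, dotNr, dotZl, dotZr) !(rmorphD, rmorphM) /=.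
    by rewrite fmorphV /= rmorph_nat; field.
  by have := Jm g; lra.
have cv : cvgn (u \o s).
  apply: (@cvg_bounded_variation _ _ _ (fun n => - (4 * (2^-1) ^+ n)) 0) => n; last first.
    by rewrite oppr_le0 mulr_ge0// exprn_ge0// invr_ge0.
  rewrite -(@ler_pXn2r _ 2) ?nnegrE//; last first.
    rewrite ler0c exprS; have : (0 : R) <= 2^-1 ^+ n by rewrite exprn_ge0// invr_ge0.
    by lra.
  rewrite -dot_normE -[leLHS]ge0_RRe ?dot_ge0// -rmorphXn /= lecR.
  apply: le_trans (par _ _) _.
  have q : d n = (2^-1 ^+ n) ^+ 2 by rewrite /d -exprM mulnC exprM; congr (_ ^+ _); field.
  have dS : d n.+1 = 4^-1 * d n by rewrite /d exprS.
  rewrite [2^-1 ^+ n.+1]exprS; have := sP n; have := sP n.+1; rewrite dS q.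
  move: ((2^-1 : R) ^+ n) => t; have := sqr_ge0 t; nra.
set y := limn (u \o s) in cv; exists y.
have uy : u (s n) @[n --> \oo] --> y := cv.
have perp h : (forall e, dot (u e) h = 0) -> dot y h = 0.
  move=> uh.
  have z0 : (dot (u (s n)) h : C^o) @[n --> \oo] --> (0 : C^o).
    have -> : (fun n => dot (u (s n)) h : C^o) = (fun=> 0 : C^o).
      by apply/funext => n; rewrite uh.
    exact: cvg_cst.
  exact: (@cvg_uniq R C^o nat \oo _ _ _ _ (dot_cvgl (y := h) uy) z0).
have rep e : l e = dot (u e) y.
  pose D n : C := l e - dot (u e) (u (s n)).
  (* Moving the near-minimiser [s n] by t conj (D n) u e lowers J by at least t |D n|^2 when t = 1 /
     (|u e|^2 + 1), while J can drop by at most d n. *)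
  have DP n : `|D n| ^+ 2 <= (d n)%:C%C * (`|u e| ^+ 2 + 1).
    have q0 : 0 < `|u e| ^+ 2 + 1 by rewrite ltr_wpDl// exprn_ge0.
    pose t := (`|u e| ^+ 2 + 1)^-1.
    have t0 : 0 < t by rewrite invr_gt0.
    have tc : t^* = t by rewrite conj_Creal// gtr0_real.
    have [e'' [ue le]] := comb (t * (D n)^*) e (s n).
    have := expand _ _ _ _ ue le; rewrite -/(D n).
    have -> : t * (D n)^* * (t * (D n)^*)^* * dot (u e) (u e) =
       t ^+ 2 * `|u e| ^+ 2 * `|D n| ^+ 2.
      by rewrite rmorphM /= tc conjCK normCK dot_normE; ring.
    have -> : t * (D n)^* * D n = t * `|D n| ^+ 2 by rewrite normCK; ring.
    rewrite rmorphM /= tc conj_Creal; last by rewrite ger0_real// exprn_ge0.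
    move=> JJ; have : (J (s n))%:C%C - (d n)%:C%C <= (J e'')%:C%C.
      by rewrite -rmorphB lecR; have := Jm e''; have := sP n; lra.
    rewrite JJ -addrA lerD2l => H1.
    have H2 : t ^+ 2 * `|u e| ^+ 2 * `|D n| ^+ 2 <= t * `|D n| ^+ 2.
      rewrite [t ^+ 2]expr2 -[t * t * _]mulrA -[leLHS]mulrA ler_wpM2l ?(ltW t0)//.
      rewrite ler_piMl ?exprn_ge0//.
      by rewrite /t ler_pdivrMl// mulr1 lerDl.
    rewrite -ler_pdivrMr// -/t mulrC.
    rewrite lerNl opprB in H1; apply: le_trans H1.
    by rewrite -addrA lerDl subr_ge0.
  have Dcv : (D n : C^o) @[n --> \oo] --> ((l e - dot (u e) y) : C^o).
    apply: cvgB; first exact: cvg_cst.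
    apply: (@cvg_lipschitz _ H C^o (fun x => dot (u e) x : C^o) `|u e|) uy => // x x'.
    by rewrite -dotBr cauchy_schwarz.
  apply/subr0_eq/eqP; rewrite -normr_le0; apply: le_epsC => // eps eps0.
  rewrite add0r; apply: (cvg_norm_le _ Dcv); first by rewrite ler0c ltW.
  have q0 : 0 < Re (`|u e| ^+ 2 + 1) by apply: gt0_Re; rewrite ltr_wpDl// exprn_ge0.
  have dq : d n @[n --> \oo] --> 0.
    have -> : d = geometric 1 (4^-1) by apply/funext => n; rewrite /= mul1r.
    by apply: cvg_geometric; rewrite ger0_norm// invf_lt1//; lra.
  have ep : 0 < eps ^+ 2 / Re (`|u e| ^+ 2 + 1) by rewrite divr_gt0// exprn_gt0.
  have dq' := (@cvgrPdist_lt _ R _ _ _ d 0).1 dq _ ep.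
  apply: (@filterS _ \oo _ _ _ _ (dq' _)) => n; rewrite sub0r normrN gtr0_norm// ltr_pdivlMr// => dn.
  rewrite -(@ler_pXn2r _ 2) ?nnegrE//; last by rewrite ler0c ltW.
  apply: le_trans (DP n) _; rewrite -[X in _ * X <= _]ge0_RRe; last first.
    by rewrite addr_ge0// exprn_ge0.
  by rewrite -rmorphM -rmorphXn lecR ltW.
(* For the norm, |y|^2 is the limit of dot (u (s n)) y = l (s n), which is at most k |u (s n)| in
   modulus. *)
split=> //; have [->|y0] := eqVneq y 0; first by rewrite normr0.
have ny : 0 < `|y| by rewrite normr_gt0.
rewrite -(ler_pM2r ny) -expr2; apply: le_epsC => [||eps eps0]; first by rewrite exprn_ge0.
  by rewrite mulr_ge0// ltW.
have k1 : 0 < k + 1 by rewrite ltr_wpDl.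
have e1 : 0 < eps%:C%C / (k + 1) by rewrite divr_gt0// ltcR.
rewrite -[leLHS]ger0_norm ?exprn_ge0// -dot_normE.
apply: (@cvg_norm_le R C^o _ _ _ _ _ _ _ (dot_cvgl (y := y) uy)).
  by rewrite addr_ge0// ?mulr_ge0// ?ler0c ltW.
have uy' := (@cvgrPdist_lt _ H _ _ _ _ _).1 uy _ e1.
apply: (@filterS _ \oo _ _ _ _ (uy' _)) => n yn; rewrite -rep.
apply: le_trans (l_le _) _.
have un : `|u (s n)| <= `|y| + eps%:C%C / (k + 1).
  rewrite -[u (s n)](subrK y) addrC (le_trans (ler_normD _ _))// lerD2l.
  by rewrite distrC ltW.
apply: le_trans (ler_wpM2l k_ge0 un) _; rewrite mulrDr lerD2l.
rewrite mulrCA ler_piMr ?ler0c ?(ltW eps0)// ler_pdivrMr// mul1r lerDl//.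
Qed.

End Riesz.

(** * Bounded operators *)

Section BopTheory.
Context (R : realType).
Local Notation C := R[i].
Local Notation Re := (@complex.Re R).
Implicit Types H K M N : hilbertType R.

Lemma bop_norm_apply M N (T : bop M N) x : `|T x| <= `|T| * `|x|.
Proof. exact: opnormP. Qed.

Lemma bop_norm_le M N (T : bop M N) (k : C) :
  0 <= k -> (forall x, `|T x| <= k * `|x|) -> `|T| <= k.
Proof. exact: opnorm_le. Qed.

Lemma bop_norm_le1 M N (T : bop M N) : (forall x, `|T x| <= `|x|) -> `|T| <= 1.
Proof. by move=> T1; apply: bop_norm_le => // x; rewrite mul1r. Qed.

Lemma bcomp_norm H M N (S : bop M N) (T : bop H M) : `|bcomp S T| <= `|S| * `|T|.
Proof.
apply: bop_norm_le => [|x]; first by rewrite mulr_ge0.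
by rewrite -mulrA (le_trans (bop_norm_apply S _))// ler_wpM2l// bop_norm_apply.
Qed.

Lemma bid_norm H : `|bid H| <= 1.
Proof. exact: bop_norm_le1. Qed.

Lemma mk_bop M N (g : M -> N) (k : C) : linear g -> (forall x, `|g x| <= k * `|x|) ->
  exists T : bop M N, T =1 g.
Proof.
move=> gl gk; have gb : g \in @is_bop R M N by apply/asboolP; split=> //; exists k.
by exists (Bop gb).
Qed.

Lemma bopBE M N (S T : bop M N) x : (S - T) x = S x - T x. Proof. by []. Qed.
Lemma bopNE M N (T : bop M N) x : (- T) x = - T x. Proof. by []. Qed.

Lemma bcompA H K M N (S : bop M N) (T : bop K M) (U : bop H K) :
  bcomp S (bcomp T U) = bcomp (bcomp S T) U.
Proof. exact: bopP. Qed.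

Lemma bcomp1l M N (T : bop M N) : bcomp (bid N) T = T.
Proof. exact: bopP. Qed.

Lemma bcomp1r M N (T : bop M N) : bcomp T (bid M) = T.
Proof. exact: bopP. Qed.

Lemma bcomp_linearl H M N (T : bop H M) : linear (fun S : bop M N => bcomp S T).
Proof. by move=> a S S'; apply: bopP => x. Qed.

Lemma bcomp_linearr H M N (S : bop M N) : linear (fun T : bop H M => bcomp S T).
Proof. by move=> a T T'; apply: bopP => x; rewrite /= linearP. Qed.

HB.instance Definition _ H M N (S : bop M N) :=
  GRing.isLinear.Build C (bop H M) (bop H N) _ (@bcomp R H M N S)
  (@bcomp_linearr H M N S).

Definition bcompr H M N (T : bop H M) (S : bop M N) : bop H N := bcomp S T.

HB.instance Definition _ H M N (T : bop H M) :=
  GRing.isLinear.Build C (bop M N) (bop H N) _ (bcompr T)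
  (@bcomp_linearl H M N T).

Lemma bcompDl H M N (S S' : bop M N) (T : bop H M) :
  bcomp (S + S') T = bcomp S T + bcomp S' T.
Proof. exact: bopP. Qed.

Lemma bcompDr H M N (S : bop M N) (T T' : bop H M) :
  bcomp S (T + T') = bcomp S T + bcomp S T'.
Proof. by apply: bopP => x; rewrite /= raddfD. Qed.

Lemma bcompNl H M N (S : bop M N) (T : bop H M) : bcomp (- S) T = - bcomp S T.
Proof. exact: bopP. Qed.

Lemma bcompNr H M N (S : bop M N) (T : bop H M) : bcomp S (- T) = - bcomp S T.
Proof. by apply: bopP => x; rewrite /= raddfN. Qed.

Lemma bcompZl H M N a (S : bop M N) (T : bop H M) : bcomp (a *: S) T = a *: bcomp S T.
Proof. exact: bopP. Qed.

Lemma bcompZr H M N a (S : bop M N) (T : bop H M) : bcomp S (a *: T) = a *: bcomp S T.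
Proof. by apply: bopP => x; rewrite /= linearZ. Qed.

Lemma bcomp0l H M N (T : bop H M) : bcomp (0 : bop M N) T = 0.
Proof. exact: bopP. Qed.

Lemma bcomp0r H M N (S : bop M N) : bcomp S (0 : bop H M) = 0.
Proof. by apply: bopP => x; rewrite /= raddf0. Qed.

(* |dot (u e) (g y)| <= |u e| |y| represents the functional e |-> dot (v e) y by
   a vector g y of the closure of the range of u; g is then the adjoint of the
   extension of u e |-> v e by 0 on the orthogonal complement. *)
Lemma contraction_adjoint K0 K1 (E : Type) (e0 : E) (u : E -> K0) (v : E -> K1) :
  (forall (a : C) (e e' : E), exists e'',
    u e'' = a *: u e + u e' /\ v e'' = a *: v e + v e') ->
  (forall e, `|v e| <= `|u e|) ->
  exists2 G : bop K1 K0, (forall y, `|G y| <= `|y|) &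
    forall e y, dot (v e) y = dot (u e) (G y).
Proof.
move=> comb uv.
have ex y : exists g : K0, [/\ forall e, dot (v e) y = dot (u e) g,
    forall h, (forall e, dot (u e) h = 0) -> dot g h = 0 & `|g| <= `|y|].
  apply: (riesz_subspace e0) => // [a e e'|e].
    have [e'' [ue ve]] := comb a e e'; exists e''; split=> //.
    by rewrite ve dotDl dotZl.
  apply: le_trans (cauchy_schwarz _ _) _; rewrite mulrC ler_wpM2l//.
have [g gP] := choice ex.
have uniq y y' g' : y = y' -> (forall e, dot (v e) y' = dot (u e) g') ->
    (forall h, (forall e, dot (u e) h = 0) -> dot g' h = 0) -> g y = g'.
  move=> <- r1 r2; have [s1 s2 _] := gP y.
  have d0 e : dot (u e) (g y - g') = 0 by rewrite dotBr -s1 -r1 subrr.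
  by apply/subr0_eq/dot_eq0; rewrite {1}dotBl s2// r2// subrr.
have gl : linear g.
  move=> a x y; have [s1 s2 _] := gP x; have [t1 t2 _] := gP y.
  apply: uniq (erefl _) _ _ => [e|h hh].
    by rewrite !dotDr !dotZr s1 t1.
  by rewrite dotDl dotZl s2// t2// mulr0 addr0.
have [|G GE] := @mk_bop _ _ g 1 gl.
  by move=> y; rewrite mul1r; have [] := gP y.
by exists G => [y|e y]; rewrite GE; have [] := gP y.
Qed.

(** Division by |T| + 1, which is never 0, turns T into a contraction. *)
Lemma adjoint_exists M N (T : bop M N) : exists S : bop N M, is_adjoint T S.
Proof.
have t0 : 0 < `|T| + 1 by rewrite ltr_wpDl.
have [||G _ GP] := @contraction_adjoint M N M 0 id (fun x => (`|T| + 1)^-1 *: T x).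
- by move=> a x x'; exists (a *: x + x'); rewrite linearP /= scalerDr !scalerA mulrC.
- move=> x; rewrite normrZ gtr0_norm ?invr_gt0// ler_pdivrMl//.
  by rewrite (le_trans (bop_norm_apply _ _))// ler_wpM2r// lerDl.
exists ((`|T| + 1) *: G) => x y.
rewrite bopZE dotZr -GP dotZl mulrA conj_Creal ?gtr0_real// mulfV ?mul1r// gt_eqF.
Qed.

Lemma adjointP M N (T : bop M N) x y : dot (T x) y = dot x (adjoint T y).
Proof.
have [S0 SP] := adjoint_exists T.
by rewrite /adjoint; case: xgetP => [S _ /(_ x y)//|/(_ S0)/(_ SP)].
Qed.

Lemma adjointPr M N (T : bop M N) x y : dot y (T x) = dot (adjoint T y) x.
Proof. by rewrite dotC adjointP -dotC. Qed.

Lemma adjoint_uniq M N (T : bop M N) (S : bop N M) :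
  (forall x y, dot (T x) y = dot x (S y)) -> adjoint T = S.
Proof. by move=> TS; apply: bopP => y; apply: dot_injr => x; rewrite -adjointP TS. Qed.

Lemma adjointK M N (T : bop M N) : adjoint (adjoint T) = T.
Proof. by apply: adjoint_uniq => x y; rewrite -adjointPr. Qed.

Lemma adjoint_comp H M N (S : bop M N) (T : bop H M) :
  adjoint (bcomp S T) = bcomp (adjoint T) (adjoint S).
Proof. by apply: adjoint_uniq => x y; rewrite /= !adjointP. Qed.

Lemma adjointD M N (S T : bop M N) : adjoint (S + T) = adjoint S + adjoint T.
Proof. by apply: adjoint_uniq => x y; rewrite !bopDE dotDl dotDr !adjointP. Qed.

Lemma adjointZ M N a (T : bop M N) : adjoint (a *: T) = a^* *: adjoint T.
Proof. by apply: adjoint_uniq => x y; rewrite !bopZE dotZl dotZr conjCK adjointP. Qed.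

Lemma adjointN M N (T : bop M N) : adjoint (- T) = - adjoint T.
Proof. by apply: adjoint_uniq => x y; rewrite !bopNE dotNl dotNr adjointP. Qed.

Lemma adjoint0 M N : adjoint (0 : bop M N) = 0.
Proof. by apply: adjoint_uniq => x y; rewrite !bop0E dot0l dot0r. Qed.

Lemma adjoint1 H : adjoint (bid H) = bid H.
Proof. exact: adjoint_uniq. Qed.

Lemma norm_adjoint_le M N (T : bop M N) : `|adjoint T| <= `|T|.
Proof.
apply: bop_norm_le => // y; have [->|y0] := eqVneq (adjoint T y) 0.
  by rewrite normr0 mulr_ge0.
rewrite -(@ler_pM2r _ `|adjoint T y|) ?normr_gt0// -expr2 -dot_normE -adjointP.
rewrite -[leLHS]ger0_norm; last by rewrite adjointP dot_ge0.
apply: le_trans (cauchy_schwarz _ _) _.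
by rewrite mulrAC ler_wpM2r// bop_norm_apply.
Qed.

Lemma norm_adjoint M N (T : bop M N) : `|adjoint T| = `|T|.
Proof.
by apply/le_anti; rewrite norm_adjoint_le -{1}(adjointK T) norm_adjoint_le.
Qed.

(** The adjoint of the operator from [contraction_adjoint] already agrees with v on the range of u,
    so no extension by continuity is carried out. *)
Lemma contraction_extension K0 K1 (E : Type) (e0 : E) (u : E -> K0) (v : E -> K1) :
  (forall (a : C) (e e' : E), exists e'',
    u e'' = a *: u e + u e' /\ v e'' = a *: v e + v e') ->
  (forall e, `|v e| <= `|u e|) ->
  exists2 W : bop K0 K1, `|W| <= 1 & forall e, W (u e) = v e.
Proof.
move=> comb uv; have [G G1 GP] := contraction_adjoint e0 comb uv.
exists (adjoint G); first by rewrite norm_adjoint; exact: bop_norm_le1.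
by move=> e; apply: dot_inj => y; rewrite -adjointPr GP.
Qed.

Lemma norm1_apply M N (T : bop M N) x : `|T| <= 1 -> `|T x| <= `|x|.
Proof. by move=> T1; rewrite (le_trans (bop_norm_apply _ _))// ler_piMl. Qed.

Lemma isometry_norm M N (T : bop M N) x :
  bcomp (adjoint T) T = bid M -> `|T x| = `|x|.
Proof.
move=> TT; apply/eqP; rewrite -(@eqrXn2 _ 2)// -!dot_normE adjointP.
by rewrite -[adjoint T _]/(bcomp (adjoint T) T x) TT.
Qed.

Lemma bop_complete M N (F : set_system (bop M N)) : ProperFilter F -> cauchy F -> cvg F.
Proof.
move=> FF /cauchyP Fc.
have evc x : cauchy ((fun T : bop M N => T x) @ F).
  apply: cauchy_exP => e e0.
  have e1 : 0 < e / (`|x| + 1) by rewrite divr_gt0// ltr_wpDl.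
  have [T FT] := Fc _ e1; exists (T x).
  apply: (@filterS _ F _ (ball T (e / (`|x| + 1)))) => // S.
  rewrite -!ball_normE /= ltr_pdivlMr ?ltr_wpDl//; apply: le_lt_trans.
  by rewrite -bopBE (le_trans (bop_norm_apply _ _))// ler_wpM2l// lerDl.
have ex x : exists y : N, (fun T : bop M N => T x) @ F --> y.
  by exists (lim ((fun T : bop M N => T x) @ F)); exact: cauchy_cvg (evc x).
have [g gP] := choice ex.
have gl : linear g.
  move=> a x y.
  have h1 : (fun T : bop M N => a *: T x + T y) @ F --> a *: g x + g y.
    by apply: cvgD; [apply: cvgZr|]; exact: gP.
  apply: (@cvg_uniq _ _ _ F _ _ _ _ (gP (a *: x + y))).
  by move: h1; under eq_fun do rewrite -linearP.
have near_bound (e : C) (T : bop M N) : 0 < e -> F (ball T e) ->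
    forall x, `|T x - g x| <= e * `|x|.
  move=> e0 FT x.
  have h1 : (fun S : bop M N => T x - S x) @ F --> T x - g x.
    by apply: cvgB; [exact: cvg_cst|exact: gP].
  apply: (cvg_norm_le _ h1); first by rewrite mulr_ge0// ltW.
  apply: (@filterS _ F _ (ball T e)) => // S; rewrite -!ball_normE /= => TS.
  by rewrite -bopBE (le_trans (bop_norm_apply _ _))// ler_wpM2r// ltW.
have [T0 FT0] := Fc 1 ltr01.
have [|G GE] := @mk_bop _ _ g (`|T0| + 1) gl.
  move=> x; rewrite -[g x](subrK (T0 x)) (le_trans (ler_normD _ _))//.
  by rewrite mulrDl addrC lerD ?bop_norm_apply// distrC near_bound.
apply: (@cvgP (bop M N) F G).
apply: (@cvgrPdist_lt _ (bop M N) _ F _ id _).2 => e e0.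
have e1 : 0 < e / 4 by rewrite divr_gt0.
have [T FT] := Fc _ e1.
apply: (@filterS _ F _ (ball T (e / 4))) => // S; rewrite -ball_normE /= => TS.
have TG : `|T - G| <= e / 4.
  apply: bop_norm_le => [|x]; first exact: ltW.
  by rewrite bopBE GE near_bound.
have -> : G - S = (G - T) + (T - S) by rewrite addrA subrK.
apply: le_lt_trans (ler_normD _ _) _; rewrite distrC.
apply: (@le_lt_trans _ _ (e / 4 + e / 4)); first by rewrite lerD// ltW.
have -> : e / 4 + e / 4 = e / 2 by field.
by rewrite ltr_pdivrMr// ltr_pMr// ltr1n.
Qed.

HB.instance Definition _ M N := Uniform_isComplete.Build (bop M N) (@bop_complete M N).

Lemma cvg_linear_bounded (V W : normedModType C) (phi : V -> W) (k : C)
    (T : Type) (F : set_system T) {FF : Filter F} (f : T -> V) (l : V) :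
  0 <= k -> (forall x y, phi (x - y) = phi x - phi y) ->
  (forall x, `|phi x| <= k * `|x|) -> f @ F --> l -> phi (f x) @[x --> F] --> phi l.
Proof.
by move=> k0 lin bnd; apply: (cvg_lipschitz k0) => x y; rewrite -lin.
Qed.

Lemma cvg_bcompl H M N (U : bop H M) (T : Type) (F : set_system T) {FF : Filter F}
    (f : T -> bop M N) (l : bop M N) :
  f @ F --> l -> bcomp (f x) U @[x --> F] --> bcomp l U.
Proof.
apply: (@cvg_linear_bounded _ _ (fun S => bcomp S U) `|U|) => // [S S'|S].
  by rewrite bcompDl bcompNl.
by rewrite mulrC bcomp_norm.
Qed.

Lemma cvg_bcompr H M N (U : bop M N) (T : Type) (F : set_system T) {FF : Filter F}
    (f : T -> bop H M) (l : bop H M) :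
  f @ F --> l -> bcomp U (f x) @[x --> F] --> bcomp U l.
Proof.
apply: (@cvg_linear_bounded _ _ (fun S => bcomp U S) `|U|) => // [S S'|S].
  by rewrite bcompDr bcompNr.
by rewrite bcomp_norm.
Qed.

Lemma cvg_adjoint M N (T : Type) (F : set_system T) {FF : Filter F}
    (f : T -> bop M N) (l : bop M N) :
  f @ F --> l -> adjoint (f x) @[x --> F] --> adjoint l.
Proof.
apply: (@cvg_linear_bounded _ _ (@adjoint R M N) 1) => // [S S'|S].
  by rewrite adjointD adjointN.
by rewrite mul1r norm_adjoint.
Qed.

(** * Square root of I - T for a self-adjoint contraction T *)

Section SquareRoot.
Context (H : hilbertType R) (T : bop H H).
Hypothesis T_norm : `|T| <= 1.
Hypothesis T_adj : adjoint T = T.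

(* Y' = (T + Y^2) / 2 has the fixed point I - sqrt (I - T); its increments are
   dominated by those of the same iteration on numbers, started at 0 with 1 for T. *)
Fixpoint sqrt_iter (n : nat) : bop H H :=
  if n is n'.+1 then 2^-1 *: (T + bcomp (sqrt_iter n') (sqrt_iter n')) else 0.

Fixpoint sqrt_bound (n : nat) : R :=
  if n is n'.+1 then 2^-1 * (1 + sqrt_bound n' ^+ 2) else 0.

Lemma sqrt_bound_itv n : 0 <= sqrt_bound n <= 1.
Proof.
elim: n => [|n /= /andP[a0 a1]]; first by rewrite lexx ler01.
by apply/andP; split; nra.
Qed.

Lemma sqrt_iter_norm n : `|sqrt_iter n| <= (sqrt_bound n)%:C%C.
Proof.
elim: n => [|n IH] /=; first by rewrite normr0.
have /andP[a0 a1] := sqrt_bound_itv n.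
rewrite normrZ ger0_norm ?invr_ge0// rmorphM /= fmorphV rmorph_nat ler_wpM2l ?invr_ge0//.
rewrite (le_trans (ler_normD _ _))// rmorphD lerD// (le_trans (bcomp_norm _ _))//.
by rewrite rmorphXn expr2 ler_pM.
Qed.

(** The factorisation Y^2 - Z^2 = Y (Y - Z) + (Y - Z) Z needs no commutation, and its numerical
    counterpart is exact. *)
Lemma sqrt_iter_step n :
  `|sqrt_iter n.+1 - sqrt_iter n| <= (sqrt_bound n.+1 - sqrt_bound n)%:C%C.
Proof.
elim: n => [|n IH].
  by rewrite /= !subr0 expr0n addr0 mulr1 bcomp0l addr0 normrZ ger0_norm ?invr_ge0//
    fmorphV rmorph_nat ler_piMr ?invr_ge0.
set Y := sqrt_iter n.+1 in IH *; set Z := sqrt_iter n in IH *.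
have -> : sqrt_iter n.+2 - Y = 2^-1 *: (bcomp Y (Y - Z) + bcomp (Y - Z) Z).
  rewrite bcompDr bcompDl bcompNr bcompNl addrA subrK -scalerBr.
  by rewrite opprD addrACA subrr add0r.
rewrite normrZ ger0_norm ?invr_ge0//.
set a := sqrt_bound n.+1 in IH *; set b := sqrt_bound n in IH *.
have -> : sqrt_bound n.+2 - a = 2^-1 * (a * (a - b) + (a - b) * b).
  by rewrite /a /b /=; field.
have hY : `|Y| <= a%:C%C := sqrt_iter_norm n.+1.
have hZ : `|Z| <= b%:C%C := sqrt_iter_norm n.
clearbody Y Z a b.
rewrite rmorphM /= fmorphV rmorph_nat ler_wpM2l ?invr_ge0//.
rewrite (le_trans (ler_normD _ _))// rmorphD !rmorphM /= lerD//.
  by rewrite (le_trans (bcomp_norm _ _))// ler_pM.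
by rewrite (le_trans (bcomp_norm _ _))// ler_pM.
Qed.

Lemma sqrt_iter_adj n : adjoint (sqrt_iter n) = sqrt_iter n.
Proof.
elim: n => [|n IH] /=; first exact: adjoint0.
rewrite adjointZ adjointD adjoint_comp T_adj IH.
by rewrite fmorphV rmorph_nat.
Qed.

(** Since |T| = 1 is allowed, no contraction estimate is available; convergence comes from the
    increments being dominated by those of a bounded sequence. The limit satisfies 2 Z = T + Z^2,
    that is, (I - Z)^2 = I - T. *)
Lemma sqrt_one_minus : exists2 Y : bop H H, adjoint Y = Y & bcomp Y Y = bid H - T.
Proof.
have cv : cvgn sqrt_iter.
  apply: (cvg_bounded_variation (A := 1) sqrt_iter_step) => n.
  by have /andP[] := sqrt_bound_itv n.
set Z := limn sqrt_iter in cv.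
have Zadj : adjoint Z = Z.
  have cv' : adjoint (sqrt_iter n) @[n --> \oo] --> adjoint Z by exact: cvg_adjoint cv.
  apply: (cvg_uniq cv'); suff -> : (fun n => adjoint (sqrt_iter n)) = sqrt_iter by [].
  by apply/funext => n; exact: sqrt_iter_adj.
have ZE : Z = 2^-1 *: (T + bcomp Z Z).
  have cvS : sqrt_iter n.+1 @[n --> \oo] --> Z by rewrite (@cvg_shiftS (bop H H) sqrt_iter).
  apply: (cvg_uniq cvS); rewrite /=; apply: cvgZr; apply: cvgD; first exact: cvg_cst.
  have Y1 n : `|sqrt_iter n| <= 1.
    rewrite (le_trans (sqrt_iter_norm n))// -[leRHS]/(1%:C%C) lecR.
    by have /andP[] := sqrt_bound_itv n.
  have Z1 : `|Z| <= 1 by apply: (cvg_norm_le _ cv) => //; exact: nearW.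
  apply/cvgrPdist_lt => e e0.
  have e20 : 0 < e / 2 by rewrite divr_gt0.
  have cv' := (@cvgrPdist_lt _ (bop H H) _ _ _ _ _).1 cv _ e20.
  apply: (@filterS _ \oo _ _ _ _ (cv' _)) => n nZ.
  have -> : bcomp Z Z - bcomp (sqrt_iter n) (sqrt_iter n) =
      bcomp Z (Z - sqrt_iter n) + bcomp (Z - sqrt_iter n) (sqrt_iter n).
    by rewrite bcompDr bcompDl bcompNr bcompNl addrA subrK.
  apply: le_lt_trans (ler_normD _ _) _; rewrite (splitr e).
  apply: ltrD; apply: le_lt_trans (bcomp_norm _ _) _; apply: le_lt_trans nZ.
    by rewrite ler_piMl.
  by rewrite ler_piMr.
exists (bid H - Z); first by rewrite adjointD adjointN adjoint1 Zadj.
have Z2 : bcomp Z Z = Z + Z - T.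
  have -> : Z + Z = T + bcomp Z Z.
    have half : 2^-1 + 2^-1 = 1 :> C by field.
    by rewrite {1 2}ZE -scalerDl half scale1r.
  by rewrite addrAC subrr add0r.
rewrite bcompDl !bcompDr !bcompNl !bcompNr !bcomp1l bcomp1r opprK Z2.
by rewrite -addrA; congr (_ + _); rewrite -addrA !addKr.
Qed.

End SquareRoot.

End BopTheory.

(** * Square-summable sequences *)

Section SquareNorm.
Context (R : realType) (V : normedModType R[i]).
Local Notation C := R[i].
Local Notation Re := (@complex.Re R).
Implicit Types x y : V.

Definition nrm2 x : R := Re `|x| ^+ 2.

Lemma nrm2E x : (nrm2 x)%:C%C = `|x| ^+ 2.
Proof. by rewrite /nrm2 rmorphXn /= ge0_RRe. Qed.

Lemma nrm2_ge0 x : 0 <= nrm2 x. Proof. exact: sqr_ge0. Qed.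

Lemma nrm2D x y : nrm2 (x + y) <= 2 * nrm2 x + 2 * nrm2 y.
Proof.
have h : Re `|x + y| <= Re `|x| + Re `|y|.
  by rewrite -lecR rmorphD /= !ge0_RRe// ler_normD.
have h0 : 0 <= Re `|x + y| by exact: Re_ge0.
rewrite /nrm2; move: (Re `|x + y|) (Re `|x|) (Re `|y|) h h0 => a b c h h0.
by have := sqr_ge0 (b - c); nra.
Qed.

Lemma nrm2Z (a : C) x : nrm2 (a *: x) = Re `|a| ^+ 2 * nrm2 x.
Proof.
by rewrite /nrm2 normrZ -{1}(ge0_RRe (normr_ge0 a)) ReZ exprMn.
Qed.

Lemma nrm2_cvg (T : Type) (F : set_system T) {FF : Filter F} (f : T -> V) (l : V) :
  f @ F --> l -> nrm2 (f t) @[t --> F] --> nrm2 l.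
Proof.
move=> fl.
have h := @Re_cvg R T F FF (fun t => `|f t| : C^o) (`|l| : C^o) (cvg_norm fl).
rewrite {2}/nrm2 expr2.
have -> : (fun t => nrm2 (f t)) = (fun t => Re `|f t| * Re `|f t|).
  by apply/funext => t; rewrite /nrm2 expr2.
exact: (@cvgM R T F FF _ _ _ _ (h _) (h _)).
Qed.

End SquareNorm.

Section SquareSummable.
Context (R : realType) (H : hilbertType R).
Local Notation C := R[i].
Local Notation Re := (@complex.Re R).

Definition sum2 (x : nat -> H) (n : nat) : R := \sum_(i < n) nrm2 (x i).

Definition is_l2 : {pred nat -> H} := fun x => `[< exists k, forall n, sum2 x n <= k >].

Record l2 := L2 { l2_fun :> nat -> H ; _ : l2_fun \in is_l2 }.

HB.instance Definition _ := [isSub for l2_fun].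
HB.instance Definition _ := [Choice of l2 by <:].

Lemma is_l2_closed : submod_closed is_l2.
Proof.
split=> [|a x y /asboolP[k xk] /asboolP[l yl]]; apply/asboolP.
  exists 0 => n; rewrite /sum2 big1// => i _.
  by rewrite /nrm2 -[(0 : nat -> H) i]/(0 : H) normr0 expr0n.
exists (2 * (Re `|a| ^+ 2 * k) + 2 * l) => n.
have a0 : 0 <= Re `|a| ^+ 2 by exact: sqr_ge0.
apply: (@le_trans _ _ (2 * (Re `|a| ^+ 2 * sum2 x n) + 2 * sum2 y n)); last first.
  by have := ler_wpM2l a0 (xk n); have := yl n; lra.
rewrite /sum2 !mulr_sumr -big_split ler_sum// => i _.
by rewrite -[(a *: x + y) i]/(a *: x i + y i) (le_trans (nrm2D _ _))// nrm2Z.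
Qed.

HB.instance Definition _ := GRing.isSubmodClosed.Build C (nat -> H) is_l2
  is_l2_closed.
HB.instance Definition _ := [SubChoice_isSubLmodule of l2 by <:].

Implicit Types x y z : l2.

Lemma l2P x y : x =1 y -> x = y.
Proof. by move=> xy; apply/val_inj/funext. Qed.

Lemma l2DE x y n : (x + y) n = x n + y n. Proof. by []. Qed.
Lemma l2ZE a x n : (a *: x) n = a *: x n. Proof. by []. Qed.
Lemma l2BE x y n : (x - y) n = x n - y n. Proof. by []. Qed.

Lemma l2_bounded x : exists k, forall n, sum2 x n <= k.
Proof. by case: x => x /= /asboolP. Qed.

Lemma sum2S (x : nat -> H) n : sum2 x n.+1 = sum2 x n + nrm2 (x n).
Proof. by rewrite /sum2 big_ord_recr. Qed.

Lemma sum2_nd (x : nat -> H) n m : (n <= m)%N -> sum2 x n <= sum2 x m.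
Proof.
move=> /subnKC <-; elim: (m - n)%N => [|k IH]; rewrite ?addn0// addnS sum2S.
by rewrite (le_trans IH)// lerDl nrm2_ge0.
Qed.

Definition l2_sq x : R := sup (range (sum2 x)).

Lemma l2_has_sup x : has_sup (range (sum2 x)).
Proof.
split; first by exists (sum2 x 0), 0%N.
by have [k xk] := l2_bounded x; exists k => _ [n _ <-].
Qed.

Lemma sum2_le x n : sum2 x n <= l2_sq x.
Proof. by apply: ub_le_sup; [case: (l2_has_sup x)|exists n]. Qed.

Lemma l2_sq_le x k : (forall n, sum2 x n <= k) -> l2_sq x <= k.
Proof.
by move=> xk; apply: ge_sup; [case: (l2_has_sup x)|move=> _ [n _ <-]].
Qed.

Lemma l2_sq_ge0 x : 0 <= l2_sq x.
Proof. by apply: le_trans (sum2_le x 0); rewrite /sum2 big_ord0. Qed.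

Definition pdot (x y : nat -> H) (n : nat) : C^o := \sum_(i < n) dot (x i) (y i).

Definition l2_dot x y : C := limn (pdot x y).

(** Each term is at most (|x n|^2 + |y n|^2) / 2 in modulus, so half the sum of the two partial sums
    of squares is a bounded majorant. *)
Lemma pdot_cvg x y : pdot x y @ \oo --> (l2_dot x y : C^o).
Proof.
suff : cvgn (pdot x y) by [].
pose a n : R := 2^-1 * (sum2 x n + sum2 y n).
have [k xk] := l2_bounded x; have [l yl] := l2_bounded y.
apply: (@cvg_bounded_variation_of R C^o _ a (2^-1 * (k + l)) (@complex_complete R)) => n;
  last first.
  by rewrite ler_wpM2l// ?invr_ge0// lerD.
rewrite /pdot big_ord_recr /= addrAC subrr add0r (le_trans (cauchy_schwarz _ _))//.
have -> : a n.+1 - a n = 2^-1 * (nrm2 (x n) + nrm2 (y n)) by rewrite /a !sum2S; ring.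
rewrite rmorphM rmorphD /= !nrm2E fmorphV rmorph_nat ler_pdivlMl//.
rewrite -subr_ge0.
have -> : `|x n| ^+ 2 + `|y n| ^+ 2 - 2 * (`|x n| * `|y n|) = (`|x n| - `|y n|) ^+ 2 by ring.
by rewrite -real_normK ?exprn_ge0// rpredB.
Qed.

Lemma l2_dot_eq x y (l : C) : pdot x y @ \oo --> (l : C^o) -> l2_dot x y = l.
Proof. by move=> xyl; exact: (@cvg_uniq R C^o nat \oo _ _ _ _ (@pdot_cvg x y) xyl). Qed.

Lemma l2_dotDl x y z : l2_dot (x + y) z = l2_dot x z + l2_dot y z.
Proof.
apply: l2_dot_eq.
have -> : pdot (x + y : l2) z = pdot x z \+ pdot y z.
  by apply/funext => n; rewrite /pdot -[RHS]big_split; apply: eq_bigr => i _; exact: dotDl.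
by apply: cvgD; exact: pdot_cvg.
Qed.

Lemma l2_dotZl (a : C) x y : l2_dot (a *: x) y = a * l2_dot x y.
Proof.
apply: l2_dot_eq.
have -> : pdot (a *: x : l2) y = (fun n => a *: pdot x y n).
  by apply/funext => n; rewrite /pdot scaler_sumr; apply: eq_bigr => i _; exact: dotZl.
by apply: cvgZr; exact: pdot_cvg.
Qed.

Lemma l2_dotC x y : l2_dot y x = (l2_dot x y)^*.
Proof.
apply: l2_dot_eq.
have -> : pdot y x = (fun n => (pdot x y n)^* : C^o).
  by apply/funext => n; rewrite /pdot /= rmorph_sum; apply: eq_bigr => i _; rewrite /= dotC.
apply: (@cvg_lipschitz _ C^o C^o (fun z : C^o => z^* : C^o) 1) (@pdot_cvg x y) => // u v.
by rewrite -rmorphB norm_conjC mul1r.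
Qed.

Lemma l2_dot_sq x : l2_dot x x = (l2_sq x)%:C%C.
Proof.
apply: l2_dot_eq.
have -> : pdot x x = (fun n => (sum2 x n)%:C%C : C^o).
  apply/funext => n; rewrite /pdot /sum2 rmorph_sum; apply: eq_bigr => i _.
  by rewrite /= nrm2E dot_normE.
apply/cvgrPdist_lt => e e0.
have [_ [N _ <-] aN] := sup_adherent (gt0_Re e0) (l2_has_sup x).
exists N => //= n Nn; rewrite -rmorphB ger0_norm; last by rewrite ler0c subr_ge0 sum2_le.
rewrite -[ltRHS](ge0_RRe (ltW e0)) ltcR.
by have := sum2_nd x Nn; rewrite /l2_sq; lra.
Qed.

Lemma l2_dot_ge0 x : 0 <= l2_dot x x.
Proof. by rewrite l2_dot_sq ler0c l2_sq_ge0. Qed.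

Lemma nrm2_coord x n : nrm2 (x n) <= l2_sq x.
Proof.
apply: le_trans (sum2_le x n.+1); rewrite sum2S lerDr.
by rewrite /sum2 sumr_ge0// => i _; exact: nrm2_ge0.
Qed.

Lemma l2_dot_eq0 x : l2_dot x x = 0 -> x = 0.
Proof.
rewrite l2_dot_sq => /complexI x0; apply: l2P => n.
have := nrm2_coord x n; rewrite x0 /nrm2 => n0.
have : Re `|x n| ^+ 2 == 0 by rewrite eq_le n0 sqr_ge0.
rewrite sqrf_eq0 => /eqP n1; apply/eqP; rewrite -normr_eq0.
by rewrite -(ge0_RRe (normr_ge0 (x n))) n1.
Qed.

Definition l2_norm x : C := sqrtC (l2_dot x x).

Lemma l2_norm_ge0 x : 0 <= l2_norm x.
Proof. by rewrite sqrtC_ge0 l2_dot_ge0. Qed.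

Lemma l2_norm_sqr x : l2_norm x ^+ 2 = l2_dot x x.
Proof. exact: sqrtCK. Qed.

Lemma l2_normD x y : l2_norm (x + y) <= l2_norm x + l2_norm y.
Proof.
rewrite -(@ler_pXn2r _ 2) ?nnegrE ?addr_ge0 ?l2_norm_ge0//.
rewrite sqrrD !l2_norm_sqr l2_dotDl [l2_dot x (_ + _)]l2_dotC [l2_dot y (_ + _)]l2_dotC.
rewrite !l2_dotDl !rmorphD /= -!l2_dotC.
have cs : `|l2_dot x y| <= l2_norm x * l2_norm y.
  rewrite -(@ler_pXn2r _ 2) ?nnegrE ?mulr_ge0 ?l2_norm_ge0//.
  rewrite exprMn !l2_norm_sqr; apply: form_cauchy_schwarz;
    [exact: l2_dotDl|exact: l2_dotZl|exact: l2_dotC|exact: l2_dot_ge0|exact: l2_dot_eq0].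
rewrite addrA -[_ + l2_dot x y + _]addrA lerD2r lerD2l.
have -> : l2_dot x y + l2_dot y x = (2 * Re (l2_dot x y))%:C%C.
  by rewrite [l2_dot y x]l2_dotC rmorphM /= rmorph_nat complexRe ReE mulrC divfK.
rewrite -[leRHS]mulr_natl rmorphM /= rmorph_nat ler_wpM2l// (le_trans _ cs)//.
by rewrite -(ge0_RRe (normr_ge0 (l2_dot x y))) lecR Re_norm_le.
Qed.

Lemma l2_normZ (a : C) x : l2_norm (a *: x) = `|a| * l2_norm x.
Proof.
apply/eqP; rewrite -(@eqrXn2 _ 2) ?mulr_ge0 ?l2_norm_ge0// exprMn !l2_norm_sqr.
by rewrite l2_dotZl l2_dotC l2_dotZl rmorphM /= -l2_dotC mulrA normCK.
Qed.

Lemma l2_norm_eq0 x : l2_norm x = 0 -> x = 0.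
Proof. by move=> /eqP; rewrite sqrtC_eq0 => /eqP; exact: l2_dot_eq0. Qed.

HB.instance Definition _ :=
  Lmodule_isNormed.Build C l2 l2_normD l2_normZ l2_norm_eq0.

Lemma l2_norm_le x (k : R) : 0 <= k -> (forall n, sum2 x n <= k ^+ 2) -> `|x| <= k%:C%C.
Proof.
move=> k0 xk; rewrite -(@ler_pXn2r _ 2) ?nnegrE ?ler0c//.
rewrite -[`|x|]/(l2_norm x) l2_norm_sqr l2_dot_sq -rmorphXn lecR.
exact: l2_sq_le.
Qed.

Lemma sum2_le_norm x n : (sum2 x n)%:C%C <= `|x| ^+ 2.
Proof.
by rewrite -[`|x|]/(l2_norm x) l2_norm_sqr l2_dot_sq lecR sum2_le.
Qed.

Lemma l2_coord_le x n : `|x n| <= `|x|.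
Proof.
rewrite -(@ler_pXn2r _ 2) ?nnegrE// -nrm2E -[`|x|]/(l2_norm x) l2_norm_sqr l2_dot_sq.
by rewrite lecR nrm2_coord.
Qed.

Lemma l2_complete (F : set_system l2) : ProperFilter F -> cauchy F -> cvg F.
Proof.
move=> FF /cauchyP Fc.
have evc k : cauchy ((fun x : l2 => x k) @ F).
  apply: cauchy_exP => e e0; have [x Fx] := Fc _ e0; exists (x k).
  apply: (@filterS _ F _ (ball x e)) => // y; rewrite -!ball_normE /=.
  by apply: le_lt_trans; rewrite -l2BE l2_coord_le.
have ex k : exists y : H, (fun x : l2 => x k) @ F --> y.
  by exists (lim ((fun x : l2 => x k) @ F)); exact: cauchy_cvg (evc k).
have [g gP] := choice ex.
have near_bound (e : C) x : 0 < e -> F (ball x e) ->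
    forall n, sum2 (fun k => x k - g k) n <= Re e ^+ 2.
  move=> e0 Fx n.
  have h1 : (fun y : l2 => sum2 (fun k => x k - y k) n) @ F -->
      sum2 (fun k => x k - g k) n.
    elim: n => [|n IH].
      by rewrite /sum2 big_ord0; under eq_fun do rewrite big_ord0; exact: cvg_cst.
    rewrite sum2S; under eq_fun do rewrite sum2S.
    apply: cvgD => //; apply: nrm2_cvg; apply: cvgB; first exact: cvg_cst.
    exact: gP.
  apply: (cvgr_to_le h1).
  apply: (@filterS _ F _ (ball x e)) => // y; rewrite -ball_normE /= => xy.
  rewrite -lecR rmorphXn /= (ge0_RRe (ltW e0)).
  apply: le_trans (sum2_le_norm (x - y) n) _.
  by rewrite ler_pXn2r ?nnegrE// ltW.
have [x0 Fx0] := Fc 1 ltr01.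
(* The coordinatewise limit g is seen to be square-summable through its difference from a member of
   the filter. *)
have dl : (fun k => x0 k - g k) \in is_l2.
  by apply/asboolP; exists (Re 1 ^+ 2); exact: near_bound.
pose G := x0 - L2 dl.
have GE k : G k = g k by rewrite /G l2BE /= opprB addrC subrK.
apply: (@cvgP l2 F G).
apply: (@cvgrPdist_lt _ l2 _ F _ id _).2 => e e0.
have e1 : 0 < e / 4 by rewrite divr_gt0.
have [x Fx] := Fc _ e1.
apply: (@filterS _ F _ (ball x (e / 4))) => // y; rewrite -ball_normE /= => xy.
have xG : `|x - G| <= e / 4.
  rewrite -[leRHS](ge0_RRe (ltW e1)); apply: l2_norm_le => [|n].
    exact: (ltW (gt0_Re e1)).
  have -> : sum2 (x - G : l2) n = sum2 (fun k => x k - g k) n.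
    by apply: eq_bigr => i _; rewrite l2BE GE.
  exact: near_bound.
have -> : G - y = (G - x) + (x - y) by rewrite addrA subrK.
apply: le_lt_trans (ler_normD _ _) _; rewrite distrC.
apply: (@le_lt_trans _ _ (e / 4 + e / 4)); first by rewrite lerD// ltW.
have -> : e / 4 + e / 4 = e / 2 by field.
by rewrite ltr_pdivrMr// ltr_pMr// ltr1n.
Qed.

HB.instance Definition _ := Uniform_isComplete.Build l2 l2_complete.

Lemma l2_dot_normE x : l2_dot x x = `|x| ^+ 2.
Proof. by rewrite -l2_norm_sqr. Qed.

HB.instance Definition _ := isHilbert.Build R l2
  l2_dotDl l2_dotZl l2_dotC l2_dot_normE.

End SquareSummable.

(** * Dilations and co-isometries *)

Section Operators.
Context (R : realType).
Local Notation C := R[i].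
Local Notation Re := (@complex.Re R).
Implicit Types H K M N : hilbertType R.

Lemma l2_family N H (T : nat -> bop N H) (K q : R) : 0 <= q < 1 ->
  (forall n, `|T n| <= (K * q ^+ n)%:C%C) ->
  exists V : bop N (l2 H), forall x n, V x n = T n x.
Proof.
move=> /andP[q0 q1] TK; have K0 : 0 <= K.
  by have := le_trans (normr_ge0 _) (TK 0%N); rewrite ler0c expr0 mulr1.
have q20 : 0 < 1 - q ^+ 2 by rewrite subr_gt0 expr_lt1.
(* Cruder than K / sqrt (1 - q^2), but free of square roots; the extra factor 1 / (1 - q^2) is at
   least 1. *)
pose k := K / (1 - q ^+ 2).
have k0 : 0 <= k by rewrite divr_ge0// ltW.
have sum_le x n : sum2 (fun n => T n x) n <= (k * Re `|x|) ^+ 2.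
  have term i : nrm2 (T i x) <= (K * Re `|x|) ^+ 2 * (q ^+ 2) ^+ i.
    have h : Re `|T i x| <= K * q ^+ i * Re `|x|.
      rewrite -lecR rmorphM /= !(ge0_RRe (normr_ge0 _)).
      by rewrite (le_trans (bop_norm_apply _ _))// ler_wpM2r.
    have h0 : 0 <= Re `|T i x| by exact: Re_ge0.
    rewrite /nrm2 -exprM mulnC exprM -exprMn mulrAC ler_pXn2r// ?nnegrE//.
    exact: le_trans h.
  have le1 : sum2 (fun n => T n x) n <= (K * Re `|x|) ^+ 2 / (1 - q ^+ 2).
    elim: n => [|n IH].
      by rewrite /sum2 big_ord0 divr_ge0 ?sqr_ge0// ltW.
    have : sum2 (fun n => T n x) n <=
        (K * Re `|x|) ^+ 2 * (1 - (q ^+ 2) ^+ n) / (1 - q ^+ 2).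
      elim: {IH} n => [|n IH].
        by rewrite /sum2 big_ord0 expr0 subrr mulr0 mul0r.
      rewrite sum2S (le_trans (lerD IH (term n)))// le_eqVlt; apply/orP; left.
      move: (q ^+ 2) q20 => Q Q0; apply/eqP; rewrite [Q ^+ n.+1]exprS.
      by field; rewrite gt_eqF.
    rewrite sum2S => /lerD/(_ (term n)) /le_trans; apply.
    rewrite -subr_ge0.
    have -> : (K * Re `|x|) ^+ 2 / (1 - q ^+ 2) -
      ((K * Re `|x|) ^+ 2 * (1 - (q ^+ 2) ^+ n) / (1 - q ^+ 2) +
       (K * Re `|x|) ^+ 2 * (q ^+ 2) ^+ n) =
      (K * Re `|x|) ^+ 2 * (q ^+ 2) ^+ n * (q ^+ 2 / (1 - q ^+ 2)).
      by field; rewrite gt_eqF.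
    have q2 : 0 <= q ^+ 2 by exact: sqr_ge0.
    apply: mulr_ge0; last by rewrite divr_ge0// ltW.
    by apply: mulr_ge0; [exact: sqr_ge0|exact: exprn_ge0].
  apply: le_trans le1 _.
  have -> : (k * Re `|x|) ^+ 2 = (K * Re `|x|) ^+ 2 / (1 - q ^+ 2) / (1 - q ^+ 2).
    by rewrite /k; field; rewrite gt_eqF.
  rewrite ler_peMr ?divr_ge0 ?sqr_ge0 ?(ltW q20)//.
  by rewrite invf_ge1// gerBl sqr_ge0.
have mem x : (fun n => T n x) \in @is_l2 R H.
  by apply/asboolP; exists ((k * Re `|x|) ^+ 2).
have [||V VE] := @mk_bop R N (l2 H) (fun x => L2 (mem x)) k%:C%C.
- by move=> a x y; apply: l2P => n; rewrite l2DE l2ZE /= linearP.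
- move=> x; rewrite -[`|x| in leRHS]ge0_RRe// -rmorphM; apply: l2_norm_le.
    by rewrite mulr_ge0// Re_ge0.
  exact: sum_le.
by exists V => x n; rewrite VE.
Qed.

Lemma l2_shift H : exists2 S : bop (l2 H) (l2 H), `|S| <= 1 & forall h n, S h n = h n.+1.
Proof.
have le_sum (h : l2 H) n : sum2 (fun n => h n.+1) n <= sum2 h n.+1.
  by rewrite /sum2 big_ord_recl lerDr nrm2_ge0.
have mem (h : l2 H) : (fun n => h n.+1) \in @is_l2 R H.
  have [k hk] := l2_bounded h; apply/asboolP; exists k => n.
  exact: le_trans (le_sum h n) (hk _).
have shift_le (h : l2 H) : `|L2 (mem h)| <= `|h|.
  rewrite -[leRHS]ge0_RRe//; apply: l2_norm_le => [|n]; first exact: Re_ge0.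
  apply: le_trans (le_sum h n) _; rewrite -lecR rmorphXn /= ge0_RRe//.
  exact: sum2_le_norm.
have [||S SE] := @mk_bop R (l2 H) (l2 H) (fun h => L2 (mem h)) 1.
- by move=> a x y; apply: l2P.
- by move=> h; rewrite mul1r shift_le.
exists S => [|h n]; last by rewrite SE.
by apply: bop_norm_le1 => h; rewrite SE shift_le.
Qed.

Lemma l2_coord0 H : exists T : bop (l2 H) H, forall h, T h = h 0%N.
Proof.
have [||T TE] := @mk_bop R (l2 H) H (fun h : l2 H => h 0%N) 1; last by exists T.
- by move=> a x y.
- by move=> h; rewrite mul1r l2_coord_le.
Qed.

Lemma l2_cons_subproof H (y : H) (g : l2 H) :
  (fun n => if n is n'.+1 then g n' else y) \in @is_l2 R H.
Proof.
have [k gk] := l2_bounded g; apply/asboolP; exists (nrm2 y + k) => n.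
apply: (@le_trans _ _ (sum2 (fun n => if n is n'.+1 then g n' else y) n.+1)).
  by rewrite [leRHS]sum2S lerDl nrm2_ge0.
by rewrite /sum2 big_ord_recl lerD2l; exact: gk.
Qed.

Definition l2_cons H (y : H) (g : l2 H) : l2 H := L2 (l2_cons_subproof y g).

Lemma dot_l2_cons H (y y' : H) (g g' : l2 H) :
  dot (l2_cons y g) (l2_cons y' g') = dot y y' + dot g g'.
Proof.
apply: l2_dot_eq; rewrite -cvg_shiftS /=.
have -> : (fun n => pdot (l2_cons y g) (l2_cons y' g') n.+1) =
    (fun n => (dot y y' : C^o) + pdot g g' n).
  by apply/funext => n; rewrite /pdot big_ord_recl.
by apply: cvgD; [exact: cvg_cst|exact: pdot_cvg].
Qed.

Lemma isometry_bop M N (g : M -> N) : linear g ->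
  (forall x y, dot (g x) (g y) = dot x y) ->
  exists2 T : bop M N, T =1 g & bcomp (adjoint T) T = bid M.
Proof.
move=> gl giso; have [||T TE] := @mk_bop R M N g 1 => //.
  move=> x; rewrite mul1r le_eqVlt; apply/orP; left.
  by rewrite -(@eqrXn2 _ 2)// -!dot_normE giso.
exists T => //; apply: bopP => x; apply: dot_inj => y.
by rewrite /= -adjointPr !TE dotC -giso -dotC.
Qed.

Lemma dsum_eq H M (x y : dsum H M) : x.1 = y.1 -> x.2 = y.2 -> x = y.
Proof. exact: injective_projections. Qed.

Lemma dsum_dotE H M (x y : dsum H M) : dot x y = dot x.1 y.1 + dot x.2 y.2.
Proof. by []. Qed.

(* The defect (I - W^* W)^(1/2) x of a contraction W is fed into a unilateral shift. *)
Lemma isometric_dilation H M N (W : bop (dsum H N) (dsum H M)) : `|W| <= 1 ->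
  exists (K : hilbertType R) (j : bop H K) (V : bop (dsum K N) (dsum K M)),
    bcomp (adjoint V) V = bid _ /\
    forall h n, `|W ((h, n) : dsum H N)| = `|(h, n) : dsum H N| ->
      V ((j h, n) : dsum K N) = ((j (W ((h, n) : dsum H N)).1, (W ((h, n) : dsum H N)).2) : dsum K M).
Proof.
move=> W1; have T1 : `|bcomp (adjoint W) W| <= 1.
  by rewrite (le_trans (bcomp_norm _ _))// norm_adjoint mulr_ile1.
have Tadj : adjoint (bcomp (adjoint W) W) = bcomp (adjoint W) W.
  by rewrite adjoint_comp adjointK.
have [Y Yadj YY] := sqrt_one_minus T1 Tadj.
have WY a b : dot (W a) (W b) + dot (Y a) (Y b) = dot a b.
  rewrite !adjointP Yadj -dotDr -[adjoint W (W b)]/(bcomp (adjoint W) W b).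
  by rewrite -[Y (Y b)]/(bcomp Y Y b) YY bopBE [_ + (_ - _)]addrC subrK.
pose E := dsum H N.
pose K : hilbertType R := dsum H (l2 E).
pose j0 (h : H) : K := (h, 0).
have [||j jE _] := @isometry_bop H K j0.
- by move=> a x y; apply: dsum_eq => //=; rewrite scaler0 addr0.
- by move=> x y; rewrite dsum_dotE /= dot0l addr0.
pose c (x : dsum K N) : E := (x.1.1, x.2).
have cl a x y : c (a *: x + y) = a *: c x + c y by [].
pose v (x : dsum K N) : dsum K M :=
  (((W (c x)).1, l2_cons (Y (c x)) x.1.2) : K, (W (c x)).2).
have [||V VE VV] := @isometry_bop (dsum K N) (dsum K M) v.
- move=> a x y; rewrite /v cl !linearP; apply: dsum_eq => //=.
  by apply: dsum_eq => //=; apply: l2P => -[].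
- move=> x y; have := WY (c x) (c y).
  rewrite [dot (W _) _]dsum_dotE [dot (c x) _]dsum_dotE => WYc.
  rewrite dsum_dotE [dot (v x).1 _]dsum_dotE dot_l2_cons.
  rewrite [RHS]dsum_dotE [dot x.1 _]dsum_dotE.
  set w1 := dot (W (c x)).1 _ in WYc *; set w2 := dot (W (c x)).2 _ in WYc *.
  set d := dot (Y _) _ in WYc *; set g := dot x.1.2 _.
  have -> : w1 + (d + g) + w2 = (w1 + w2 + d) + g by ring.
  by rewrite WYc addrAC.
exists K, j, V; split=> // h n Whn.
(* Where W preserves the norm the defect is zero, so nothing enters the shift and V acts as W. *)
have Y0 : Y ((h, n) : E) = 0.
  apply: dot_eq0; apply: (addrI (dot (W ((h, n) : E)) (W ((h, n) : E)))).
  by rewrite WY addr0 !dot_normE Whn.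
have cE : c ((j h, n) : dsum K N) = (h, n) by rewrite /c jE.
rewrite VE /v cE Y0 !jE; apply: dsum_eq => //=.
by apply: dsum_eq => //=; apply: l2P => -[|k] //=; rewrite jE.
Qed.

Section Rows.
Context (H M : hilbertType R).

Lemma dsum_proj1 : exists T : bop (dsum H M) H, forall x, T x = x.1.
Proof.
have [||T TE] := @mk_bop R (dsum H M) H (fun x : dsum H M => x.1) 1; last by exists T.
- by [].
- by move=> x; rewrite mul1r dsum_norm1.
Qed.

Lemma dsum_proj2 : exists T : bop (dsum H M) M, forall x, T x = x.2.
Proof.
have [||T TE] := @mk_bop R (dsum H M) M (fun x : dsum H M => x.2) 1; last by exists T.
- by [].
- by move=> x; rewrite mul1r dsum_norm2.
Qed.

Lemma row_exists N (F : bop H N) (S : bop M N) :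
  exists T : bop (dsum H M) N, forall x, T x = F x.1 + S x.2.
Proof.
have [P1 P1E] := dsum_proj1; have [P2 P2E] := dsum_proj2.
by exists (bcomp F P1 + bcomp S P2) => x; rewrite bopDE /= P1E P2E.
Qed.

Lemma adjoint_row N (F : bop H N) (S : bop M N) (T : bop (dsum H M) N) y :
  (forall x, T x = F x.1 + S x.2) -> adjoint T y = (adjoint F y, adjoint S y).
Proof.
move=> TE; apply: dot_injr => x.
by rewrite -adjointP TE dotDl !adjointP dsum_dotE.
Qed.

End Rows.

Section Coisometry.
Context (H M N N' : hilbertType R).
Context (A : bop H H) (B : bop M H) (C0 : bop H N) (D : bop M N).
Hypothesis co : coisometry (block A B C0 D).

(** Both rows [F S] are of the form [F' J] U with U U^* = I, so their products with adjoints agree.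
    This is the identity that telescopes the kernel. *)
Lemma coisometry_rows (F1 F2 : bop H N') (S1 S2 : bop M N') (F1' F2' : bop H N')
    (J1 J2 : bop N N') :
  F1 = bcomp F1' A + bcomp J1 C0 -> S1 = bcomp F1' B + bcomp J1 D ->
  F2 = bcomp F2' A + bcomp J2 C0 -> S2 = bcomp F2' B + bcomp J2 D ->
  bcomp F1 (adjoint F2) + bcomp S1 (adjoint S2) =
  bcomp F1' (adjoint F2') + bcomp J1 (adjoint J2).
Proof.
move=> F1E S1E F2E S2E.
have [T1 T1E] := row_exists F1 S1; have [T2 T2E] := row_exists F2 S2.
have [U1 U1E] := row_exists F1' J1; have [U2 U2E] := row_exists F2' J2.
have blk (F : bop H N') (S : bop M N') F' J (T : bop (dsum H M) N')
      (U : bop (dsum H N) N') :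
    F = bcomp F' A + bcomp J C0 -> S = bcomp F' B + bcomp J D ->
    (forall x : dsum H M, T x = F x.1 + S x.2) ->
    (forall x : dsum H N, U x = F' x.1 + J x.2) -> T = bcomp U (block A B C0 D).
  move=> -> -> TE UE; apply: bopP => x; rewrite TE /= UE /block_fun /=.
  by rewrite !raddfD /= addrACA.
have TT : bcomp T1 (adjoint T2) = bcomp U1 (adjoint U2).
  rewrite (blk _ _ _ _ _ _ F1E S1E T1E U1E) (blk _ _ _ _ _ _ F2E S2E T2E U2E).
  by rewrite adjoint_comp -bcompA [bcomp (block _ _ _ _) _]bcompA co bcomp1l.
apply: bopP => y; have := congr1 (fun T : bop N' N' => T y) TT.
by rewrite /= (adjoint_row _ T2E) (adjoint_row _ U2E) T1E U1E.
Qed.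

Lemma coisometry_contraction : `|A| <= 1.
Proof.
have T1 : `|block A B C0 D| <= 1.
  rewrite -norm_adjoint; apply: bop_norm_le1 => x.
  by rewrite isometry_norm// adjointK.
apply: bop_norm_le1 => x.
pose xx : dsum H M := (x, 0).
have -> : `|x| = `|xx|.
  apply/eqP; rewrite -(@eqrXn2 _ 2)// -!dot_normE dsum_dotE /= dot0l addr0//.
apply: le_trans (norm1_apply xx T1).
have -> : A x = (block A B C0 D xx).1 by rewrite /= raddf0 addr0.
exact: dsum_norm1.
Qed.

End Coisometry.

End Operators.

(** * From a co-isometry to the kernel *)

Section Functionals.
Context (R : realType) (M N : hilbertType R).

(** These functionals separate bounded operators, as [DA_iter_functionals] requires. *)
Definition matrix_coef (xy : M * N) (T : bop M N) : R[i]^o := dot (T xy.1) xy.2.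

Lemma matrix_coef_linear xy : linear (matrix_coef xy).
Proof. by move=> a S T; rewrite /matrix_coef bopDE bopZE dotDl dotZl. Qed.

HB.instance Definition _ xy := GRing.isLinear.Build R[i] (bop M N) R[i]^o _
  (matrix_coef xy) (matrix_coef_linear xy).

Lemma matrix_coef_eq0 (T : bop M N) : (forall xy, matrix_coef xy T = 0) -> T = 0.
Proof.
move=> T0; apply: bopP => x; apply: dot_inj => y.
by rewrite bop0E dot0l; exact: (T0 (x, y)).
Qed.

End Functionals.

Section ScaleOn.
Context (R : realType) (V : lmodType R[i]) (v : V).

Definition scale_on (a : R[i]^o) : V := a *: v.

Lemma scale_on_linear : linear scale_on.
Proof. by move=> a b c; rewrite /scale_on scalerDl scalerA. Qed.

HB.instance Definition _ := GRing.isLinear.Build R[i] R[i]^o V _ scale_on scale_on_linear.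

End ScaleOn.

Section Iterates.
Context (R : realType) (L : rhombic_lattice R).
Local Notation C := R[i].
Local Notation vertex := (vertex L).
Local Notation origin := (origin L).
Local Notation Z n f := (iter n (@Zplus R L _) f).

Lemma DA_iter_bop (M N : hilbertType R) (f : vertex -> bop M N) n :
  DA f -> DA (Z n f).
Proof.
exact: (@DA_iter_functionals R L _ _ (fun xy => matrix_coef xy) f n (@matrix_coef_eq0 R M N)).
Qed.

Lemma DA_zbasis n : DA (zbasis L n : vertex -> C^o).
Proof. by apply: DA_iter_Zplus_scalar; exact: DA_cst. Qed.

Lemma zbasis_edge n : edge_rel (zbasis L n : vertex -> C^o) (zbasis L n.+1).
Proof. by apply: DA_edge_rel; exact: DA_zbasis. Qed.

Lemma zbasisS_origin n : zbasis L n.+1 origin = 0.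
Proof. by apply: Zplus_origin; exact: DA_zbasis. Qed.

Lemma growth_zbasis (r : R) (z : vertex) : 1 < r ->
  exists2 K : R, 0 <= K & forall n, `|zbasis L n z| <= (K * r ^+ n)%:C%C.
Proof.
move=> r1; have r1' : (1 : C) < r%:C%C by rewrite -[ltLHS]/(1%:C%C) ltcR.
have [K K0 KP] := @growth R L C^o (zbasis L) r%:C%C zbasis_edge zbasisS_origin r1' z.
exists (complex.Re K) => [|n]; first exact: Re_ge0.
by rewrite rmorphM rmorphXn /= ge0_RRe.
Qed.

Lemma growth_bop (M N : hilbertType R) (f : vertex -> bop M N) (r : R) (z : vertex) :
  DA f -> 1 < r -> exists2 K : R, 0 <= K & forall n, `|Z n f z| <= (K * r ^+ n)%:C%C.
Proof.
move=> fD r1; have r1' : (1 : C) < r%:C%C by rewrite -[ltLHS]/(1%:C%C) ltcR.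
have [||K K0 KP] := @growth R L (bop M N) (fun n => Z n f) r%:C%C _ _ r1' z.
- by move=> n; apply: DA_edge_rel; exact: DA_iter_bop.
- by move=> n; apply: Zplus_origin; exact: DA_iter_bop.
exists (complex.Re K) => [|n]; first exact: Re_ge0.
by rewrite rmorphM rmorphXn /= ge0_RRe.
Qed.

(** The constant v is the image of the constant 1 under the linear map a |-> a v, which commutes
    with Z_+. *)
Lemma iter_Zplus_cst (V : lmodType C) (v : V) n :
  Z n (fun _ : vertex => v) = (fun z => zbasis L n z *: v).
Proof.
rewrite -[RHS]/(scale_on v \o iter n (@Zplus R L C^o) (fun=> 1)).
rewrite -(@iter_Zplus_linear R L _ _ (scale_on v)).
by congr (iter n _ _); apply/funext => z; rewrite /= /scale_on scale1r.
Qed.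

(** A rate strictly between 1 and mu: above 1 it bounds the iterates of Z_+, and its quotient by mu
    is below 1, so the weighted series converge. *)
Definition mid (mu : R) : R := (1 + mu) / 2.

Lemma mid_gt1 mu : 1 < mu -> 1 < mid mu. Proof. by rewrite /mid; lra. Qed.

Lemma mid_ratio mu : 1 < mu -> 0 <= mid mu / mu < 1.
Proof.
move=> mu1; have mu0 : 0 < mu by lra.
rewrite divr_ge0 /mid; [|lra|lra].
by rewrite /= ltr_pdivrMr// mul1r; lra.
Qed.

(** * The resolvent as a power series *)

Section Resolvent.
Context (H : hilbertType R) (T : bop H H) (mu : R).
Hypothesis mu1 : 1 < mu.
Hypothesis T_le : `|T| <= mu^-1%:C%C.

Definition bpow (n : nat) : bop H H := iter n (bcomp T) (bid H).

Lemma bpowS n : bpow n.+1 = bcomp T (bpow n). Proof. by []. Qed.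

Lemma bpowSr n : bpow n.+1 = bcomp (bpow n) T.
Proof.
elim: n => [|n IH]; first exact: bopP.
by rewrite bpowS {1}IH bcompA -bpowS.
Qed.

Lemma bpow_norm n : `|bpow n| <= (mu^-1 ^+ n)%:C%C.
Proof.
elim: n => [|n IH]; first by rewrite expr0 bid_norm.
by rewrite bpowS exprS rmorphM (le_trans (bcomp_norm _ _))// ler_pM.
Qed.

(** For k = 0 these are the terms of the resolvent; k = 1 shifts the basis functions only and gives
    the terms of its image under Z_+. *)
Let term (k : nat) (z : vertex) (n : nat) : bop H H := zbasis L (n + k) z *: bpow n.

Let term_cvg k z : cvgn (series (term k z)).
Proof.
have [K K0 KP] := growth_zbasis z (mid_gt1 mu1).
apply: (@cvg_series_geometric _ _ _ (K * mid mu ^+ k) (mid mu / mu)).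
  exact: mid_ratio.
move=> n; rewrite normrZ (le_trans (ler_pM _ _ (KP _) (bpow_norm n)))//.
rewrite -rmorphM lecR le_eqVlt; apply/orP; left; apply/eqP.
by move: (mid mu) => m; rewrite exprMn exprD; ring.
Qed.

Let sums k z : bop H H := limn (series (term k z)).

Let sums_cvg k z : series (term k z) @ \oo --> sums k z.
Proof. exact: term_cvg. Qed.

Let sums_edge : edge_rel (sums 0%N) (sums 1%N).
Proof.
move=> a b ab; apply: (cvg_uniq (@sums_cvg 1%N b)).
set c1 := _ * (1 + _); set c2 := _ * (1 - _).
have -> : series (term 1%N b) = (fun n => series (term 1%N a) n +
    c1 *: series (term 0%N a) n - c2 *: series (term 0%N b) n).
  apply/funext => n; rewrite /series /= !scaler_sumr -big_split -sumrB.
  apply: eq_bigr => i _; rewrite /term addn1 addn0 (zbasis_edge i ab).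
  by rewrite scalerBl scalerDl !scalerA.
apply: cvgB; first apply: cvgD; first exact: sums_cvg.
  by apply: cvgZr; exact: sums_cvg.
by apply: cvgZr; exact: sums_cvg.
Qed.

Let sums_eq z : sums 0%N z = bid H + bcomp T (sums 1%N z) /\
  sums 0%N z = bid H + bcomp (sums 1%N z) T.
Proof.
have cS : series (term 0%N z) n.+1 @[n --> \oo] --> sums 0%N z.
  by rewrite (@cvg_shiftS (bop H H) (series (term 0%N z))); exact: sums_cvg.
have E0 : term 0%N z 0%N = bid H by rewrite /term scale1r.
split; apply: (cvg_uniq cS).
  have -> : (fun n => series (term 0%N z) n.+1) =
      (fun n => bid H + bcomp T (series (term 1%N z) n)).
    apply/funext => n; rewrite /series /= big_nat_recl// E0; congr (_ + _).
    rewrite raddf_sum; apply: eq_bigr => i _; rewrite /term addn0 addn1.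
    by rewrite /= bcompZr.
  by apply: cvgD; [exact: cvg_cst|apply: cvg_bcompr; exact: sums_cvg].
have -> : (fun n => series (term 0%N z) n.+1) =
    (fun n => bid H + bcompr T (series (term 1%N z) n)).
  apply/funext => n; rewrite /series /= big_nat_recl// E0; congr (_ + _).
  rewrite raddf_sum; apply: eq_bigr => i _; rewrite /term addn0 addn1.
  by rewrite /= /bcompr bcompZl -bpowSr.
by apply: cvgD; [exact: cvg_cst|apply: cvg_bcompl; exact: sums_cvg].
Qed.

(** One inverse is enough for [xget] to return an inverse. For the series, the edge relation
    together with the value 0 at the origin identifies Z_+ without evaluating an integral. *)
Lemma resolventP : is_odot_inverse [:: bid H; - T] (resolvent L T).
Proof.
rewrite /resolvent; case: xgetP => [G _ //|none]; exfalso; apply: (none (sums 0%N)).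
have s0 : sums 1%N origin = 0.
  rewrite /sums; have -> : series (term 1%N origin) = (fun=> 0).
    apply/funext => n; rewrite /series /= big1// => i _.
    by rewrite /term addn1 zbasisS_origin scale0r.
  exact: lim_cst.
have ZE := edge_rel_Zplus sums_edge s0.
split; first exact: edge_rel_DA sums_edge.
  apply/funext => z; rewrite /odot_polyr /= big_ord_recr big_ord1 /= ZE.
  by rewrite bcomp1r bcompNr (sums_eq z).2 addrK.
apply/funext => z; rewrite /odot_polyl /= big_ord_recr big_ord1 /= ZE.
by rewrite bcomp1l bcompNl (sums_eq z).1 addrK.
Qed.

Lemma resolvent_DA : DA (resolvent L T).
Proof. by case: resolventP. Qed.

Lemma resolvent_eq z :
  resolvent L T z = bid H + bcomp (Zplus (resolvent L T) z) T.
Proof.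
have [_ + _] := resolventP; move=> /(congr1 (fun f => f z)).
rewrite /odot_polyr /= big_ord_recr big_ord1 /= bcomp1r bcompNr => <-.
by rewrite subrK.
Qed.

End Resolvent.

Lemma schurE (H M N : hilbertType R) (A : bop H H) (B : bop M H) (C0 : bop H N)
    (D : bop M N) (mu : R) z :
  schur L A B C0 D mu z = D + bcomp
    (Zplus (fun z => bcomp C0 (resolvent L (mu^-1%:C%C *: A) z)) z) (mu^-1%:C%C *: B).
Proof.
by rewrite /schur /odot_polyr /= big_ord_recr big_ord1 /= bcomp0r add0r.
Qed.

Lemma scaled_contraction (H : hilbertType R) (A : bop H H) (mu : R) : 1 < mu ->
  `|A| <= 1 -> `|mu^-1%:C%C *: A| <= mu^-1%:C%C.
Proof.
move=> mu1 A1; rewrite normrZ normCR ger0_norm; last by rewrite invr_ge0; lra.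
by rewrite ler_piMr// ler0c invr_ge0; lra.
Qed.

Section Direct.
Context (H M N : hilbertType R) (A : bop H H) (B : bop M H) (C0 : bop H N) (D : bop M N).
Context (mu : R).
Hypothesis co : coisometry (block A B C0 D).
Hypothesis mu1 : 1 < mu.
Let T := mu^-1%:C%C *: A.
Let S := schur L A B C0 D mu.
Let F := fun z : vertex => bcomp C0 (resolvent L T z).

Let T_le : `|T| <= mu^-1%:C%C.
Proof. exact: scaled_contraction mu1 (coisometry_contraction co). Qed.

Let F_DA : DA F.
Proof. by apply: (@DA_linear R L _ _ (bcomp C0)); exact: resolvent_DA mu1 T_le. Qed.

Let FE : F = (fun=> C0) \+ (bcompr T \o Zplus F).
Proof.
apply/funext => z; rewrite /= {1}/F (resolvent_eq mu1 T_le) bcompDr bcomp1r; congr (_ + _).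
by rewrite bcompA /bcompr /F (@Zplus_linear R L _ _ (bcomp C0)).
Qed.

Let SE : S = (fun=> D) \+ (bcompr (mu^-1%:C%C *: B) \o Zplus F).
Proof. by apply/funext => z; rewrite /S schurE. Qed.

(** The n-th power of Z_+ applied to F = C0 + (Z_+ F / mu) A turns the constant into z^(n) C0, the
    form that [coisometry_rows] takes. *)
Let F_iter n z : Z n F z = bcomp (mu^-1%:C%C *: Z n.+1 F z) A
  + bcomp (zbasis L n z *: bid N) C0.
Proof.
rewrite {1}FE iter_ZplusD iter_Zplus_cst iter_Zplus_linear /= addrC -iterSr.
by rewrite !bcompZl bcomp1l /bcompr /T bcompZr.
Qed.

Let S_iter n z : Z n S z = bcomp (mu^-1%:C%C *: Z n.+1 F z) B
  + bcomp (zbasis L n z *: bid N) D.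
Proof.
rewrite {1}SE iter_ZplusD iter_Zplus_cst iter_Zplus_linear /= addrC -iterSr.
by rewrite !bcompZl bcomp1l /bcompr bcompZr.
Qed.

Let rest z w n : bop N N := ((mu ^+ (2 * n))^-1)%:C%C *:
  bcomp (Z n F z) (adjoint (Z n F w)).

Let term_eq z w n : schur_term mu S z w n = rest z w n - rest z w n.+1.
Proof.
have h := coisometry_rows co (F_iter n z) (S_iter n z) (F_iter n w) (S_iter n w).
rewrite /schur_term /rest.
have -> : (mu ^+ (2 * n.+1))^-1%:C%C *: bcomp (Z n.+1 F z) (adjoint (Z n.+1 F w)) =
  (mu ^+ (2 * n))^-1%:C%C *: bcomp (mu^-1%:C%C *: Z n.+1 F z) (adjoint (mu^-1%:C%C *: Z n.+1 F w)).
  rewrite adjointZ conjCR bcompZl bcompZr !scalerA -!rmorphM; congr (_%:C%C *: _).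
  by rewrite mulnS exprD invfM [mu ^+ 2]expr2 invfM; ring.
rewrite -scalerBr; congr (_ *: _).
have -> : (zbasis L n z * (zbasis L n w)^*) *: bid N =
    bcomp (zbasis L n z *: bid N) (adjoint (zbasis L n w *: bid N)).
  by rewrite adjointZ adjoint1 bcompZl bcompZr bcomp1l scalerA.
move: h; set FF := bcomp (Z n F z) _; set SS := bcomp (Z n S z) _.
set G := bcomp (_ *: Z n.+1 F z) _; set J := bcomp (zbasis L n z *: _) _ => h.
have -> : J = FF + SS - G by rewrite h addrAC subrr add0r.
by rewrite addrAC addrK.
Qed.

Lemma schur_kernel_cvg z w :
  series (schur_term mu S z w) @ \oo --> bcomp (F z) (adjoint (F w)).
Proof.
have -> : series (schur_term mu S z w) = (fun n => rest z w 0 - rest z w n).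
  apply/funext => n; rewrite /series /=; under eq_bigr do rewrite term_eq.
  have := telescope_sumr (rest z w) (leq0n n).
  move=> h; rewrite -[RHS]opprB -h -sumrN; apply: eq_bigr => i _.
  by rewrite opprB.
have -> : rest z w 0 = bcomp (F z) (adjoint (F w)).
  by rewrite /rest muln0 expr0 invr1 scale1r.
rewrite -[X in _ --> X]subr0; apply: cvgB; first exact: cvg_cst.
have [K K0 KP] := growth_bop z F_DA (mid_gt1 mu1).
have [K' K'0 KP'] := growth_bop w F_DA (mid_gt1 mu1).
have mu0 : 0 <= mu by rewrite ltW// (lt_trans ltr01).
have [q0 q1] := andP (mid_ratio mu1); set q := mid mu / mu in q0 q1.
have le n : `|rest z w n| <= (K * K' * (q ^+ 2) ^+ n)%:C%C.
  rewrite /rest normrZ normCR ger0_norm ?invr_ge0 ?exprn_ge0//.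
  apply: (@le_trans _ _ ((mu ^+ (2 * n))^-1%:C%C *
     ((K * mid mu ^+ n)%:C%C * (K' * mid mu ^+ n)%:C%C))).
    rewrite ler_wpM2l ?ler0c ?invr_ge0 ?exprn_ge0//.
    by rewrite (le_trans (bcomp_norm _ _))// norm_adjoint ler_pM.
  rewrite -!rmorphM lecR le_eqVlt; apply/orP; left; apply/eqP.
  rewrite /q; move: (mid mu) => m.
  have -> : mu ^+ (2 * n) = mu ^+ n * mu ^+ n by rewrite mul2n -addnn exprD.
  have -> : ((m / mu) ^+ 2) ^+ n = (m ^+ n / mu ^+ n) ^+ 2.
    by rewrite -exprM mulnC exprM expr_div_n.
  by rewrite invfM; ring.
have q2 : 0 <= q ^+ 2 < 1 by rewrite exprn_ge0//= expr_lt1.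
(* The remainder tends to 0 as the general term of a convergent series. *)
apply: cvg_series_cvg_0.
apply: (@cvg_series_geometric _ _ _ (K * K') (q ^+ 2)) => //.
Qed.

Lemma schur_kernel_factor :
  [/\ forall z w, cvgn (series (schur_term mu S z w)),
    forall z w, schur_kernel mu S z w = bcomp (F z) (adjoint (F w))
    & positive_kernel (schur_kernel mu S)].
Proof.
have kE z w : schur_kernel mu S z w = bcomp (F z) (adjoint (F w)).
  exact: (cvg_lim (@norm_hausdorff _ _) (@schur_kernel_cvg z w)).
split=> // [z w|m w x]; first exact: (cvgP _ (@schur_kernel_cvg z w)).
have -> : \sum_(i < m) \sum_(j < m) dot (schur_kernel mu S (w i) (w j) (x j)) (x i) =
    dot (\sum_(j < m) adjoint (F (w j)) (x j)) (\sum_(i < m) adjoint (F (w i)) (x i)).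
  rewrite dot_sumr; apply: eq_bigr => i _; rewrite dot_suml; apply: eq_bigr => j _.
  by rewrite kE -adjointP.
exact: dot_ge0.
Qed.


End Direct.

End Iterates.

(** * From a positive kernel to a co-isometry *)

Section Blocks.
Context (R : realType) (H1 M H2 N : hilbertType R).

Lemma dsum_in1 : exists T : bop H1 (dsum H1 M), forall x, T x = (x, 0).
Proof.
have [||T TE _] := @isometry_bop R H1 (dsum H1 M) (fun x => (x, 0)); last by exists T.
- by move=> a x y; apply: dsum_eq => //=; rewrite scaler0 addr0.
- by move=> x y; rewrite dsum_dotE /= dot0l addr0.
Qed.

Lemma dsum_in2 : exists T : bop M (dsum H1 M), forall x, T x = (0, x).
Proof.
have [||T TE _] := @isometry_bop R M (dsum H1 M) (fun x => (0, x)); last by exists T.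
- by move=> a x y; apply: dsum_eq => //=; rewrite scaler0 addr0.
- by move=> x y; rewrite dsum_dotE /= dot0l add0r.
Qed.

Lemma block_exists (T : bop (dsum H1 M) (dsum H2 N)) :
  exists (A : bop H1 H2) (B : bop M H2) (C0 : bop H1 N) (D : bop M N), T = block A B C0 D.
Proof.
have [i1 i1E] := dsum_in1; have [i2 i2E] := dsum_in2.
have [p1 p1E] := @dsum_proj1 R H2 N; have [p2 p2E] := @dsum_proj2 R H2 N.
exists (bcomp p1 (bcomp T i1)), (bcomp p1 (bcomp T i2)), (bcomp p2 (bcomp T i1)),
  (bcomp p2 (bcomp T i2)).
apply: bopP => x.
have xE : x = i1 x.1 + i2 x.2.
  by rewrite i1E i2E; apply: dsum_eq => /=; rewrite ?addr0 ?add0r.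
by rewrite {1}xE raddfD; apply: dsum_eq; rewrite /= ?p1E ?p2E.
Qed.

End Blocks.

Section Converse.
Context (R : realType) (L : rhombic_lattice R) (M N : hilbertType R) (mu : R).
Local Notation C := R[i].
Local Notation vertex := (vertex L).
Local Notation origin := (origin L).
Local Notation Z n f := (iter n (@Zplus R L _) f).
Context (S : vertex -> bop M N).
Hypothesis mu1 : 1 < mu.
Hypothesis S_DA : DA S.

Let mu0 : 0 < mu. Proof. exact: lt_trans mu1. Qed.

Let scal (n : nat) : C := (mu ^- n)%:C%C.

Let scal_conj n : (scal n)^* = scal n. Proof. exact: conjCR. Qed.

Let scalS n : scal n.+1 = mu^-1%:C%C * scal n.
Proof. by rewrite /scal exprS invfM rmorphM. Qed.

Let scal2 n : scal n * scal n = ((mu ^+ (2 * n))^-1)%:C%C.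
Proof. by rewrite /scal -rmorphM -invfM -exprD addnn mul2n. Qed.

Let scal_norm n (V : normedModType C) (v : V) (K : R) :
  `|v| <= (K * mid mu ^+ n)%:C%C -> `|scal n *: v| <= (K * (mid mu / mu) ^+ n)%:C%C.
Proof.
move=> vK; rewrite normrZ normCR ger0_norm ?invr_ge0 ?exprn_ge0 ?(ltW mu0)//.
rewrite expr_div_n mulrA mulrC rmorphM /= ler_wpM2r//.
by rewrite ler0c invr_ge0 exprn_ge0// ltW.
Qed.

(** [P w] and [Q w] below are the operators written P(w)^* and Q(w)^* in the overview. The conjugate
    makes dot (P w x) (P z y) carry the factor z^(n) conj w^(n). *)
Lemma P_exists : exists P : vertex -> bop N (l2 N),
  forall w x n, P w x n = (scal n * (zbasis L n w)^*) *: x.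
Proof.
suff ex w : exists V : bop N (l2 N),
    forall x n, V x n = (scal n * (zbasis L n w)^*) *: x.
  by have [P PE] := choice ex; exists P.
have [K K0 KP] := growth_zbasis w (mid_gt1 mu1).
have [||V VE] := @l2_family R N N (fun n => scal n *: ((zbasis L n w)^* *: bid N)) K (mid mu / mu).
- exact: mid_ratio.
- move=> n; apply: scal_norm; rewrite normrZ norm_conjC (le_trans _ (KP n))//.
  by rewrite ler_piMr// bid_norm.
by exists V => x n; rewrite VE !bopZE scalerA.
Qed.

Lemma Q_exists : exists Q : vertex -> bop N (l2 M),
  forall w x n, Q w x n = scal n *: adjoint (Z n S w) x.
Proof.
suff ex w : exists V : bop N (l2 M),
    forall x n, V x n = scal n *: adjoint (Z n S w) x.
  by have [Q QE] := choice ex; exists Q.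
have [K K0 KP] := growth_bop w S_DA (mid_gt1 mu1).
have [||V VE] := @l2_family R N M (fun n => scal n *: adjoint (Z n S w)) K (mid mu / mu).
- exact: mid_ratio.
- by move=> n; apply: scal_norm; rewrite norm_adjoint.
by exists V => x n; rewrite VE bopZE.
Qed.

Lemma schur_kernel_is_cvg z w : cvgn (series (schur_term mu S z w)).
Proof.
have [K1 K10 K1P] := growth_zbasis z (mid_gt1 mu1).
have [K2 K20 K2P] := growth_zbasis w (mid_gt1 mu1).
have [K3 K30 K3P] := growth_bop z S_DA (mid_gt1 mu1).
have [K4 K40 K4P] := growth_bop w S_DA (mid_gt1 mu1).
have /andP[q0 q1] := mid_ratio mu1.
apply: (@cvg_series_geometric _ _ _ (K1 * K2 + K3 * K4) ((mid mu / mu) ^+ 2)).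
  by rewrite exprn_ge0//= expr_lt1.
move=> n; rewrite /schur_term normrZ normCR ger0_norm; last first.
  by rewrite invr_ge0 exprn_ge0// ltW.
have h1 : `|(zbasis L n z * (zbasis L n w)^*) *: bid N| <=
    ((K1 * K2) * (mid mu ^+ n * mid mu ^+ n))%:C%C.
  rewrite normrZ normrM norm_conjC -[leRHS]mulr1 ler_pM ?mulr_ge0 ?bid_norm//.
  apply: le_trans (ler_pM _ _ (K1P n) (K2P n)) _ => //.
  by rewrite -rmorphM lecR le_eqVlt; apply/orP; left; apply/eqP; ring.
have h2 : `|bcomp (Z n S z) (adjoint (Z n S w))| <=
    ((K3 * K4) * (mid mu ^+ n * mid mu ^+ n))%:C%C.
  apply: le_trans (bcomp_norm _ _) _; rewrite norm_adjoint.
  apply: le_trans (ler_pM _ _ (K3P n) (K4P n)) _ => //.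
  by rewrite -rmorphM lecR le_eqVlt; apply/orP; left; apply/eqP; ring.
apply: (@le_trans _ _ ((mu ^+ (2 * n))^-1%:C%C *
  ((K1 * K2 + K3 * K4) * (mid mu ^+ n * mid mu ^+ n))%:C%C)).
  rewrite ler_wpM2l ?ler0c ?invr_ge0 ?exprn_ge0 ?(ltW mu0)//.
  by rewrite (le_trans (ler_normB _ _))// mulrDl rmorphD lerD.
rewrite -rmorphM lecR le_eqVlt; apply/orP; left; apply/eqP.
move: (mid mu) => m.
have -> : mu ^+ (2 * n) = mu ^+ n * mu ^+ n by rewrite mul2n -addnn exprD.
have -> : ((m / mu) ^+ 2) ^+ n = (m ^+ n / mu ^+ n) ^+ 2.
  by rewrite -exprM mulnC exprM expr_div_n.
by rewrite invfM; ring.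
Qed.

(** The partial sums agree term by term, the weight mu^-2n being split between the two sequences. *)
Lemma schur_kernel_dot (P : vertex -> bop N (l2 N)) (Q : vertex -> bop N (l2 M)) z w x y :
  (forall w x n, P w x n = (scal n * (zbasis L n w)^*) *: x) ->
  (forall w x n, Q w x n = scal n *: adjoint (Z n S w) x) ->
  dot (schur_kernel mu S z w x) y = dot (P w x) (P z y) - dot (Q w x) (Q z y).
Proof.
move=> PE QE.
have h1 : (dot (series (schur_term mu S z w) n x) y : C^o) @[n --> \oo] -->
    (dot (schur_kernel mu S z w x) y : C^o).
  have bnd (T T' : bop N N) : `|(dot (T x) y : C^o) - (dot (T' x) y : C^o)| <=
      (`|x| * `|y|) * `|T - T'|.
    rewrite -dotBl -bopBE (le_trans (cauchy_schwarz _ _))//.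
    by rewrite [leRHS]mulrAC ler_wpM2r// [leRHS]mulrC bop_norm_apply.
  apply: (@cvg_lipschitz R (bop N N) C^o (fun T => dot (T x) y : C^o) _ _ _ _ _ _ _ bnd).
    by rewrite mulr_ge0.
  exact: schur_kernel_is_cvg.
have h2 : (pdot (P w x) (P z y) \- pdot (Q w x) (Q z y)) @ \oo -->
    (dot (P w x) (P z y) - dot (Q w x) (Q z y) : C^o).
  by apply: cvgB; exact: pdot_cvg.
apply: (@cvg_uniq R C^o nat \oo _ _ _ _ h1).
suff -> : (fun n => dot (series (schur_term mu S z w) n x) y : C^o) =
  pdot (P w x) (P z y) \- pdot (Q w x) (Q z y) by [].
apply/funext => n; rewrite /pdot /= -sumrB /series /= big_mkord.
rewrite -[dot _ y]/(matrix_coef (x, y) _) raddf_sum; apply: eq_bigr => i _.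
rewrite /matrix_coef /= !PE !QE !dotZl !dotZr rmorphM /= conjCK !scal_conj.
rewrite -adjointP -[LHS]/(dot (schur_term mu S z w i x) y) /schur_term.
by rewrite bopZE bopBE bopZE dotZl dotBl dotZl -scal2; ring.
Qed.

Hypothesis K_pos : positive_kernel (schur_kernel mu S).

(** Finite formal combinations of vectors attached to vertices; concatenation is addition, and a
    vertex may occur repeatedly. *)
Let E := seq (vertex * N).

Section Construction.
Context (P : vertex -> bop N (l2 N)) (Q : vertex -> bop N (l2 M)).
Hypothesis PE : forall w x n, P w x n = (scal n * (zbasis L n w)^*) *: x.
Hypothesis QE : forall w x n, Q w x n = scal n *: adjoint (Z n S w) x.

Definition span_of (K : hilbertType R) (P' : vertex -> bop N K) (s : E) : K :=
  \sum_(i <- s) P' i.1 i.2.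

Lemma span_comb (K : hilbertType R) (P' : vertex -> bop N K) a (s s' : E) :
  span_of P' ([seq (i.1, a *: i.2) | i <- s] ++ s') = a *: span_of P' s + span_of P' s'.
Proof.
rewrite /span_of big_cat big_map scaler_sumr; congr (_ + _).
by apply: eq_bigr => i _; rewrite linearZ.
Qed.

Lemma span_seq1 (K : hilbertType R) (P' : vertex -> bop N K) w x :
  span_of P' [:: (w, x)] = P' w x.
Proof. by rewrite /span_of big_seq1. Qed.

Lemma span_comp (K K' : hilbertType R) (T : bop K K') (P' : vertex -> bop N K) (s : E) :
  T (span_of P' s) = span_of (fun w => bcomp T (P' w)) s.
Proof. exact: raddf_sum. Qed.

(** Positivity of the kernel at the entries of [s] is exactly the difference of the two squared
    norms being nonnegative. *)
Lemma span_le s : `|span_of Q s| <= `|span_of P s|.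
Proof.
rewrite -(@ler_pXn2r _ 2) ?nnegrE// -!dot_normE -subr_ge0.
pose w (i : 'I_(size s)) := (tnth (in_tuple s) i).1.
pose x (i : 'I_(size s)) := (tnth (in_tuple s) i).2.
have := K_pos w x; congr (_ <= _).
rewrite /span_of !(big_tnth _ _ s) !dot_sumr -sumrB; apply: eq_bigr => i _.
rewrite !dot_suml -sumrB; apply: eq_bigr => j _.
exact: schur_kernel_dot.
Qed.

(** The recursion of w^(n) along an edge links coordinates n and n + 1, which becomes a relation
    with the backward shift. It determines [Sh (P b x)] from data at a and from [P b x], so facts on
    shifted sequences propagate from the origin. *)
Lemma P_edge (Sh : bop (l2 N) (l2 N)) : (forall h n, Sh h n = h n.+1) ->
  forall a b, adj a b -> forall x, Sh (P b x) = Sh (P a x) +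
  (mu^-1%:C%C * (2^-1 * (1 + (\val b - \val a)))^*) *: P a x -
  (mu^-1%:C%C * (2^-1 * (1 - (\val b - \val a)))^*) *: P b x.
Proof.
move=> ShE a b ab x; apply: l2P => n.
rewrite l2BE l2DE !l2ZE !ShE !PE (zbasis_edge n ab) !scalerA -scalerDl -scalerBl.
by congr (_ *: _); rewrite scalS rmorphB rmorphD !rmorphM /=; ring.
Qed.

Lemma Q_edge (Sh : bop (l2 M) (l2 M)) : (forall h n, Sh h n = h n.+1) ->
  forall a b, adj a b -> forall x, Sh (Q b x) = Sh (Q a x) +
  (mu^-1%:C%C * (2^-1 * (1 + (\val b - \val a)))^*) *: Q a x -
  (mu^-1%:C%C * (2^-1 * (1 - (\val b - \val a)))^*) *: Q b x.
Proof.
move=> ShE a b ab x; apply: l2P => n.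
have SE : edge_rel (Z n S) (Z n.+1 S) by apply: DA_edge_rel; exact: DA_iter_bop.
rewrite l2BE l2DE !l2ZE !ShE !QE (SE _ _ ab) adjointD adjointN adjointD !adjointZ.
rewrite bopBE bopDE !bopZE scalerBr scalerDr !scalerA scalS.
by congr (_ + _ *: _ - _ *: _); ring.
Qed.

Lemma l2_split (K : hilbertType R) (Sh : bop (l2 K) (l2 K)) :
  (forall h n, Sh h n = h n.+1) ->
  forall h : l2 K, dot h h = dot (h 0%N) (h 0%N) + dot (Sh h) (Sh h).
Proof.
move=> ShE h; rewrite -dot_l2_cons; congr (dot _ _);
  by apply: l2P => -[|n] //=; rewrite ShE.
Qed.

(* F and F' = Z_+ F / mu are recovered from an isometry V with
   V (F'(w)^* x, x) = (F(w)^* x, S(w)^* x). *)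
Lemma model : exists (K : hilbertType R) (V : bop (dsum K N) (dsum K M))
    (Phi Phi' : vertex -> bop N K),
  [/\ bcomp (adjoint V) V = bid _,
    forall w x, V ((Phi' w x, x) : dsum K N) = ((Phi w x, adjoint (S w) x) : dsum K M),
    Phi' origin = 0 &
    forall a b, adj a b -> Phi' b = Phi' a +
      (mu^-1%:C%C * (2^-1 * (1 + (\val b - \val a)))^*) *: Phi a -
      (mu^-1%:C%C * (2^-1 * (1 - (\val b - \val a)))^*) *: Phi b].
Proof.
have comb (K K' : hilbertType R) (P1 : vertex -> bop N K) (P2 : vertex -> bop N K')
    (a : C) (e e' : E) : exists e'', span_of P1 e'' = a *: span_of P1 e + span_of P1 e' /\
    span_of P2 e'' = a *: span_of P2 e + span_of P2 e'.
  by exists ([seq (i.1, a *: i.2) | i <- e] ++ e'); rewrite !span_comb.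
have [X X1 XE] := contraction_extension [::] (comb _ _ P Q) span_le.
have XPQ w x : X (P w x) = Q w x by rewrite -!span_seq1 XE.
have T1 : `|bcomp (adjoint X) X| <= 1.
  by rewrite (le_trans (bcomp_norm _ _))// norm_adjoint mulr_ile1.
have Tadj : adjoint (bcomp (adjoint X) X) = bcomp (adjoint X) X.
  by rewrite adjoint_comp adjointK.
have [Y Yadj YY] := sqrt_one_minus T1 Tadj.
have XY a b : dot (Y a) (Y b) = dot a b - dot (X a) (X b).
  rewrite !adjointP Yadj -dotBr -[adjoint X (X b)]/(bcomp (adjoint X) X b).
  by rewrite -[Y (Y b)]/(bcomp Y Y b) YY.
have [ShN _ ShNE] := l2_shift N; have [ShM _ ShME] := l2_shift M.
have ShP0 x : ShN (P origin x) = 0.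
  by apply: l2P => n; rewrite ShNE PE zbasisS_origin rmorph0 mulr0 scale0r.
have ShQ0 x : ShM (Q origin x) = 0.
  apply: l2P => n; rewrite ShME QE.
  have -> : Z n.+1 S origin = 0 by apply: Zplus_origin; exact: DA_iter_bop.
  by rewrite adjoint0 scaler0.
(* The intertwining is needed on these vectors only. At the origin both shifted sequences vanish,
   and the two edge relations have the same coefficients. *)
have XSh w x : X (ShN (P w x)) = ShM (Q w x).
  elim/vertex_ind: w => [|a b ab IH]; first by rewrite ShP0 ShQ0 raddf0.
  rewrite (P_edge ShNE ab) (Q_edge ShME ab) raddfB raddfD /= IH.
  by rewrite !linearZ /= !XPQ.
pose u1 w := bcomp Y (bcomp ShN (P w)).
pose v1 w := bcomp Y (P w).
have [i1 i1E] := @dsum_in1 R (l2 N) N; have [i2 i2E] := @dsum_in2 R (l2 N) N.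
have [k1 k1E] := @dsum_in1 R (l2 N) M; have [k2 k2E] := @dsum_in2 R (l2 N) M.
pose u w := bcomp i1 (u1 w) + i2.
pose v w := bcomp k1 (v1 w) + bcomp k2 (adjoint (S w)).
have uE w x : u w x = (u1 w x, x).
  by rewrite /u bopDE /= i1E i2E; apply: dsum_eq => /=; rewrite ?addr0 ?add0r.
have vE w x : v w x = (v1 w x, adjoint (S w) x).
  by rewrite /v bopDE /= k1E k2E; apply: dsum_eq => /=; rewrite ?addr0 ?add0r.
(* Write p and q = X p for the two spans. On the left, |Y p|^2 + |q 0|^2 = |p|^2 - |q|^2 + |q 0|^2;
   on the right, |Y Sh p|^2 + |p 0|^2 = |Sh p|^2 - |Sh q|^2 + |p 0|^2. Both equal |p|^2 - |Sh
   q|^2. *)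
have uv s : `|span_of v s| = `|span_of u s|.
  have [p1 p1E] := @dsum_proj1 R (l2 N) N; have [p2 p2E] := @dsum_proj2 R (l2 N) N.
  have [q1 q1E] := @dsum_proj1 R (l2 N) M; have [q2 q2E] := @dsum_proj2 R (l2 N) M.
  have [cN cNE] := @l2_coord0 R N; have [cM cME] := @l2_coord0 R M.
  have us1 : (span_of u s).1 = Y (ShN (span_of P s)).
    rewrite -p1E !span_comp; apply: eq_bigr => i _.
    by rewrite -[LHS]/(p1 (u i.1 i.2)) p1E uE.
  have us2 : (span_of u s).2 = (span_of P s) 0%N.
    rewrite -p2E -cNE !span_comp; apply: eq_bigr => i _.
    rewrite -[LHS]/(p2 (u i.1 i.2)) p2E -[RHS]/(cN (P i.1 i.2)) cNE uE PE /scal expr0 invr1 mul1r.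
    by rewrite [zbasis L 0 _]/(1 : C) rmorph1 scale1r.
  have vs1 : (span_of v s).1 = Y (span_of P s).
    by rewrite -q1E !span_comp; apply: eq_bigr => i _;
      rewrite -[LHS]/(q1 (v i.1 i.2)) q1E vE.
  have vs2 : (span_of v s).2 = (span_of Q s) 0%N.
    rewrite -q2E -cME !span_comp; apply: eq_bigr => i _.
    by rewrite -[LHS]/(q2 (v i.1 i.2)) q2E -[RHS]/(cM (Q i.1 i.2)) cME vE QE /scal expr0 invr1 scale1r.
  have XShs : X (ShN (span_of P s)) = ShM (span_of Q s).
    by rewrite !span_comp; apply: eq_bigr => i _; exact: XSh.
  apply/eqP; rewrite -(@eqrXn2 _ 2)// -!dot_normE !dsum_dotE us1 us2 vs1 vs2.
  rewrite !XY XShs XE (l2_split ShNE (span_of P s)) (l2_split ShME (span_of Q s)).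
  by apply/eqP; ring.
have uv_le s : `|span_of v s| <= `|span_of u s| by rewrite uv.
have [W W1 WE] := contraction_extension [::] (comb _ _ u v) uv_le.
have Wuv w x : W ((u1 w x, x) : dsum (l2 N) N) = ((v1 w x, adjoint (S w) x) : dsum (l2 N) M).
  by have := WE [:: (w, x)]; rewrite !span_seq1 uE vE.
have [K [j [V [VV VE]]]] := isometric_dilation W1.
exists K, V, (fun w => bcomp j (v1 w)), (fun w => bcomp j (u1 w)); split=> //.
- move=> w x; rewrite /= VE ?Wuv//.
  by have := uv [:: (w, x)]; rewrite !span_seq1 uE vE.
- apply: bopP => x; rewrite /= ShP0.
  by rewrite !raddf0.
move=> a b ab; apply: bopP => x.
rewrite bopBE bopDE !bopZE /= (P_edge ShNE ab).
by rewrite !raddfB !raddfD /= !linearZ.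
Qed.

End Construction.

Lemma schur_realization : exists (H : hilbertType R) (A : bop H H) (B : bop M H)
    (C0 : bop H N) (D : bop M N),
  coisometry (block A B C0 D) /\ S = schur L A B C0 D mu.
Proof.
have [P PE] := P_exists; have [Q QE] := Q_exists.
have [H [V [Phi [Phi' [VV VE Phi'0 Phi'E]]]]] := model PE QE.
have [A [B [C0 [D TE]]]] := block_exists (adjoint V).
have co : coisometry (block A B C0 D) by rewrite /coisometry -TE adjointK.
exists H, A, B, C0, D; split=> //.
pose F w := adjoint (Phi w); pose F' w := adjoint (Phi' w).
(* The adjoint of the relation satisfied by V: [F S] = [F' I] U with U = V^*. *)
have key w k m : F w k + S w m = F' w (A k + B m) + (C0 k + D m).
  apply: dot_inj => x; rewrite !dotDl /F /F' -!adjointPr [dot (S w m) x]adjointP.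
  transitivity (dot ((k, m) : dsum H M) ((Phi w x, adjoint (S w) x) : dsum H M)) => //.
  by rewrite -VE (adjointPr V) TE -[dot (C0 k) x + _]dotDl.
have FE w : F w = bcomp (F' w) A + C0.
  apply: bopP => k; have := key w k 0.
  by rewrite !raddf0 !addr0.
have SE w : S w = bcomp (F' w) B + D.
  apply: bopP => m; have := key w 0 m.
  by rewrite !raddf0 !add0r.
have F'E a b : adj a b -> F' b = F' a +
    (mu^-1%:C%C * (2^-1 * (1 + (\val b - \val a)))) *: F a -
    (mu^-1%:C%C * (2^-1 * (1 - (\val b - \val a)))) *: F b.
  move=> ab; rewrite /F' (Phi'E _ _ ab) adjointD adjointN adjointD !adjointZ.
  by rewrite !rmorphM /= !conjCK !conjCR.
have A1 := coisometry_contraction co.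
have T_le := scaled_contraction mu1 A1.
pose T := mu^-1%:C%C *: A.
pose G w := bcomp C0 (resolvent L T w).
have G_DA : DA G by apply: (@DA_linear R L _ _ (bcomp C0)); exact: resolvent_DA mu1 T_le.
have GE w : G w = bcomp (mu^-1%:C%C *: Zplus G w) A + C0.
  rewrite /G (resolvent_eq mu1 T_le) bcompDr bcomp1r addrC; congr (_ + _).
  by rewrite (@Zplus_linear R L _ _ (bcomp C0)) /= bcompA /T bcompZr bcompZl.
have EA w : F w - G w = bcomp (F' w - mu^-1%:C%C *: Zplus G w) A.
  by rewrite FE GE opprD addrACA subrr addr0 bcompDl bcompNl.
(* Since S = F' B + D, it is enough to identify F' with the function that the resolvent produces. *)
suff eqF w : F' w = mu^-1%:C%C *: Zplus G w.
  apply/funext => w; rewrite schurE SE eqF addrC; congr (_ + _).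
  by rewrite bcompZl bcompZr.
elim/vertex_ind: w => [|a b ab IH].
  by rewrite (Zplus_origin G_DA) scaler0 /F' Phi'0 adjoint0.
have Fa : F a = G a.
  by apply/subr0_eq; rewrite EA IH subrr bcomp0l.
(* When the two candidates agree at a, their difference X at b satisfies X = - mu^-1 (1 - e) / 2 X
   A. As |1 - e| <= 2 and |A| <= 1, this gives |X| <= |X| / mu, hence X = 0. *)
set X := F' b - mu^-1%:C%C *: Zplus G b.
have XE : X = - ((mu^-1%:C%C * (2^-1 * (1 - (\val b - \val a)))) *: bcomp X A).
  rewrite {2}/X -EA {1}/X (F'E _ _ ab) (DA_edge_rel G_DA ab) Fa IH.
  rewrite !scalerBr !scalerDr !scalerA.
  set U := mu^-1%:C%C *: Zplus G a; set V1 := _ *: G a.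
  move: (_ *: F b) (_ *: G b) => x y.
  by rewrite opprB addrC addrA subrK opprB.
apply/subr0_eq/eqP; rewrite -/X -normr_le0.
have e1 := adj_unit ab.
have nX : `|X| <= mu^-1%:C%C * `|X|.
  rewrite {1}XE normrN normrZ normrM normCR (@ger0_norm _ mu^-1) ?invr_ge0 ?(ltW mu0)//.
  rewrite -mulrA ler_wpM2l ?ler0c ?invr_ge0 ?(ltW mu0)//.
  rewrite -[leRHS]mul1r ler_pM//; last first.
    by rewrite (le_trans (bcomp_norm _ _))// ler_piMr.
  rewrite normrM ger0_norm ?invr_ge0// ler_pdivrMl ?ltr0n// mulr1.
  by rewrite (le_trans (ler_normB _ _))// e1 normr1.
have mu10 : (0 : C) < 1 - mu^-1%:C%C.
  by rewrite subr_gt0 -[ltRHS]/(1%:C%C) ltcR invf_lt1.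
rewrite -(ler_pM2l mu10) mulr0 mulrBl mul1r subr_le0.
exact: nX.
Qed.

End Converse.

Theorem theorem4p5 (R : realType) (L : rhombic_lattice R) (M N : hilbertType R) :
  (forall (H : hilbertType R) (A : bop H H) (B : bop M H) (C : bop H N) (D : bop M N),
     coisometry (block A B C D) ->
     forall mu : R, 1 < mu ->
       let S := schur L A B C D mu in
       let F := fun z => bcomp C (resolvent L (mu^-1%:C%C *: A) z) in
       [/\ forall z w, cvgn (series (schur_term mu S z w)),
           forall z w, schur_kernel mu S z w = bcomp (F z) (adjoint (F w))
         & positive_kernel (schur_kernel mu S)]) /\
  (forall (mu : R) (S : vertex L -> bop M N),
     1 < mu -> DA S -> positive_kernel (schur_kernel mu S) ->
     exists (H : hilbertType R) (A : bop H H) (B : bop M H) (C : bop H N) (D : bop M N),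
       coisometry (block A B C D) /\ S = schur L A B C D mu).
Proof.
split=> [H A B C D co mu mu1|mu S mu1 S_DA K_pos].
  exact: schur_kernel_factor.
exact: schur_realization.
Qed.
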